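(* Let $\beta\ge0$ and let $s$, $r_1,\dots,r_s$ be positive integers with $1<s<q$ and $\sum_{i=1}^s r_i=q$. Assume that either (a) $r_i\le2$ for all $i$, or (b) $r_i\ge3$ for some $i$ and $\beta<\beta_c(r_* )$, where $r_*:=\min\{r\ge3: r=r_i\text{ for some }i\}$. Let $u_n\in\mathbb{T}_n^d$ with $u_n\to u\in\mathbb{T}^d$ and $\nu_n\in\mathcal{M}_{s,n}^{u_n}$ with $\nu_n\to\nu$ weakly. Then for every $k\in\{1,\dots,s\}$ $$\lim_{n\to\infty}\gamma^{u_n}_{n,\beta,q,(r_1,\dots,r_s)}(k\,|\,\nu_n)=\frac{r_k\exp\Big\{2\beta r_k^{-1}\int dv\,\nu[k](v)J(u-v)\Big\}\,D_{r_k}(u,\tilde\nu_k,\tilde\beta_k)}{\sum_{i=1}^s r_i\exp\Big\{2\beta r_i^{-1}\int dv\,\nu[i](v)J(u-v)\Big\}\,D_{r_i}(u,\tilde\nu_i,\tilde\beta_i)},$$ where $\nu[i](v)$ denotes the Lebesgue density of $\nu[i]$, $\tilde\nu_i:=\nu[i](\mathbb{T}^d)^{-1}\nu[i]$ and $\tilde\beta_i:=\nu[i](\mathbb{T}^d)\,\beta$.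
   Context: **Kac-Potts and fuzzy Kac-Potts model.** $\mathbb{T}^d=\mathbb{R}^d/\mathbb{Z}^d$ with Lebesgue measure $\lambda$; $\Delta_n^d=\mathbb{Z}^d/n\mathbb{Z}^d$; $\mathbb{T}_n^d=\Delta_n^d/n\subseteq\mathbb{T}^d$. $J:\mathbb{T}^d\to(0,\infty)$ is continuous, symmetric with $\int J\,d\lambda=1$. $\Omega_{q,n}=\{1,\dots,q\}^{\Delta_n^d}$. $\mu_n$ is the probability measure on $\Omega_{q,n}$ proportional to $\exp\big(\frac{\beta}{n^d}\sum_{x,y\in\Delta_n^d}J(\frac{x-y}{n})1_{\sigma(x)=\sigma(y)}\big)$. For a partition $R_1,\dots,R_s$ of $\{1,\dots,q\}$ with $|R_i|=r_i$, $T(a)=i$ for $a\in R_i$, and $T$ is applied sitewise; $\mu_n^T=\mu_n\circ T^{-1}$ on $\Omega_{s,n}$. **Kernels.** For $u\in\mathbb{T}^d_n$ and $\sigma\in\Omega_{s,n}$, $\pi_n^{(u)}(\sigma)$ is the probability measure on $\mathbb{T}^d\times\{1,\dots,s\}$ with components $\pi_n^{(u)}[a](\sigma)=\frac1{n^d-1}\sum_{x\in\Delta_n^d,\,x\ne nu}1_{\sigma(x)=a}\delta_{x/n}$; $\mathcal{M}^u_{s,n}=\pi_n^{(u)}(\Omega_{s,n})$; $\gamma^u_{n,\beta,q,(r_1,\dots,r_s)}(k\,|\,\nu):=\mu_n^T(\sigma(nu)=k\,|\,\pi_n^{(u)}(\sigma)=\nu)$. Any weak limit $\nu$ of $\nu_n\in\mathcal{M}_{s,n}^{u_n}$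 has components $\nu[a]$ with bounded Lebesgue densities summing to $1$ a.e. **Critical temperature.** $\beta_c(r)$ is the critical inverse temperature of the $r$-state mean-field Potts model with weights proportional to $\exp\big(\frac{\beta}{N}\sum_{x,y=1}^N1_{\sigma(x)=\sigma(y)}\big)$, i.e. the supremum of all $\beta\ge0$ for which the uniform distribution is the unique minimizer of $p\mapsto-\beta\sum_{a=1}^rp_a^2+\sum_{a=1}^rp_a\log(rp_a)$ over probability vectors; $\beta_c(r)=\frac{r-1}{r-2}\log(r-1)$ for $r\ge3$. **The function $D_r$.** For a bounded probability density $\tilde\rho$ on $\mathbb{T}^d$ and $\tilde\beta\ge0$, consider $$I_{\tilde\rho,\tilde\beta}(m)=\int du\,\tilde\rho(u)\Big\{-\frac{\tilde\beta}{2}\int dv\,\tilde\rho(v)m(u)m(v)J(u-v)+I(m(u))\Big\}$$ over measurable $m:\mathbb{T}^d\to[-1,1]$ (identified if equal $\tilde\rho\lambda$-a.e.), where $I(x)=\frac{1+x}2\log(1+x)+\frac{1-x}2\log(1-x)$, $I(\pm1)=\log2$. This functional has a unique non-negative global minimizer $m_{\tilde\rho,\tilde\beta}$ (identically zero, or positive $\tilde\rho\lambda$-a.e.); it satisfies $m(u)=\tanh\big(\tilde\beta\int dv\,\tilde\rho(v)m(v)J(u-v)\big)$ for $\tilde\rho\lambda$-a.e. $u$, and $m_{\tilde\rho,\tilde\beta}$ denotes the version for which this holds for all $u\in\mathbb{T}^d$. Define $$D_r(u,\tilde\rho,\tilde\beta)=1\ \text{ if } r\ne2,\qquad D_2(u,\tilde\rho,\tilde\beta)=\frac1{\sqrt{1-m_{\tilde\rho,\tilde\beta}(u)^2}}.$$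 If $\nu[i](\mathbb{T}^d)=0$, set $m_{\tilde\nu_i,\tilde\beta_i}=0$, so $D_{r_i}=1$. Measures $\tilde\nu_i$ are identified with their Lebesgue densities. *)

(* Defs.v *)
From HB Require Import structures.
From mathcomp Require Import all_boot all_order all_algebra.
From mathcomp Require Import all_classical all_reals all_analysis.
From mathcomp Require Import measurable_realfun.

Set Implicit Arguments.
Unset Strict Implicit.
Unset Printing Implicit Defensive.

Import Order.TTheory GRing.Theory Num.Theory.
Import numFieldNormedType.Exports.

Local Open Scope classical_set_scope.
Local Open Scope ring_scope.
Local Open Scope quotient_scope.

Definition int_lattice (R : realType) (d : nat) : {pred 'rV[R]_d} :=
  fun x => x \is a mxOver Num.int.

Section int_lattice.
Context (R : realType) (d : nat).

Fact int_lattice_closed : zmod_closed (@int_lattice R d).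
Proof.
split=> [|x y].
  by apply/mxOverP => i j; rewrite mxE rpred0.
move=> /mxOverP xZ /mxOverP yZ; apply/mxOverP => i j.
by rewrite !mxE rpredB.
Qed.

HB.instance Definition _ :=
  GRing.isZmodClosed.Build 'rV[R]_d (@int_lattice R d) int_lattice_closed.

End int_lattice.

(* R^d / Z^d with its quotient group structure, quotient topology and Borel
   sigma-algebra. *)
Definition torus (R : realType) (d : nat) : Type :=
  quotient_topology (Quotient.quot (@int_lattice R d : zmodClosed 'rV[R]_d)).

Section torus.
Context (R : realType) (d : nat).

HB.instance Definition _ := Topological.on (torus R d).
HB.instance Definition _ := Pointed.on (torus R d).
HB.instance Definition _ := Choice.on (torus R d).
HB.instance Definition _ :=
  GRing.Zmodule.copy (torus R d) (Quotient.quot (@int_lattice R d : zmodClosed 'rV[R]_d)).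
HB.instance Definition _ := isMeasurable.Build (sigma_display (@open (torus R d)))
  (torus R d) (@sigma_algebra0 _ setT (@open (torus R d)))
  (@sigma_algebraC (torus R d) open)
  (@sigma_algebra_bigcup _ setT (@open (torus R d))).
Definition to_torus (x : 'rV[R]_d) : torus R d :=
  \pi_(quotient_topology (Quotient.quot (@int_lattice R d : zmodClosed 'rV[R]_d))) x.

Lemma to_torus_continuous : continuous to_torus.
Proof. exact: pi_continuous. Qed.

Definition tuple_torus (t : d.-tuple (measurableTypeR R)) : torus R d :=
  to_torus (\row_i (tnth t i : R)).

Lemma measurable_tuple_torus : measurable_fun [set: d.-tuple (measurableTypeR R)] tuple_torus.
Proof.
apply: (@measurability _ _ _ _ _ _ (@open (torus R d))) => //.
move=> _ [U oU <-]; rewrite setTI.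
have oV : open (to_torus @^-1` U).
  by apply: open_comp => // x _; exact: to_torus_continuous.
pose box (a : 'rV[rat]_d * nat) :=
  [set t : d.-tuple (measurableTypeR R) | forall i, `|(tnth t i : R) - ratr (a.1 0 i)| < a.2.+1%:R^-1].
pose small (a : 'rV[rat]_d * nat) := forall y : 'rV[R]_d,
  (forall i, `|y 0 i - ratr (a.1 0 i)| < a.2.+1%:R^-1) -> U (to_torus y).
have -> : tuple_torus @^-1` U = \bigcup_a (if `[< small a >] then box a else set0).
  apply/seteqP; split => [t Ut|t [a _]]; last first.
    case: asboolP => // sa ta; apply: sa => i; rewrite mxE; exact: ta.
  have /nbhs_ballP[e /= e0 eU] : nbhs (\row_i (tnth t i : R) : 'rV[R]_d) (to_torus @^-1` U).
    exact: open_nbhs_nbhs.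
  have [k _ /(_ k (leqnn k)) /= ke] := near_infty_natSinv_lt (PosNum (divr_gt0 e0 (ltr0n R 2))).
  have qP i : exists q : rat, `|(tnth t i : R) - ratr q| < k.+1%:R^-1.
    have : tnth t i - k.+1%:R^-1 < tnth t i + k.+1%:R^-1.
      by rewrite ltrBlDr -addrA ltrDl addr_gt0// invr_gt0 ltr0n.
    move=> /rat_in_itvoo[q]; rewrite in_itv/= => /andP[q1 q2]; exists q.
    by rewrite distrC ltr_distl q1.
  exists (\row_i xchoose (qP i), k) => //; case: asboolP => [_ i|]/=.
    by rewrite mxE; exact: xchooseP (qP i).
  case => y /= yk; apply: eU; split => // i j; rewrite ord1 mxE /ball/=.
  rewrite -(subrK (ratr (xchoose (qP j))) (tnth t j)) -addrA.
  rewrite (le_lt_trans (ler_normD _ _))// (splitr e) ltrD//.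
    by rewrite (lt_trans _ ke)//; exact: xchooseP (qP j).
  by rewrite (lt_trans _ ke)// distrC; have := yk j; rewrite mxE.
apply: countable_bigcupT_measurable => [|a]; first exact: countableP.
case: asboolP => // _.
have -> : box a = \bigcap_(i in [set: 'I_d])
    ((@tnth d (measurableTypeR R))^~ i @^-1` [set x | `|x - ratr (a.1 0 i)| < a.2.+1%:R^-1]).
  by apply/seteqP; split => t /= h; [move=> i _; exact: h|move=> i; exact: h].
apply: fin_bigcap_measurable; first exact: finite_finset.
move=> i _; rewrite -[X in measurable X]setTI; apply: measurable_tnth => //.
have -> : [set x : R | `|x - ratr (a.1 0 i)| < a.2.+1%:R^-1] =
    ball (ratr (a.1 0 i) : R) a.2.+1%:R^-1.
  by apply/seteqP; split => x; rewrite /ball/= distrC.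
exact: measurable_ball.
Qed.

HB.instance Definition _ :=
  isMeasurableFun.Build _ _ _ _ tuple_torus measurable_tuple_torus.

End torus.

Section cube.
Context (R : realType).

Definition cons_pair n (p : measurableTypeR R * n.-tuple (measurableTypeR R)) : n.+1.-tuple (measurableTypeR R) :=
  [tuple of p.1 :: p.2].

Fact measurable_cons_pair n : measurable_fun setT (@cons_pair n).
Proof. exact: measurable_cons. Qed.

HB.instance Definition _ n :=
  isMeasurableFun.Build _ _ _ _ (@cons_pair n) (@measurable_cons_pair n).

(* Lebesgue measure on the unit cube [0,1]^n, as an n-fold product. *)
Fixpoint cube_prob (n : nat) : probability (n.-tuple (measurableTypeR R)) R :=
  match n return probability (n.-tuple (measurableTypeR R)) R with
  | 0%N => dirac [tuple]
  | n'.+1 =>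
    distribution (uniform_prob (@ltr01 R) \x cube_prob n')%E (@cons_pair n')
  end.

End cube.

(* The Lebesgue measure of the torus is the image of that of the unit cube. *)
Definition torus_lebesgue (R : realType) (d : nat) : probability (torus R d) R :=
  distribution (cube_prob R d) (@tuple_torus R d).

Section lattice.
Context (R : realType) (d n : nat).

(* Z^d / nZ^d; this is the intended group only for 1 < n, see zmodp.v. *)
Definition lattice := 'rV['Z_n]_d.

(* The point x / n of the torus. *)
Definition site (x : lattice) : torus R d :=
  to_torus (\row_i ((x 0 i : nat)%:R / n%:R)).

End lattice.

Arguments site R {d n} x.

Section model.
Context (R : realType) (d : nat) (J : torus R d -> R) (beta : R).

Section potts.
Context (q s : nat) (T : 'I_q -> 'I_s) (n : nat).

Definition potts_weight (sigma : {ffun lattice d n -> 'I_q}) : R :=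
  expR (beta / (n ^ d)%:R *
        \sum_x \sum_y J (site R (x - y)) * (sigma x == sigma y)%:R).

Definition potts_prob (A : {set {ffun lattice d n -> 'I_q}}) : R :=
  (\sum_(sigma in A) potts_weight sigma) / (\sum_sigma potts_weight sigma).

Definition fuzzy (sigma : {ffun lattice d n -> 'I_q}) :
  {ffun lattice d n -> 'I_s} := [ffun x => T (sigma x)].

Definition fuzzy_prob (A : {set {ffun lattice d n -> 'I_s}}) : R :=
  potts_prob (fuzzy @^-1: A).

End potts.

(* A measure on torus x {1..s} is given by its components nu a on the torus,
   a : 'I_s. *)

Definition same_measure (mu1 mu2 : set (torus R d) -> \bar R) : Prop :=
  forall A, measurable A -> mu1 A = mu2 A.

Section kernel.
Context (s n : nat).

(* pi_n^{(u)}[a](sigma), where u = x0 / n. *)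
Definition empirical (x0 : lattice d n) (sigma : {ffun lattice d n -> 'I_s})
    (a : 'I_s) (A : set (torus R d)) : \bar R :=
  (((n ^ d - 1)%N%:R^-1)%:E *
   \sum_(x | x != x0) ((sigma x == a)%:R)%:E * \d_(site R x) A)%E.

Definition empirical_is (x0 : lattice d n) (sigma : {ffun lattice d n -> 'I_s})
    (nu : 'I_s -> set (torus R d) -> \bar R) : Prop :=
  forall a, same_measure (empirical x0 sigma a) (nu a).

(* Elements of M_{s,n}^u. *)
Definition is_empirical (x0 : lattice d n)
    (nu : 'I_s -> set (torus R d) -> \bar R) : Prop :=
  exists sigma, empirical_is x0 sigma nu.

Definition fuzzy_kernel (q : nat) (T : 'I_q -> 'I_s) (x0 : lattice d n)
    (k : 'I_s) (nu : 'I_s -> set (torus R d) -> \bar R) : R :=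
  let Omega := {ffun lattice d n -> 'I_s} in
  let E := finset (fun sigma : Omega => `[< empirical_is x0 sigma nu >]) in
  let F := finset (fun sigma : Omega => sigma x0 == k) in
  fuzzy_prob T (E :&: F)%SET / fuzzy_prob T E.

End kernel.

(* Test functions on torus x {1..s} (discrete second factor) are families of
   continuous functions on the torus, automatically bounded. *)
Definition weak_cvg (s : nat)
    (nun : nat -> 'I_s -> {finite_measure set (torus R d) -> \bar R})
    (nu : 'I_s -> {finite_measure set (torus R d) -> \bar R}) : Prop :=
  forall f : 'I_s -> torus R d -> R, (forall a, continuous (f a)) ->
    (\sum_a \int[nun n a]_v f a v) @[n --> \oo] --> \sum_a \int[nu a]_v f a v.

Local Notation lambda := (torus_lebesgue R d).

(* The Lebesgue density, as the Radon-Nikodym derivative of the library; it is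
   determined up to null sets and only ever used under an integral. *)
Definition density (nu : {finite_measure set (torus R d) -> \bar R})
    (v : torus R d) : R :=
  fine (Radon_Nikodym (charge_of_finite_measure nu) lambda v).

Definition mass (nu : {finite_measure set (torus R d) -> \bar R}) : R :=
  fine (nu setT).

Definition normalized_density (nu : {finite_measure set (torus R d) -> \bar R})
    (v : torus R d) : R := (mass nu)^-1 * density nu v.

(* The convention I(+-1) = log 2 holds since ln 0 = 0. *)
Definition Ising_entropy (x : R) : R :=
  (1 + x) / 2 * ln (1 + x) + (1 - x) / 2 * ln (1 - x).

Definition Ising_functional (rho : torus R d -> R) (b : R)
    (m : torus R d -> R) : R :=
  \int[lambda]_u (rho u *
    (- (b / 2) * (\int[lambda]_v (rho v * m u * m v * J (u - v)))
     + Ising_entropy (m u))).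

Definition magnetization (m : torus R d -> R) : Prop :=
  measurable_fun setT m /\ forall u, -1 <= m u <= 1.

Definition tanh (x : R) : R :=
  (expR x - expR (- x)) / (expR x + expR (- x)).

(* The version of the non-negative global minimizer that solves the mean-field
   equation at every point of the torus. *)
Definition is_nonneg_minimizer (rho : torus R d -> R) (b : R)
    (m : torus R d -> R) : Prop :=
  [/\ magnetization m,
      forall u, 0 <= m u,
      forall m', magnetization m' ->
        Ising_functional rho b m <= Ising_functional rho b m'
    & forall u, m u = tanh (b * \int[lambda]_v (rho v * m v * J (u - v)))].

Definition nonneg_minimizer (rho : torus R d -> R) (b : R) : torus R d -> R :=
  xget (fun=> 0) [set m | is_nonneg_minimizer rho b m].

Definition Dfun (r : nat) (u : torus R d) (rho : torus R d -> R) (b : R) : R :=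
  if r == 2%N then (Num.sqrt (1 - nonneg_minimizer rho b u ^+ 2))^-1 else 1.

(* D_r(u, nu~, beta~), equal to 1 by convention when nu has no mass. *)
Definition Dcomp (r : nat) (u : torus R d)
    (nu : {finite_measure set (torus R d) -> \bar R}) : R :=
  if mass nu == 0 then 1
  else Dfun r u (normalized_density nu) (mass nu * beta).

Definition limit_weight (r : nat) (u : torus R d)
    (nu : {finite_measure set (torus R d) -> \bar R}) : R :=
  r%:R * expR (2 * beta / r%:R * \int[lambda]_v (density nu v * J (u - v)))
  * Dcomp r u nu.

End model.

Definition prob_vector (R : realType) (r : nat) (p : 'I_r -> R) : Prop :=
  (forall a, 0 <= p a) /\ \sum_a p a = 1.

(* The mean-field Potts free energy, with 0 log 0 = 0 since ln 0 = 0. *)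
Definition Potts_free_energy (R : realType) (r : nat) (b : R) (p : 'I_r -> R) : R :=
  - b * (\sum_a p a ^+ 2) + \sum_a p a * ln (r%:R * p a).

Definition uniform_unique_minimizer (R : realType) (r : nat) (b : R) : Prop :=
  forall p : 'I_r -> R,
    (prob_vector p /\ forall p' : 'I_r -> R, prob_vector p' ->
       Potts_free_energy b p <= Potts_free_energy b p')
    <-> p = (fun=> r%:R^-1).

Definition beta_c (R : realType) (r : nat) : R :=
  sup [set b : R | 0 <= b /\ uniform_unique_minimizer r b].

Definition is_rstar (s : nat) (r : 'I_s -> nat) (k : nat) : Prop :=
  [/\ (3 <= k)%N, exists i, r i = k & forall i, (3 <= r i)%N -> (k <= r i)%N].

(* Main.v *)
(* The conditional law at the pinned site is a quotient of Gibbs expectations,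
   over the spins off that site constrained to the fuzzy classes prescribed by
   nu_n, of sums of exponentials of the local fields.  Cutting the torus into
   finitely many cells on which J hardly varies, the weight of the spin
   configurations with a given block profile is, up to subexponential factors,
   the exponential of a mean-field free energy, which splits over the fuzzy
   classes; so it suffices to see that near-minimizers of each class free energy
   have nearly the same local field.  For r <> 2 a Pinsker-type inequality, which
   holds below beta_c(r) and is inherited by larger r through the Kearns-Saul
   inequality, forces the profile to be uniform in L^2.  For r = 2 the free
   energy is an Ising one; its minimizers are +-m, with m the limit of the
   decreasing iteration of the mean-field map, and strong convexity of the Ising
   entropy in m^2 together with positivity of J gives the stability.  The two
   signs contribute the factor cosh(h(u)) = 1 / sqrt(1 - m(u)^2). *)

(* Everything is quantitative at finite volume, so neither existence nor compactness of minimizers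
   enters. On the exponential scale [n ^ d] a wrong local field costs a fixed multiple [dl] of the
   volume, the block approximation an arbitrarily small one, and block profiles are only
   polynomially many. Each class therefore has to supply just one comparison profile that is nearly
   optimal and beats every profile with a wrong field by [dl] per site.

   The obstacle is a class of size two, where the minimizer is not unique and may vanish.
   Non-uniqueness is harmless because the two colours contribute an even function of the field: it
   suffices to control [m ^ 2] and to exclude a mixture of signs, whose cost is the product of the
   masses of both signs times the minimum of [J]. Vanishing matters because the quadratic-form
   estimate divides by the comparison function. The iterates are used instead of their limit: they
   are positive, and the external field makes them strict supersolutions, with a slack that absorbs
   the error of replacing [nu] by an empirical measure. *)
Require Import Defs.
From mathcomp Require Import all_boot all_order all_algebra.
From mathcomp Require Import all_classical all_reals all_analysis.
From mathcomp Require Import measurable_realfun finmap ring lra.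

Set Implicit Arguments.
Unset Strict Implicit.
Unset Printing Implicit Defensive.

Import Order.TTheory GRing.Theory Num.Theory.
Import numFieldNormedType.Exports.

Local Open Scope classical_set_scope.
Local Open Scope ring_scope.

(** * The torus *)

Section torus_topology.
Local Open Scope quotient_scope.
Context {R : realType} {d : nat}.
Implicit Types (x y : 'rV[R]_d) (u v : torus R d).

Lemma to_torusB x y : to_torus (x - y) = to_torus x - to_torus y.
Proof. exact: pi_is_zmod_morphism. Qed.

Lemma to_torus_surj u : exists x, to_torus x = u.
Proof. by exists (repr u); exact: reprK. Qed.

Lemma to_torus_eq x y :
  (to_torus x = to_torus y) <-> (x - y \is a mxOver Num.int).
Proof.
split => [h|h].
  have /eqmodP : \pi_(Quotient.quot (@int_lattice R d : zmodClosed 'rV[R]_d)) x = \pi_(Quotient.quot (@int_lattice R d : zmodClosed 'rV[R]_d)) y by exact: h.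
  by rewrite /= /Quotient.equiv.
have : x = y %[mod Quotient.quot (@int_lattice R d : zmodClosed 'rV[R]_d)].
  by apply/eqmodP.
by [].
Qed.

Lemma continuous_torus (T : topologicalType) (f : torus R d -> T) :
  continuous (f \o @to_torus R d) -> continuous f.
Proof.
move=> /continuousP fc; apply/continuousP => A oA.
exact: (fc _ oA).
Qed.

Lemma to_torus_box u : exists2 x : 'rV[R]_d, (forall i, x 0 i \in `[0, 1]) & to_torus x = u.
Proof.
have [x <-] := to_torus_surj u.
exists (\row_i (x 0 i - (Num.floor (x 0 i))%:~R)).
  move=> i; rewrite mxE in_itv/= subr_ge0 ge_floor/= lerBlDr ltW//.
  by have := floorD1_gt (x 0 i); rewrite intrD addrC.
apply/to_torus_eq/mxOverP => i j; rewrite !mxE ord1.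
by rewrite addrAC subrr sub0r rpredN intr_int.
Qed.

Lemma compact_box : compact [set x : 'rV[R]_d | forall i, x 0 i \in `[0, 1]].
Proof.
have := @rV_compact R d (fun=> `[0, 1]%classic) (fun i => @segment_compact R 0 1).
congr compact.
Qed.

Lemma compact_torus : compact [set: torus R d].
Proof.
have := continuous_compact (continuous_subspaceT (@to_torus_continuous R d)) compact_box.
congr compact; apply/seteqP; split => // u _.
by have [x xb <-] := to_torus_box u; exists x.
Qed.

(** * Translates of the interaction [J] *)

Section kernel.
Variables (J : torus R d -> R) (Jc : continuous J).

Lemma to_torus_sub_continuous : continuous (fun z : 'rV[R]_d * 'rV[R]_d => to_torus (z.1 - z.2)).
Proof.
move=> z; apply: continuous_comp; last exact: to_torus_continuous.
apply: continuousB; [exact: cvg_fst|exact: cvg_snd].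
Qed.

(** The subtraction is lifted to representatives in ['rV[R]_d], where it is continuous, and pushed
    down again by [continuous_torus]. *)
Lemma J_sub_continuous v : continuous (fun u => J (u - v)).
Proof.
have [y <-] := to_torus_surj v.
apply: continuous_torus => x /=.
have -> : (fun u => J (u - to_torus y)) \o @to_torus R d = (fun x => J (to_torus (x - y))).
  by apply/funext => z /=; rewrite to_torusB.
apply: (@continuous_comp _ _ _ (fun x => to_torus (x - y)) J); last exact: Jc.
apply: (@continuous_comp _ _ _ (fun x => x - y) (@to_torus R d)); last exact: to_torus_continuous.
by apply: continuousD; [exact: cvg_id|exact: cst_continuous].
Qed.

(** Continuity of [J] at [x - y] gives a neighbourhood of [x] that depends on [y]; compactness of
    the box of representatives makes it uniform. *)
Lemma J_equicontinuous x (e : R) : 0 < e ->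
  \forall x' \near x, forall v, `|J (to_torus x' - v) - J (to_torus x - v)| <= e.
Proof.
move=> e0.
have /compact_near_coveringP /(_ _ (nbhs x)
    (fun x' y => `|J (to_torus (x' - y)) - J (to_torus (x - y))| <= e) _) := compact_box.
move=> cov.
apply: filterS; last apply: cov.
  move=> x' h v; have [y yb <-] := to_torus_box v.
  by rewrite -!to_torusB; exact: h.
move=> y yb /=.
have Jz : {for (x, y), continuous (fun z : 'rV[R]_d * 'rV[R]_d => J (to_torus (z.1 - z.2)))}.
  apply: (@continuous_comp _ _ _ (fun z : 'rV[R]_d * 'rV[R]_d => to_torus (z.1 - z.2)) J).
    exact: to_torus_sub_continuous.
  exact: Jc.
(* Both [J (x' - y')] and [J (x - y')] are compared with [J (x - y)], hence the half. *)
have e20 : 0 < e / 2 by rewrite divr_gt0.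
have := Jz _ (nbhsx_ballx (J (to_torus (x - y))) _ e20).
move=> [[A B] /= [Ax By] AB].
exists (B, A) => //= -[y' x'] /= [By' Ax'].
have h1 := AB (x', y') (conj Ax' By').
have h2 := AB (x, y') (conj (nbhs_singleton Ax) By').
rewrite /ball/= in h1 h2.
rewrite (splitr e) -(subrK (J (to_torus (x - y))) (J (to_torus (x' - y')))) -addrA.
by rewrite (le_trans (ler_normD _ _))// lerD// ltW// distrC.
Qed.

(** Total boundedness of the family of translates in the uniform norm. Cells of the torus are
    defined by the nearest element of such a net, so that [J] varies little on them by
    construction. *)
Lemma J_net (e : R) : 0 < e ->
  exists L : nat, exists c : 'I_L.+1 -> torus R d,
    forall u, exists i, forall v, `|J (u - v) - J (c i - v)| <= e.
Proof.
move=> e0; have := compact_box; rewrite compact_cover.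
pose f (x : 'rV[R]_d) := interior [set x' | forall v, `|J (to_torus x' - v) - J (to_torus x - v)| <= e].
move=> /(_ _ setT f (fun i _ => open_interior _)) [|D' _ cov].
  by move=> x _; exists x => //; exact: J_equicontinuous.
(* The extra [0] keeps the list of centres nonempty, to match ['I_L.+1]. *)
pose s := 0 :: enum_fset D'.
exists (size (enum_fset D')), (fun i => to_torus (nth 0 s i)) => u.
have [x xb <-] := to_torus_box u.
have [y yD /interior_subset fy] := cov x xb.
have ys : y \in s by rewrite inE; apply/orP; right; exact: yD.
have ys' : (index y s < (size (enum_fset D')).+1)%N by rewrite -[X in (_ < X)%N]/(size s) index_mem.
by exists (Ordinal ys') => v /=; rewrite nth_index.
Qed.

Lemma J_lower : (forall v, 0 < J v) -> exists2 c : R, 0 < c & forall v, c <= J v.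
Proof.
move=> J0.
have ne : [set: torus R d] !=set0 by exists (to_torus 0).
have [v _ vm] := compact_EVT_min ne compact_torus (continuous_subspaceT Jc).
by exists (J v) => // w; apply: vm; exact: mem_set.
Qed.

End kernel.

Lemma continuous_torus_bounded (f : torus R d -> R) : continuous f ->
  exists M, forall u, `|f u| <= M.
Proof.
move=> fc.
have nc : continuous (fun u => `|f u|).
  by move=> u; apply: (@continuous_comp _ _ _ f (@Num.norm R R)); [exact: fc|exact: norm_continuous].
have ne : [set: torus R d] !=set0 by exists (to_torus 0).
have [v _ vm] := compact_EVT_max ne compact_torus (continuous_subspaceT nc).
by exists `|f v| => u; apply: vm; exact: mem_set.
Qed.

Lemma open_measurable_torus (A : set (torus R d)) : open A -> measurable A.
Proof. by move=> oA; exact: sub_sigma_algebra. Qed.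

Lemma closed_measurable_torus (A : set (torus R d)) : closed A -> measurable A.
Proof.
move=> /closed_openC oA; rewrite -[A]setCK; apply: measurableC.
exact: open_measurable_torus.
Qed.

Lemma continuous_measurable_torus (f : torus R d -> R) : continuous f ->
  measurable_fun setT f.
Proof.
move=> /continuousP fc.
apply: (measurability _ (RGenOpens.measurableE R)).
move=> _ [U [a [b ->]] <-]; rewrite setTI; apply: open_measurable_torus.
by apply: fc; exact: interval_open.
Qed.

End torus_topology.

(** * The Ising entropy *)

Section derive1.
Context {R : realType}.
Implicit Types (f g : R -> R) (x : R).

Lemma is_derive1D f g x a b : is_derive x 1 f a -> is_derive x 1 g b ->
  is_derive x 1 (fun y => f y + g y) (a + b).
Proof. by move=> *; exact: is_deriveD. Qed.

Lemma is_derive1N f x a : is_derive x 1 f a -> is_derive x 1 (fun y => - f y) (- a).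
Proof. by move=> *; exact: is_deriveN. Qed.

Lemma is_derive1M f g x a b : is_derive x 1 f a -> is_derive x 1 g b ->
  is_derive x 1 (fun y => f y * g y) (f x * b + g x * a).
Proof. by move=> *; exact: is_deriveM. Qed.

Lemma is_derive1_id x : is_derive x 1 (fun y => y) 1.
Proof. exact: is_derive_id. Qed.

Lemma is_derive1_cst (a : R) x : is_derive x 1 (fun=> a) 0.
Proof. exact: is_derive_cst. Qed.

Lemma is_derive1Dl c x : is_derive x 1 (+%R c) 1.
Proof. by rewrite -[X in is_derive _ _ _ X]add0r; exact: (is_derive1D (is_derive1_cst c x) (is_derive1_id x)). Qed.

Lemma is_derive1Nid x : is_derive x 1 (@GRing.opp R) (- 1).
Proof. exact: (is_derive1N (is_derive1_id x)). Qed.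

Lemma is_derive1Ml c x : is_derive x 1 ( *%R c) c.
Proof. by rewrite -[X in is_derive _ _ _ X]addr0 -{2}[c]mulr1 -[X in _ + X](mulr0 x); exact: (is_derive1M (is_derive1_cst c x) (is_derive1_id x)). Qed.

Lemma is_derive1X f n x a : is_derive x 1 f a ->
  is_derive x 1 (fun y => f y ^+ n) (n%:R * f x ^+ n.-1 * a).
Proof.
move=> fa; elim: n => [|n IH].
  under eq_fun do rewrite expr0.
  by rewrite !mul0r; exact: is_derive1_cst.
under eq_fun do rewrite exprS.
apply: (is_derive_eq (is_derive1M fa IH)) => /=.
case: n {IH} => [|n]; first by rewrite !(expr0, mul0r, mulr0, mulr1, mul1r, add0r).
by rewrite /= (exprS _ n) [in RHS]mulrS; ring.
Qed.

Lemma is_derive1_expR f x a : is_derive x 1 f a ->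
  is_derive x 1 (fun y => expR (f y)) (a * expR (f x)).
Proof. by move=> fa; rewrite mulrC; apply: (@is_derive1_comp _ expR f); exact: is_derive_expR. Qed.

Lemma is_derive1_lnf f x a : is_derive x 1 f a -> 0 < f x ->
  is_derive x 1 (fun y => ln (f y)) (a / f x).
Proof.
by move=> fa f0; rewrite mulrC; apply: (@is_derive1_comp _ (@ln R) f); exact: is_derive1_ln.
Qed.

Lemma is_derive1V f x a : is_derive x 1 f a -> f x != 0 ->
  is_derive x 1 (fun y => (f y)^-1) (- a / f x ^+ 2).
Proof.
move=> fa f0; have h := @is_deriveV R f x a 1 f0 fa.
by apply: (is_derive_eq h); rewrite /= /GRing.scale/= !mulNr mulrC.
Qed.

Lemma is_derive1Vid x : x != 0 -> is_derive x 1 (@GRing.inv R) (- 1 / x ^+ 2).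
Proof. exact: (is_derive1V (is_derive1_id x)). Qed.

Lemma is_derive1_continuous f x a : is_derive x 1 f a -> {for x, continuous f}.
Proof. by move=> [fd _]; apply/differentiable_continuous/derivable1_diffP. Qed.

Lemma derive1_ge0_le f df a b : a <= b ->
  (forall x, a <= x <= b -> is_derive x 1 f (df x)) ->
  (forall x, a < x < b -> 0 <= df x) -> f a <= f b.
Proof.
rewrite le_eqVlt => /predU1P[->//|ab] fd df0.
have [||c] := @MVT R f df a b ab.
  by move=> x; rewrite in_itv/= => /andP[ax xb]; apply: fd; rewrite !ltW.
  apply: continuous_in_subspaceT => z /set_mem /=; rewrite in_itv/= => zab.
  by apply/differentiable_continuous/derivable1_diffP; have [] := fd _ zab.
rewrite in_itv/= => cab fE; rewrite -subr_ge0 fE mulr_ge0 ?df0//.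
  by rewrite subr_ge0 ltW.
Qed.

Lemma derive1_le0_le f df a b : a <= b ->
  (forall x, a <= x <= b -> is_derive x 1 f (df x)) ->
  (forall x, a < x < b -> df x <= 0) -> f b <= f a.
Proof.
move=> ab fd df0; rewrite -lerN2.
apply: (@derive1_ge0_le (fun x => - f x) (fun x => - df x)) => // x xab.
  by apply: is_derive1N; exact: fd.
by rewrite oppr_ge0; exact: df0.
Qed.

End derive1.

(** Recursion on the head symbol of the function, with constants tried before anything else and
    sections such as [+%R c] caught at the end. What remains are the derivatives of unknown
    functions and the conditions under inverses and logarithms. *)
Ltac derive1_tac :=
  tryif notypeclasses refine (@is_derive1_cst _ _ _) then idtac else
  lazymatch goal with
  | |- is_derive _ _ (fun y => y) _ => notypeclasses refine (@is_derive1_id _ _)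
  | |- is_derive _ _ (fun y => @GRing.add _ _ _) _ => notypeclasses refine (@is_derive1D _ _ _ _ _ _ _ _); derive1_tac
  | |- is_derive _ _ (fun y => @Algebra.add _ _ _) _ => notypeclasses refine (@is_derive1D _ _ _ _ _ _ _ _); derive1_tac
  | |- is_derive _ _ (fun y => @GRing.opp _ _) _ => notypeclasses refine (@is_derive1N _ _ _ _ _); derive1_tac
  | |- is_derive _ _ (fun y => @Algebra.opp _ _) _ => notypeclasses refine (@is_derive1N _ _ _ _ _); derive1_tac
  | |- is_derive _ _ (fun y => @GRing.mul _ _ _) _ => notypeclasses refine (@is_derive1M _ _ _ _ _ _ _ _); derive1_tac
  | |- is_derive _ _ (fun y => @GRing.exp _ _ _) _ => notypeclasses refine (@is_derive1X _ _ _ _ _ _); derive1_tac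
  | |- is_derive _ _ (fun y => @GRing.inv _ _) _ => notypeclasses refine (@is_derive1V _ _ _ _ _ _); derive1_tac
  | |- is_derive _ _ (fun y => ln _) _ => notypeclasses refine (@is_derive1_lnf _ _ _ _ _ _); derive1_tac
  | |- is_derive _ _ (fun y => expR _) _ => notypeclasses refine (@is_derive1_expR _ _ _ _ _); derive1_tac
  | |- is_derive _ _ (+%R _) _ => notypeclasses refine (@is_derive1Dl _ _ _)
  | |- is_derive _ _ ( *%R _) _ => notypeclasses refine (@is_derive1Ml _ _ _)
  | |- is_derive _ _ (@GRing.inv _) _ => notypeclasses refine (@is_derive1Vid _ _ _)
  | |- is_derive _ _ (@ln _) _ => notypeclasses refine (@is_derive1_ln _ _ _)
  | |- is_derive _ _ (@expR _) _ => notypeclasses refine (@is_derive_expR _ _)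
  | |- is_derive _ _ -%R _ => notypeclasses refine (@is_derive1Nid _ _)
  | |- _ => idtac
  end.

(** * Entropy, [artanh], [tanh] and [cosh] *)

Section ising.
Context {R : realType}.
Implicit Types (x m w h : R).

Definition artanh x : R := (ln (1 + x) - ln (1 - x)) / 2.

Lemma is_derive_artanh x : -1 < x < 1 -> is_derive x 1 artanh (1 - x ^+ 2)^-1.
Proof.
move=> /andP[x1 x2].
have p1 : 0 < 1 + x by lra.
have p2 : 0 < 1 - x by lra.
have -> : artanh = fun x => (ln (1 + x) - ln (1 - x)) * 2^-1 by [].
notypeclasses refine (is_derive_eq _ _); first by derive1_tac.
have -> : 1 - x ^+ 2 = (1 - x) * (1 + x) by ring.
by field; rewrite ?lt0r_neq0.
Qed.

(** This is the sign of the numerator of the derivative in [artanh_div_mono]. The difference of the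
    two sides vanishes at [0] and has derivative [2 * y ^+ 2 * ((1 - y ^+ 2) ^- 2 - 1)]. *)
Lemma artanh_cubic x : 0 <= x < 1 -> artanh x + 2 / 3 * x ^+ 3 <= x / (1 - x ^+ 2).
Proof.
move=> /andP[x0 x1].
pose f (y : R) : R := y * (1 - y ^+ 2)^-1 - (artanh y + 2 / 3 * y ^+ 3).
pose df (y : R) : R := 2 * y ^+ 2 * ((1 - y ^+ 2) ^- 2 - 1).
have y2 (y : R) : 0 <= y < 1 -> 0 < 1 - y ^+ 2 <= 1.
  by move=> /andP[y0 y1]; nra.
rewrite -subr_ge0 -/(f x).
have <- : f 0 = 0 by rewrite /f /artanh addr0 subr0 subrr !mul0r expr0n/= mulr0 addr0 subrr.
apply: (@derive1_ge0_le _ f df) => // y /andP[y0 yx].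
  have /y2/andP[yp _] : 0 <= y < 1 by rewrite y0 (le_lt_trans yx).
  rewrite /f; notypeclasses refine (is_derive_eq _ _).
    derive1_tac; first exact: lt0r_neq0.
    by apply: is_derive_artanh; lra.
  by rewrite /df /=; field; exact: lt0r_neq0.
have /y2/andP[yp yl] : 0 <= y < 1 by rewrite (ltW y0) (lt_trans yx).
rewrite /df; apply: mulr_ge0; first by rewrite mulr_ge0 ?sqr_ge0.
by rewrite subr_ge0 invf_ge1 ?exprn_gt0// expr_le1// ltW.
Qed.

(** As a function of [m ^ 2] the Ising entropy has derivative [artanh m / (2 * m)]. Monotonicity
    after subtracting [x ^+ 2 / 3] says that its second derivative in [m ^ 2] is at least [1 / 6],
    the source of the constant [1 / 12] below. *)
Lemma artanh_div_mono x y : 0 < x -> x <= y -> y < 1 ->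
  artanh x / x - x ^+ 2 / 3 <= artanh y / y - y ^+ 2 / 3.
Proof.
move=> x0 xy y1.
apply: (@derive1_ge0_le _ (fun z : R => artanh z * z^-1 - z ^+ 2 * 3^-1)
   (fun z : R => (z / (1 - z ^+ 2) - (artanh z + 2 / 3 * z ^+ 3)) / z ^+ 2)) => // z /andP[xz zy].
  have z0 : 0 < z by apply: lt_le_trans xz.
  have z1 : z < 1 by apply: le_lt_trans zy _.
  have z2 : 0 < 1 - z ^+ 2 by nra.
  notypeclasses refine (is_derive_eq _ _).
    derive1_tac; last exact: lt0r_neq0.
    by apply: is_derive_artanh; lra.
  by rewrite /=; field; rewrite !lt0r_neq0.
rewrite divr_ge0 ?sqr_ge0// subr_ge0 artanh_cubic//.
by rewrite (ltW (lt_trans x0 xz)) (lt_trans zy).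
Qed.

Lemma Ising_entropyN m : Ising_entropy (- m) = Ising_entropy m.
Proof. by rewrite /Ising_entropy opprK addrC. Qed.

Lemma is_derive_Ising_entropy x : -1 < x < 1 -> is_derive x 1 (@Ising_entropy R) (artanh x).
Proof.
move=> /andP[x1 x2].
have p1 : 0 < 1 + x by lra.
have p2 : 0 < 1 - x by lra.
have -> : @Ising_entropy R = fun x => (1 + x) * 2^-1 * ln (1 + x) + (1 - x) * 2^-1 * ln (1 - x) by [].
notypeclasses refine (is_derive_eq _ _); first by derive1_tac.
by rewrite /artanh; field; rewrite ?lt0r_neq0.
Qed.

Lemma Ising_entropy_le m : -1 <= m <= 1 -> Ising_entropy m <= ln 2.
Proof.
move=> /andP[m1 m2]; rewrite /Ising_entropy.
have l (x : R) : 0 <= x <= 2 -> x / 2 * ln x <= x / 2 * ln 2.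
  move=> /andP[x0 x2]; have [->|xn0] := eqVneq x 0; first by rewrite !mul0r.
  rewrite ler_wpM2l ?divr_ge0// ler_ln ?posrE//.
  by rewrite lt0r xn0.
apply: (le_trans (lerD (l _ _) (l _ _))); [lra|lra|].
by rewrite le_eqVlt; apply/orP; left; apply/eqP; field.
Qed.

Lemma Ising_entropy1 : Ising_entropy 1 = ln 2 :> R.
Proof.
rewrite /Ising_entropy subrr !mul0r addr0.
by have -> : 1 + 1 = 2 :> R by []; rewrite divff ?mul1r.
Qed.

(* Strong convexity of the Ising entropy as a function of [m ^ 2]: it lies above
   its tangent at [w ^ 2] with a quadratic gap. *)
Lemma Ising_entropy_tangent w m : 0 < w < 1 -> -1 <= m <= 1 ->
  Ising_entropy w + (m ^+ 2 - w ^+ 2) * (artanh w / (2 * w)) + (m ^+ 2 - w ^+ 2) ^+ 2 / 12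
  <= Ising_entropy m.
Proof.
move=> /andP[w0 w1].
(* Both sides are even in [m]. *)
wlog m0 : m / 0 <= m.
  move=> H /andP[m1 m2]; have [/H|m0] := leP 0 m; first by apply; rewrite m1.
  by rewrite -(Ising_entropyN m) -(sqrrN m); apply: H; lra.
move=> /andP[_].
pose k := artanh w / (2 * w).
pose G (x : R) : R := Ising_entropy x - (x ^+ 2 - w ^+ 2) * k - (x ^+ 2 - w ^+ 2) ^+ 2 * 12^-1.
pose dG (x : R) : R := artanh x - 2 * x * k - x * (x ^+ 2 - w ^+ 2) / 3.
have dGP (x : R) : 0 <= x < 1 -> is_derive x 1 G (dG x).
  move=> /andP[x0 x1]; rewrite /G; notypeclasses refine (is_derive_eq _ _).
    derive1_tac.
    by apply: is_derive_Ising_entropy; lra.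
  by rewrite /dG /=; field.
have dGE (x : R) : 0 < x -> dG x = x * ((artanh x / x - x ^+ 2 / 3) - (artanh w / w - w ^+ 2 / 3)).
  by move=> x0; rewrite /dG /k; field; rewrite ?lt0r_neq0.
have main (x : R) : 0 <= x < 1 -> Ising_entropy w + (x ^+ 2 - w ^+ 2) * k + (x ^+ 2 - w ^+ 2) ^+ 2 / 12 <= Ising_entropy x.
  move=> /andP[x0 x1].
  suff : G w <= G x by rewrite /G subrr !mul0r expr0n/= mul0r !subr0; lra.
  have [xw|wx] := leP x w.
    notypeclasses refine (@derive1_le0_le _ G dG _ _ xw _ _) => y /andP[xy yw].
      by apply: dGP; rewrite (le_trans x0 xy) (le_lt_trans yw).
    have y0 : 0 < y by apply: le_lt_trans xy.
    rewrite dGE// mulr_ge0_le0 ?(ltW y0)// subr_le0.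
    by apply: artanh_div_mono => //; exact: ltW.
  notypeclasses refine (@derive1_ge0_le _ G dG _ _ (ltW wx) _ _) => y /andP[xy yw].
    by apply: dGP; rewrite (le_trans (ltW w0) xy) (le_lt_trans yw).
  have y0 : 0 < y by apply: lt_trans xy.
  rewrite dGE// mulr_ge0 ?(ltW y0)// subr_ge0.
  by apply: artanh_div_mono => //; [exact: ltW|exact: lt_trans x1].
rewrite le_eqVlt => /predU1P[->|m1]; last by apply: main; rewrite m0.
(* At [m = 1] the entropy is not differentiable. If the left side exceeded [ln 2] there, it would do
   so slightly to the left as well, against the case already proved and [Ising_entropy_le]. *)
rewrite Ising_entropy1.
pose P (x : R) : R := Ising_entropy w + (x ^+ 2 - w ^+ 2) * k + (x ^+ 2 - w ^+ 2) ^+ 2 * 12^-1.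
have Pc : {for 1, continuous P}.
  notypeclasses refine (is_derive1_continuous (_ : is_derive _ _ P _)).
  by rewrite /P; derive1_tac.
rewrite -/(P 1) leNgt; apply/negP => hP.
have /nbhs_ballP[e /= e0 He] : \forall x \near (1 : R), ln 2 < P x.
  by apply: (@cvgr_gt _ _ (nbhs (1 : R)) _ P (P 1)).
have me : 0 < Num.min (e / 2) 2^-1 by rewrite lt_min divr_gt0//=.
have me2 : Num.min (e / 2) 2^-1 <= 2^-1 by rewrite ge_min lexx orbT.
have me1 : Num.min (e / 2) 2^-1 <= e / 2 by rewrite ge_min lexx.
have b1 : ball (1 : R) e (1 - Num.min (e / 2) 2^-1).
  rewrite /ball/= opprB addrC subrK gtr0_norm//.
  by apply: le_lt_trans me1 _; rewrite ltr_pdivrMr//; lra.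
have b2 : 0 <= 1 - Num.min (e / 2) 2^-1 < 1 by lra.
have := He _ b1; rewrite /= ltNge => /negP; apply.
apply: (le_trans (main _ b2)); apply: Ising_entropy_le; lra.
Qed.

Definition cosh h : R := (expR h + expR (- h)) / 2.

Lemma cosh_gt0 h : 0 < cosh h.
Proof. by rewrite divr_gt0// addr_gt0 ?expR_gt0. Qed.

Lemma sum_expR_gt0 h : 0 < expR h + expR (- h).
Proof. by rewrite addr_gt0 ?expR_gt0. Qed.

Lemma oneDtanh h : 1 + tanh h = expR h / cosh h.
Proof. by rewrite /tanh /cosh; field; rewrite lt0r_neq0 ?sum_expR_gt0. Qed.

Lemma oneBtanh h : 1 - tanh h = expR (- h) / cosh h.
Proof. by rewrite /tanh /cosh; field; rewrite lt0r_neq0 ?sum_expR_gt0. Qed.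

Lemma tanh_bound h : -1 < tanh h < 1.
Proof.
have := oneDtanh h; have := oneBtanh h.
have : 0 < expR h / cosh h by rewrite divr_gt0 ?expR_gt0 ?cosh_gt0.
have : 0 < expR (- h) / cosh h by rewrite divr_gt0 ?expR_gt0 ?cosh_gt0.
lra.
Qed.

Lemma tanh0 : tanh 0 = 0 :> R.
Proof. by rewrite /tanh oppr0 subrr mul0r. Qed.

Lemma ln_oneDtanh h : ln (1 + tanh h) = h - ln (cosh h).
Proof. by rewrite oneDtanh ln_div ?posrE ?expR_gt0 ?cosh_gt0// expRK. Qed.

Lemma ln_oneBtanh h : ln (1 - tanh h) = - h - ln (cosh h).
Proof. by rewrite oneBtanh ln_div ?posrE ?expR_gt0 ?cosh_gt0// expRK. Qed.

Lemma tanhK : cancel (@tanh R) artanh.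
Proof. by move=> h; rewrite /artanh ln_oneDtanh ln_oneBtanh; field. Qed.

Lemma Ising_entropy_tanh h : Ising_entropy (tanh h) = h * tanh h - ln (cosh h).
Proof. by rewrite /Ising_entropy ln_oneDtanh ln_oneBtanh; field. Qed.

Lemma le_tanh : {homo @tanh R : x y / x <= y}.
Proof.
move=> x y xy; rewrite ler_pdivrMr ?sum_expR_gt0// mulrAC ler_pdivlMr ?sum_expR_gt0//.
have : expR x * expR (- y) <= expR y * expR (- x).
  by rewrite -!expRD ler_expR; lra.
nra.
Qed.

Lemma tanh_ge0 h : 0 <= h -> 0 <= tanh h.
Proof. by move=> /le_tanh; rewrite tanh0. Qed.

Lemma tanh_gt0 h : 0 < h -> 0 < tanh h.
Proof.
move=> h0; rewrite lt0r tanh_ge0 ?ltW// andbT; apply/eqP => th0.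
by have := tanhK h; rewrite th0 -tanh0 tanhK => h0'; rewrite -h0' ltxx in h0.
Qed.

Lemma tanh_continuous : continuous (@tanh R).
Proof.
move=> x; notypeclasses refine (is_derive1_continuous (_ : is_derive _ _ (@tanh R) _)).
have -> : @tanh R = fun x => (expR x - expR (- x)) * (expR x + expR (- x))^-1 by [].
by derive1_tac; rewrite /= ?lt0r_neq0 ?sum_expR_gt0.
Qed.

Lemma cosh_continuous : continuous cosh.
Proof.
move=> x; notypeclasses refine (is_derive1_continuous (_ : is_derive _ _ cosh _)).
have -> : cosh = fun x => (expR x + expR (- x)) * 2^-1 by [].
by derive1_tac.
Qed.

Lemma ln_cosh_continuous : continuous (fun h => ln (cosh h)).
Proof.
move=> x; apply: (@continuous_comp _ _ _ cosh (@ln R)); first exact: cosh_continuous.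
exact/continuous_ln/cosh_gt0.
Qed.

Lemma sqrt_oneBtanh2 h : (Num.sqrt (1 - tanh h ^+ 2))^-1 = cosh h.
Proof.
have -> : 1 - tanh h ^+ 2 = (cosh h)^-1 ^+ 2.
  rewrite -[1](expr1n _ 2) subr_sqr oneDtanh oneBtanh mulf_div -expRD addrC subrr expR0.
  by rewrite exprVn expr2 div1r.
by rewrite sqrtr_sqr gtr0_norm ?invr_gt0 ?cosh_gt0// invrK.
Qed.

(** The tangent bound at [w = tanh h], where [artanh w = h] and the entropy is
    [h * w - ln (cosh h)]. The term in [m ^+ 2] is isolated because the interaction energy will
    cancel it. *)
Lemma Ising_entropy_ge h m : 0 < h -> -1 <= m <= 1 ->
  h * tanh h / 2 - ln (cosh h) + (m ^+ 2 - tanh h ^+ 2) ^+ 2 / 12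
    + m ^+ 2 * h / (2 * tanh h)
  <= Ising_entropy m.
Proof.
move=> h0 m1; have /andP[_ t1] := tanh_bound h; have t0 := tanh_gt0 h0.
have w01 : 0 < tanh h < 1 by rewrite t0.
have := Ising_entropy_tangent w01 m1; rewrite Ising_entropy_tanh tanhK.
move=> H; apply: le_trans H; rewrite le_eqVlt; apply/orP; left; apply/eqP.
by field; rewrite lt0r_neq0.
Qed.

End ising.

(** * Pinsker inequalities for the Potts entropy *)

Section kearns_saul.
Context {R : realType}.
Implicit Types q t : R.

(** Carries an inequality to an endpoint at which the logarithm is not differentiable. *)
Lemma le_at_right0 (P : R -> R) (K e0 : R) : {for 0, continuous P} -> 0 < e0 ->
  (forall e, 0 < e < e0 -> P e <= K) -> P 0 <= K.
Proof.
move=> Pc e00 PK; rewrite leNgt; apply/negP => hP.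
have /nbhs_ballP[e /= ep He] : \forall x \near (0 : R), K < P x.
  by apply: (@cvgr_gt _ _ (nbhs (0 : R)) _ P (P 0)).
pose m := Num.min (e / 2) (e0 / 2).
have m0 : 0 < m by rewrite lt_min !divr_gt0.
have me : m <= e / 2 by rewrite ge_min lexx.
have me0 : m <= e0 / 2 by rewrite ge_min lexx orbT.
have b1 : ball (0 : R) e m.
  by rewrite /ball/= sub0r normrN gtr0_norm//; apply: le_lt_trans me _; lra.
have := He _ b1; rewrite /= ltNge => /negP; apply; apply: PK.
by rewrite m0 /=; apply: le_lt_trans me0 _; lra.
Qed.

Definition bernoulli_kl q t : R := q * ln (q / t) + (1 - q) * ln ((1 - q) / (1 - t)).

Section half.
Variables (t : R) (t0 : 0 < t) (t12 : t < 1 / 2).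
Ltac tlra := move: (t0) (t12) => ? ?; lra.
Let t1 : 0 < 1 - t. Proof. tlra. Qed.

(** The one constant for which the gap [f] vanishes at [1 - t] as well as at [t]. *)
Let c := ln ((1 - t) / t) / (1 - 2 * t).
Let f q := bernoulli_kl q t - c * (q - t) ^+ 2.
Let g q := ln (q / t) - ln ((1 - q) / (1 - t)) - 2 * c * (q - t).
Let dg q := (q * (1 - q))^-1 - 2 * c.

Let df q : 0 < q < 1 -> is_derive q 1 f (g q).
Proof.
move=> /andP[q0 q1].
have p1 : 0 < 1 - q by tlra.
have p2 := t1.
rewrite /f /bernoulli_kl; notypeclasses refine (is_derive_eq _ _).
  by derive1_tac; rewrite divr_gt0.
by rewrite /g/=; field; rewrite !lt0r_neq0.
Qed.

Let dg' q : 0 < q < 1 -> is_derive q 1 g (dg q).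
Proof.
move=> /andP[q0 q1].
have p1 : 0 < 1 - q by tlra.
have p2 := t1.
rewrite /g; notypeclasses refine (is_derive_eq _ _).
  by derive1_tac; rewrite divr_gt0.
by rewrite /dg/=; field; rewrite !lt0r_neq0.
Qed.

Let gC q : 0 < q < 1 -> g (1 - q) = - g q.
Proof.
move=> /andP[q0 q1]; rewrite /g subKr !ln_div ?posrE; try tlra.
have : c * (1 - 2 * t) = ln (1 - t) - ln t.
  by rewrite /c ln_div ?posrE; [field; apply: lt0r_neq0; tlra|tlra|tlra].
tlra.
Qed.

Let gt0 : g t = 0.
Proof. by rewrite /g !divff ?subrr ?mulr0 ?lt0r_neq0//; tlra. Qed.

Let ghalf : g (1 / 2) = 0.
Proof.
have h : 1 - 1 / 2 = 1 / 2 :> R by field.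
have h2 : 0 < (1 / 2 : R) < 1 by lra.
have := gC h2; rewrite h => H; lra.
Qed.

Let dg_decr q q' : 0 < q -> q < q' -> q' <= 1 / 2 -> dg q' <= dg q.
Proof.
move=> q0 qq' q'2; rewrite lerD2r lef_pV2 ?posrE; (move: (t0) (t12) => ? ?; nra).
Qed.

Let gMVT a b : 0 < a -> a < b -> b <= 1 / 2 -> exists2 z, a < z < b & g b - g a = dg z * (b - a).
Proof.
move=> a0 ab b2; have [||z] := @MVT R g dg a b ab.
    by move=> z; rewrite in_itv/= => /andP[z1 z2]; apply: dg'; tlra.
  apply: continuous_in_subspaceT => z /set_mem /=; rewrite in_itv/= => /andP[z1 z2].
  by apply: is_derive1_continuous (dg' _); tlra.
by rewrite in_itv/=; exists z.
Qed.

(** [g] vanishes at [t] and at [1 / 2]. A negative value in between would give a negative slope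
    followed by a positive one, while the slope [dg] decreases on this range. *)
Let g_ge0 q : t <= q <= 1 / 2 -> 0 <= g q.
Proof.
move=> /andP[tq q2]; rewrite leNgt; apply/negP => gq.
have {}tq : t < q by rewrite lt_neqAle tq andbT; apply: contraTN gq => /eqP <-; rewrite gt0 ltxx.
have {}q2 : q < 1 / 2 by rewrite lt_neqAle q2 andbT; apply: contraTN gq => /eqP ->; rewrite ghalf ltxx.
have [x /andP[x1 x2]] := gMVT t0 tq (ltW q2); rewrite gt0 => hx.
have [y /andP[y1 y2]] := gMVT (lt_trans t0 tq) q2 (lexx _); rewrite ghalf => hy.
have := @dg_decr x y (lt_trans t0 x1) (lt_trans x2 y1) (ltW y2).
have : dg x < 0 by rewrite -(@pmulr_llt0 _ (q - t)) ?subr_gt0// -hx; tlra.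
have : 0 < dg y by rewrite -(@pmulr_lgt0 _ (1 / 2 - q)) ?subr_gt0// -hy; tlra.
tlra.
Qed.

(** A positive value to the left of [t] would give a negative slope before [t], but by Rolle the
    slope vanishes somewhere in [(t, 1 / 2)], and it decreases. *)
Let g_le0 q : 0 < q <= t -> g q <= 0.
Proof.
move=> /andP[q0 qt]; rewrite leNgt; apply/negP => gq.
have {}qt : q < t by rewrite lt_neqAle qt andbT; apply: contraTN gq => /eqP ->; rewrite gt0 ltxx.
have [x /andP[x1 x2]] := gMVT q0 qt (ltW t12); rewrite gt0 => hx.
have [y /andP[y1 y2]] := gMVT t0 t12 (lexx _); rewrite ghalf gt0 => hy.
have := @dg_decr x y (lt_trans q0 x1) (lt_trans x2 y1) (ltW y2).
have : dg x < 0 by rewrite -(@pmulr_llt0 _ (t - q)) ?subr_gt0// -hx; tlra.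
have : dg y = 0.
  by apply/eqP; move/eqP: hy; rewrite subrr eq_sym mulf_eq0 => /orP[//|]; rewrite subr_eq0 (gt_eqF t12).
tlra.
Qed.

Let ft : f t = 0.
Proof.
by rewrite /f /bernoulli_kl !divff ?subrr ?ln1 ?expr0n/= ?mulr0 ?addr0 ?subr0 ?lt0r_neq0//; tlra.
Qed.

Let f1t : f (1 - t) = 0.
Proof.
have p2 := t1.
rewrite /f /bernoulli_kl subKr !ln_div ?posrE// /c ln_div ?posrE//.
by field; apply: lt0r_neq0; tlra.
Qed.

(** By the signs of [g] and its oddness about [1 / 2], [f] falls to its zero at [t], rises up to
    [1 / 2], falls to its zero at [1 - t] and rises again. *)
Let f_ge0 q : 0 < q < 1 -> 0 <= f q.
Proof.
move=> /andP[q0 q1]; have [qt|tq] := leP q t.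
  rewrite -ft; apply: (@derive1_le0_le _ f g q t qt) => z /andP[z1 z2].
    by apply: df; tlra.
  by apply: g_le0; tlra.
have [q2|q2] := leP q (1 / 2).
  rewrite -ft; apply: (@derive1_ge0_le _ f g t q (ltW tq)) => z /andP[z1 z2].
    by apply: df; tlra.
  by apply: g_ge0; tlra.
have [qt|qt] := leP q (1 - t).
  rewrite -f1t; apply: (@derive1_le0_le _ f g q (1 - t) qt) => z /andP[z1 z2].
    by apply: df; tlra.
  by rewrite -oppr_ge0 -gC; [apply: g_ge0|]; tlra.
rewrite -f1t; apply: (@derive1_ge0_le _ f g (1 - t) q (ltW qt)) => z /andP[z1 z2].
  by apply: df; tlra.
by rewrite -[g z]opprK -gC; [rewrite oppr_ge0; apply: g_le0|]; tlra.
Qed.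

(* The Kearns-Saul inequality: the gap [f] vanishes to second order at [t] and
   at [1 - t], and its derivative [g] is concave on [0, 1/2] and odd about [1/2]. *)
Lemma kearns_saul q : 0 <= q <= 1 ->
  ln ((1 - t) / t) / (1 - 2 * t) * (q - t) ^+ 2 <= bernoulli_kl q t.
Proof.
rewrite -/c => /andP[].
have p2 := t1.
have cont (a : R) : {for 0, continuous (fun e => c * (a + e) ^+ 2)}.
  notypeclasses refine (is_derive1_continuous (_ : is_derive _ _ _ _)).
  by derive1_tac.
have cont' (a : R) : {for 0, continuous (fun e => c * (a - e) ^+ 2)}.
  notypeclasses refine (is_derive1_continuous (_ : is_derive _ _ _ _)).
  by derive1_tac.
have xlnx (x : R) : 0 < x <= 1 -> x * ln x <= 0.
  by move=> /andP[x0 x1]; rewrite mulr_ge0_le0 ?ln_le0// ltW.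
have K0 : bernoulli_kl 0 t = - ln (1 - t).
  by rewrite /bernoulli_kl mul0r subr0 add0r mul1r div1r lnV ?posrE.
have K1 : bernoulli_kl 1 t = - ln t.
  by rewrite /bernoulli_kl subrr mul0r addr0 mul1r div1r lnV ?posrE.
(* At [q = 0] the bound at a small [e], together with [bernoulli_kl e t <= bernoulli_kl 0 t], passes
   to the limit [e -> 0]; the end [q = 1] is handled likewise. *)
rewrite le_eqVlt => /predU1P[<- _|q0].
  have -> : 0 - t = - t + 0 by rewrite addrC.
  apply: (le_at_right0 (cont (- t)) t0) => e /andP[e0 et].
  have e01 : 0 < e < 1 by tlra.
  have := f_ge0 e01; rewrite /f subr_ge0 [e - t]addrC => H; apply: (le_trans H).
  rewrite K0 /bernoulli_kl !ln_div ?posrE; try tlra.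
  have h1 : ln e <= ln t by rewrite ler_ln ?posrE// ltW.
  have h2 : ln (1 - e) <= 0 by apply: ln_le0; tlra.
  have h3 : ln (1 - t) <= 0 by apply: ln_le0; tlra.
  by move: (t0) (t12) => ? ?; nra.
rewrite le_eqVlt => /predU1P[->|q1]; last by rewrite -subr_ge0; apply: f_ge0; rewrite q0.
have -> : 1 - t = 1 - t - 0 by rewrite subr0.
apply: (le_at_right0 (cont' (1 - t)) t0) => e /andP[e0 et].
have e01 : 0 < 1 - e < 1 by tlra.
have := f_ge0 e01; rewrite /f subr_ge0 addrAC => H; apply: (le_trans H).
rewrite K1 /bernoulli_kl subKr !ln_div ?posrE; try tlra.
have h1 : ln e <= ln (1 - t) by rewrite ler_ln ?posrE; tlra.
have h2 : ln (1 - e) <= 0 by apply: ln_le0; tlra.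
have h3 : ln t <= 0 by apply: ln_le0; tlra.
by move: (t0) (t12) => ? ?; nra.
Qed.

End half.
End kearns_saul.

(** * Entropy against squared distance for [r] colours, below the critical temperature *)

Section potts_entropy.
Context {R : realType}.
Implicit Types b : R.

Lemma sum_cst_ord r (x : R) : \sum_(i < r) x = x * r%:R.
Proof. by rewrite sumr_const card_ord mulr_natr. Qed.

(** The right side is the relative entropy with respect to the uniform law, the left side [b] times
    the squared Euclidean distance to it. Equivalently, the uniform vector minimizes the mean-field
    Potts free energy at inverse temperature [b]. *)
Definition pinsker b r := forall p : 'I_r -> R, prob_vector p ->
  b * (\sum_a p a ^+ 2 - r%:R^-1) <= \sum_a p a * ln (r%:R * p a).

Lemma uniform_unique_minimizer_pinsker r b : (0 < r)%N ->
  uniform_unique_minimizer r b -> pinsker b r.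
Proof.
move=> r0 H p pp; have rn0 : r%:R != 0 :> R by rewrite pnatr_eq0 -lt0n.
have [_ /(_ erefl)[_ /(_ p pp)]] := H (fun=> r%:R^-1).
rewrite /Potts_free_energy !sum_cst_ord divff// ln1 mulr0 mul0r addr0.
have -> : r%:R^-1 ^+ 2 * r%:R = r%:R^-1 :> R by field.
lra.
Qed.

(** At [x = r - 1] this is the explicit critical value [(r - 1) / (r - 2) * ln (r - 1)]. *)
Definition xlnx_ratio (x : R) := x * ln x / (x - 1).

(** The inequality is tested on the ordered state that coexists with the uniform one at the
    transition: one entry [(r - 1) / r], all others [1 / (r * (r - 1))]. In the proof [r] is shifted
    down by one. *)
Lemma pinsker_le r b : (3 <= r)%N -> pinsker b r -> b <= xlnx_ratio (r%:R - 1).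
Proof.
case: r => [//|r] r3 H.
have r2 : 2 <= r%:R :> R by rewrite (ler_nat R 2 r).
have rE : r.+1%:R = r%:R + 1 :> R by rewrite -natr1.
pose p (i : 'I_r.+1) : R := if i == ord0 then r%:R / (r%:R + 1) else (r%:R * (r%:R + 1))^-1.
have p0 : p ord0 = r%:R / (r%:R + 1) by rewrite /p eqxx.
have pS i : p (lift ord0 i) = (r%:R * (r%:R + 1))^-1 by [].
have pp : prob_vector p.
  split=> [a|]; first by rewrite /p; case: ifP => _; rewrite ?divr_ge0 ?invr_ge0 ?mulr_ge0 ?addr_ge0.
  rewrite big_ord_recl p0; under eq_bigr do rewrite pS.
  by rewrite sum_cst_ord; field; rewrite !lt0r_neq0//; lra.
have := H p pp; rewrite !big_ord_recl p0.
under eq_bigr do rewrite pS.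
under [X in _ <= _ + X]eq_bigr do rewrite pS.
rewrite !sum_cst_ord rE.
have -> : (r%:R + 1) * (r%:R / (r%:R + 1)) = r%:R :> R by field; rewrite lt0r_neq0//; lra.
have -> : (r%:R + 1) / (r%:R * (r%:R + 1)) = r%:R^-1 :> R by field; rewrite !lt0r_neq0//; lra.
rewrite lnV ?posrE; last lra.
rewrite /xlnx_ratio addrK => {}H.
rewrite ler_pdivlMr; last lra.
have H2 : b * (r%:R - 1) * ((r%:R - 1) / (r%:R * (r%:R + 1)))
    <= r%:R * ln r%:R * ((r%:R - 1) / (r%:R * (r%:R + 1))).
  apply: le_trans (le_trans H _); rewrite le_eqVlt; apply/orP; left; apply/eqP.
    by field; rewrite !lt0r_neq0//; lra.
  by field; rewrite !lt0r_neq0//; lra.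
by rewrite ler_pM2r// in H2; rewrite divr_gt0 ?mulr_gt0//; lra.
Qed.

Lemma xlnx_ratio_mono (x y : R) : 1 < x -> x <= y -> xlnx_ratio x <= xlnx_ratio y.
Proof.
move=> x1 xy.
apply: (@derive1_ge0_le _ _ (fun z => (z - 1 - ln z) / (z - 1) ^+ 2) x y xy) => z /andP[xz zy].
  have z1 : z - 1 != 0 by rewrite subr_eq0 gt_eqF// (lt_le_trans x1).
  have z0 : 0 < z by rewrite (lt_le_trans _ xz)// (lt_trans _ x1).
  rewrite /xlnx_ratio; notypeclasses refine (is_derive_eq _ _).
    by derive1_tac; [exact: z0|exact: z1].
  by rewrite /=; field; rewrite z1 lt0r_neq0.
rewrite divr_ge0 ?sqr_ge0// subr_ge0.
have := @le_ln1Dx R (z - 1); rewrite addrCA subrr addr0; apply; lra.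
Qed.

Lemma sum_sqr_dev r (p : 'I_r -> R) : (0 < r)%N -> prob_vector p ->
  \sum_a (p a - r%:R^-1) ^+ 2 = \sum_a p a ^+ 2 - r%:R^-1.
Proof.
move=> r0 [_ p1]; have rn0 : r%:R != 0 :> R by rewrite pnatr_eq0 -lt0n.
have E a : (p a - r%:R^-1) ^+ 2 = p a ^+ 2 - p a * (2 / r%:R) + r%:R^-1 ^+ 2 by field.
under eq_bigr do rewrite E.
rewrite big_split sumrB/= -mulr_suml p1 sum_cst_ord.
by field.
Qed.

(** Chain rule for the relative entropy: split off the mass [q] of one colour and the conditional
    law [p'] of the others. The Bernoulli part is bounded by the Kearns-Saul inequality at
    [t = 1 / (r + 1)], whose constant there is [xlnx_ratio r * (r + 1) / r]; the conditional part is
    the inequality for [r] colours. *)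
Lemma pinskerS r b : (2 <= r)%N -> 0 <= b -> b <= xlnx_ratio r%:R -> pinsker b r -> pinsker b r.+1.
Proof.
move=> r2 b0 bx H p [p0 p1].
have r2' : 2 <= r%:R :> R by rewrite (ler_nat R 2 r).
have rE : r.+1%:R = r%:R + 1 :> R by rewrite -natr1.
set q := p ord0.
pose t : R := (r%:R + 1)^-1.
have t0 : 0 < t by rewrite invr_gt0; lra.
have t12 : t < 1 / 2 by rewrite /t -div1r ltr_pdivrMr; lra.
have tE : 1 - t = r%:R / (r%:R + 1) by rewrite /t; field; rewrite lt0r_neq0//; lra.
have sumE : \sum_(i < r) p (lift ord0 i) = 1 - q.
  by rewrite -p1 big_ord_recl [X in X - _]addrC addrK.
have q01 : 0 <= q <= 1.
  by rewrite p0 /= -subr_ge0 -sumE sumr_ge0.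
have ks := kearns_saul t0 t12 q01.
have {}ks : b * (r%:R + 1) / r%:R * (q - t) ^+ 2 <= bernoulli_kl q t.
  apply: le_trans ks; rewrite ler_wpM2r ?sqr_ge0//.
  have -> : (1 - t) / t = r%:R by rewrite tE /t; field; rewrite lt0r_neq0//; lra.
  have -> : 1 - 2 * t = (r%:R - 1) / (r%:R + 1) by rewrite /t; field; rewrite lt0r_neq0//; lra.
  have -> : ln r%:R / ((r%:R - 1) / (r%:R + 1)) = xlnx_ratio r%:R * ((r%:R + 1) / r%:R) :> R.
    by rewrite /xlnx_ratio; field; rewrite !lt0r_neq0//; lra.
  by rewrite -mulrA ler_wpM2r// divr_ge0//; lra.
rewrite !big_ord_recl -/q rE.
(* For [q = 1] there is no conditional law, and the Bernoulli bound alone is the claim. *)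
have [q1|qn1] := eqVneq q 1.
  have pz i : p (lift ord0 i) = 0.
    have : \sum_(i < r) p (lift ord0 i) == 0 by rewrite sumE q1 subrr.
    by rewrite psumr_eq0// => /allP/(_ i); rewrite mem_index_enum => /(_ isT)/eqP.
  rewrite !big1 => [|i _|i _]; [|by rewrite pz mul0r|by rewrite pz expr0n].
  move: ks; rewrite q1 /bernoulli_kl subrr mul0r /t invrK !addr0 !mul1r mulr1 expr1n.
  apply: le_trans; rewrite le_eqVlt; apply/orP; left; apply/eqP.
  by field; rewrite !lt0r_neq0//; lra.
have q1 : 0 < 1 - q by rewrite subr_gt0 lt_neqAle qn1; case/andP: q01.
pose p' i := p (lift ord0 i) / (1 - q).
have pp' : prob_vector p'.
  split=> [i|]; first by rewrite divr_ge0// ltW.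
  by rewrite -mulr_suml sumE divff// lt0r_neq0.
have pE i : p (lift ord0 i) = (1 - q) * p' i by rewrite /p' mulrC divfK// lt0r_neq0.
have -> : \sum_(i < r) p (lift ord0 i) ^+ 2 = (1 - q) ^+ 2 * \sum_i p' i ^+ 2.
  by rewrite mulr_sumr; apply: eq_bigr => i _; rewrite pE exprMn.
have -> : \sum_(i < r) p (lift ord0 i) * ln ((r%:R + 1) * p (lift ord0 i)) =
    (1 - q) * (\sum_i p' i * ln (r%:R * p' i)) + (1 - q) * ln ((1 - q) / (1 - t)).
  set K := ln ((1 - q) / (1 - t)).
  have -> : (1 - q) * K = \sum_i (1 - q) * (p' i * K).
    by rewrite -mulr_sumr -mulr_suml pp'.2 mul1r.
  rewrite mulr_sumr -big_split/=; apply: eq_bigr => i _.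
  rewrite pE -mulrDr -mulrA; congr (_ * _).
  have [->|pi0] := eqVneq (p' i) 0; first by rewrite !mul0r addr0.
  have pi : 0 < p' i by rewrite lt0r pi0 pp'.1.
  have r0 : 0 < r%:R :> R by apply: lt_le_trans r2'.
  have k0 : 0 < (1 - q) / (1 - t) by rewrite tE !divr_gt0// addr_gt0.
  have rp0 : 0 < r%:R * p' i by rewrite mulr_gt0.
  rewrite -mulrDr /K -lnM ?posrE//.
  congr (_ * ln _); rewrite tE; field; rewrite !lt0r_neq0//; lra.
have Hp := H p' pp'.
have -> : (r%:R + 1) * q = q / t by rewrite /t invrK mulrC.
rewrite addrCA -/(bernoulli_kl q t).
have := sum_sqr_dev (ltnW r2) pp'.
have : 0 <= \sum_a (p' a - r%:R^-1) ^+ 2 by apply: sumr_ge0 => i _; exact: sqr_ge0.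
move: (\sum_a (p' a - _) ^+ 2) (\sum_a p' a ^+ 2) Hp => V S Hp V0 VE.
have SE : S = V + r%:R^-1 by rewrite VE subrK.
rewrite SE addrK in Hp *.
apply: le_trans (lerD (ler_wpM2l (ltW q1) Hp) ks).
(* The conditional deviation enters with weight [(1 - q) ^+ 2] on the left and [1 - q] on the right;
   the difference [q * (1 - q)] has the good sign. *)
have -> : b * (q ^+ 2 + (1 - q) ^+ 2 * (V + r%:R^-1) - (r%:R + 1)^-1) =
  (1 - q) * (b * V) + b * (r%:R + 1) / r%:R * (q - t) ^+ 2 - q * (1 - q) * (b * V).
  by rewrite /t; field; rewrite !lt0r_neq0//; lra.
by rewrite lerBlDr lerDl mulr_ge0 ?mulr_ge0// ?(ltW q1)//; case/andP: q01.
Qed.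

(** The side condition of [pinskerS] persists along the induction: [pinsker_le] gives it at [r - 1],
    and [xlnx_ratio] increases. *)
Lemma pinsker_mono r r' b : (3 <= r <= r')%N -> 0 <= b -> pinsker b r -> pinsker b r'.
Proof.
move=> /andP[r3 rr'] b0 H; elim: r' rr' => [|n IH]; first by rewrite leqn0 => /eqP r0; rewrite r0 in r3.
rewrite leq_eqVlt => /predU1P[<-//|rn]; have r2 : 2 <= r%:R - 1 :> R.
  by rewrite -(natrB _ (ltnW (ltnW r3))) (ler_nat R 2) leq_subRL// (leq_trans _ r3).
apply: pinskerS => //; [exact: (leq_trans (ltnW r3))| |exact: IH].
apply: (le_trans (pinsker_le r3 H)); apply: xlnx_ratio_mono; first lra.
by rewrite lerBlDr -(natrD _ n 1) ler_nat addn1 ltnW.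
Qed.

(** The strict inequality [b < b'] leaves the room from which the free energy gap is made. *)
Lemma beta_c_pinsker r r' b : (3 <= r <= r')%N -> 0 <= b -> b < beta_c R r ->
  exists2 b', b < b' & pinsker b' r'.
Proof.
move=> rr' b0 bc.
pose S := [set b : R | 0 <= b /\ uniform_unique_minimizer r b].
have [S0|/set0P/negP] := pselect (S !=set0); last first.
  (* The supremum of the empty set is [0] by default, which [0 <= b] excludes. *)
  by rewrite negbK => /eqP S0; move: bc; rewrite /beta_c -/S S0 sup0 ltNge b0.
have [b' [b'0 Sb'] bb'] := sup_gt S0 bc.
exists b' => //; apply: (pinsker_mono rr') => //.
by apply: uniform_unique_minimizer_pinsker => //; case/andP: rr' => /ltnW/ltnW.
Qed.

Lemma pinsker1 b : pinsker b 1.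
Proof.
move=> p [_]; rewrite !big_ord1 => ->.
by rewrite expr1n invr1 subrr mulr0 mul1r mulr1 ln1.
Qed.

End potts_entropy.

(** * Integrals of bounded measurable functions *)

Section bounded_measurable.
Context {R : realType} {dT : measure_display} {T : measurableType dT}.
Implicit Types (f g : T -> R) (nu : {finite_measure set T -> \bar R}).

(** A class closed under the ring operations and integrable for every finite measure, so that
    integrability conditions reduce to closure properties. *)
Definition bounded_measurable f := measurable_fun setT f /\ exists M, forall u, `|f u| <= M.

Lemma bounded_measurable_integrable nu f : bounded_measurable f ->
  nu.-integrable setT (EFin \o f).
Proof.
move=> [mf [M fM]]; apply: measurable_bounded_integrable => //.
  by rewrite ltey_eq fin_num_measure.
exists M; split; first exact: num_real.
by move=> x Mx y _; apply: le_trans (fM y) (ltW Mx).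
Qed.

Lemma bounded_measurable_cst (c : R) : bounded_measurable (fun=> c).
Proof. by split; [exact: measurable_cst|exists `|c|]. Qed.

Lemma bounded_measurableD f g : bounded_measurable f -> bounded_measurable g ->
  bounded_measurable (fun u => f u + g u).
Proof.
move=> [mf [M fM]] [mg [N gN]]; split; first exact: measurable_funD.
by exists (M + N) => u; apply: le_trans (ler_normD _ _) (lerD _ _).
Qed.

Lemma bounded_measurableN f : bounded_measurable f -> bounded_measurable (fun u => - f u).
Proof.
move=> [mf [M fM]]; split; first exact: measurableT_comp.
by exists M => u; rewrite normrN.
Qed.

Lemma bounded_measurableB f g : bounded_measurable f -> bounded_measurable g ->
  bounded_measurable (fun u => f u - g u).
Proof. by move=> bf bg; apply: bounded_measurableD => //; exact: bounded_measurableN. Qed.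

Lemma bounded_measurableM f g : bounded_measurable f -> bounded_measurable g ->
  bounded_measurable (fun u => f u * g u).
Proof.
move=> [mf [M fM]] [mg [N gN]]; split; first exact: measurable_funM.
by exists (M * N) => u; rewrite normrM ler_pM.
Qed.

Lemma bounded_measurable_norm f : bounded_measurable f -> bounded_measurable (fun u => `|f u|).
Proof.
move=> [mf [M fM]]; split; first exact: measurableT_comp.
by exists M => u; rewrite normr_id.
Qed.

Lemma bounded_measurableX f n : bounded_measurable f -> bounded_measurable (fun u => f u ^+ n).
Proof.
move=> bf; elim: n => [|n IH]; first exact: bounded_measurable_cst.
by under eq_fun do rewrite exprS; exact: bounded_measurableM.
Qed.

Lemma bounded_measurable_sum (I : Type) (r : seq I) (F : I -> T -> R) :
  (forall i, bounded_measurable (F i)) -> bounded_measurable (fun u => \sum_(i <- r) F i u).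
Proof.
move=> bF; elim: r => [|i r IH].
  by under eq_fun do rewrite big_nil; exact: bounded_measurable_cst.
by under eq_fun do rewrite big_cons; exact: bounded_measurableD.
Qed.

Section Rint.
Variable nu : {finite_measure set T -> \bar R}.

Lemma RintD f g : bounded_measurable f -> bounded_measurable g ->
  \int[nu]_u (f u + g u) = \int[nu]_u f u + \int[nu]_u g u.
Proof. by move=> bf bg; apply: RintegralD => //; exact: bounded_measurable_integrable. Qed.

Lemma RintB f g : bounded_measurable f -> bounded_measurable g ->
  \int[nu]_u (f u - g u) = \int[nu]_u f u - \int[nu]_u g u.
Proof. by move=> bf bg; apply: RintegralB => //; exact: bounded_measurable_integrable. Qed.

Lemma RintZ (c : R) f : bounded_measurable f ->
  \int[nu]_u (c * f u) = c * \int[nu]_u f u.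
Proof. by move=> bf; apply: RintegralZl => //; exact: bounded_measurable_integrable. Qed.

Lemma RintN f : bounded_measurable f -> \int[nu]_u (- f u) = - \int[nu]_u f u.
Proof.
move=> bf; rewrite -mulN1r -RintZ//; apply: eq_Rintegral => u _.
by rewrite mulN1r.
Qed.

Lemma le_Rint f g : bounded_measurable f -> bounded_measurable g ->
  (forall u, f u <= g u) -> \int[nu]_u f u <= \int[nu]_u g u.
Proof. by move=> bf bg fg; apply: le_Rintegral => //; exact: bounded_measurable_integrable. Qed.

Lemma Rint_cst (c : R) : \int[nu]_u c = c * fine (nu setT).
Proof. by rewrite Rintegral_cst. Qed.

Lemma norm_Rint_le f (c : R) : bounded_measurable f -> (forall u, `|f u| <= c) ->
  `|\int[nu]_u f u| <= c * fine (nu setT).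
Proof.
move=> bf fc; rewrite -Rint_cst; apply: le_trans (le_normr_Rintegral _ _) _ => //.
  exact: bounded_measurable_integrable.
by apply: le_Rint => //; [exact: bounded_measurable_norm|exact: bounded_measurable_cst].
Qed.

Lemma Rint_sum (I : Type) (r : seq I) (F : I -> T -> R) :
  (forall i, bounded_measurable (F i)) ->
  \int[nu]_u (\sum_(i <- r) F i u) = \sum_(i <- r) \int[nu]_u F i u.
Proof.
move=> bF; elim: r => [|i r IH].
  rewrite big_nil -[RHS](mul0r (fine (nu setT))) -Rint_cst.
  by apply: eq_Rintegral => u _; rewrite big_nil.
rewrite big_cons -IH -RintD//; last exact: bounded_measurable_sum.
by apply: eq_Rintegral => u _; rewrite big_cons.
Qed.

(** On a finite measure a constant dominates. Bounded measurability of the limit is returned as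
    well, because such limits enter further integrals. *)
Lemma Rint_dominated (F : nat -> T -> R) f (M : R) :
  (forall n, measurable_fun setT (F n)) -> (forall n u, `|F n u| <= M) ->
  (forall u, F n u @[n --> \oo] --> f u) ->
  bounded_measurable f /\ \int[nu]_u F n u @[n --> \oo] --> \int[nu]_u f u.
Proof.
move=> mF FM Ff.
have mf : measurable_fun setT f by apply: (measurable_fun_cvg mF) => u _; exact: Ff.
have fM u : `|f u| <= M.
  have c : `|F n u| @[n --> \oo] --> `|f u| by apply: cvg_norm; exact: Ff.
  rewrite -(cvg_lim _ c)//; apply: limr_le; first by apply/cvg_ex; exists `|f u|.
  by apply: nearW => n; exact: FM.
have bf : bounded_measurable f by split => //; exists M.
split=> //.
have bF n : bounded_measurable (F n) by split => //; exists M.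
have := @dominated_cvg _ T R nu setT measurableT (fun n => EFin \o F n) (EFin \o f) (cst M%:E).
move=> /(_ _ _ _ _ _) H.
have {}H : (\int[nu]_x (EFin \o F n) x)%E @[n --> \oo] --> (\int[nu]_x (EFin \o f) x)%E.
  apply: H => //.
  by move=> n; apply/measurable_EFinP.
  by move=> x _; apply: cvg_EFin; [exact: nearW|exact: Ff].
  exact: (bounded_measurable_integrable nu (bounded_measurable_cst M)).
  by move=> n x _; rewrite lee_fin.
apply: fine_cvg; rewrite fineK//; apply: integrable_fin_num => //.
exact: bounded_measurable_integrable.
Qed.

End Rint.
End bounded_measurable.

(** * Convolution with [J] and its symmetry *)

Section potential.
Context {R : realType} {d : nat}.
Implicit Types (f g : torus R d -> R) (u v : torus R d).

Lemma continuous_bounded_measurable f : continuous f -> bounded_measurable f.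
Proof.
by move=> fc; split; [exact: continuous_measurable_torus|exact: continuous_torus_bounded].
Qed.

Variables (J : torus R d -> R) (Jc : continuous J).
Variable nu : {finite_measure set (torus R d) -> \bar R}.

Definition potential f u := \int[nu]_v (J (u - v) * f v).

Lemma J_sub_continuous2 u : continuous (fun v => J (u - v)).
Proof.
have [x <-] := to_torus_surj u.
apply: continuous_torus => y /=.
have -> : (fun v => J (to_torus x - v)) \o @to_torus R d = (fun y => J (to_torus (x - y))).
  by apply/funext => z /=; rewrite to_torusB.
apply: (@continuous_comp 'rV[R]_d (torus R d) R (fun y => to_torus (x - y)) J); last exact: Jc.
apply: (@continuous_comp 'rV[R]_d 'rV[R]_d (torus R d) (fun y => x - y) (@to_torus R d)); last exact: to_torus_continuous.
by apply: continuousD; [exact: cst_continuous|exact: opp_continuous].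
Qed.

Lemma J_sub_bounded_measurable u : bounded_measurable (fun v => J (u - v)).
Proof. exact/continuous_bounded_measurable/J_sub_continuous2. Qed.

Lemma J_mul_bounded_measurable f u : bounded_measurable f ->
  bounded_measurable (fun v => J (u - v) * f v).
Proof. by apply: bounded_measurableM; exact: J_sub_bounded_measurable. Qed.

Lemma potential_diff_le f u u' (e M : R) : bounded_measurable f -> (forall v, `|f v| <= M) ->
  (forall v, `|J (u - v) - J (u' - v)| <= e) ->
  `|potential f u - potential f u'| <= e * M * fine (nu setT).
Proof.
move=> bf fM Je; rewrite /potential -RintB; try exact: J_mul_bounded_measurable.
apply: norm_Rint_le.
  by apply: bounded_measurableB; exact: J_mul_bounded_measurable.
by move=> v; rewrite -mulrBl normrM ler_pM.
Qed.

Lemma potential_continuous f : bounded_measurable f -> continuous (potential f).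
Proof.
move=> bf; have [mf [M fM]] := bf.
apply: continuous_torus => x.
apply/(@cvgrPdist_le _ _ _ (nbhs x) (nbhs_filter x)) => /= e e0.
have M0 : 0 <= M by apply: le_trans (normr_ge0 (f 0)) (fM 0).
pose C := M * fine (nu setT) + 1.
have C0 : 0 < C by rewrite ltr_pwDr// mulr_ge0// fine_ge0.
have eC : 0 < e / C by rewrite divr_gt0.
have := J_equicontinuous Jc x eC; apply: filterS => y H.
rewrite distrC; apply: (le_trans (potential_diff_le bf fM H)).
rewrite -mulrA mulrAC ler_pdivrMr// ler_wpM2l ?(ltW e0)//.
by rewrite /C lerDl.
Qed.

Lemma potential_bounded_measurable f : bounded_measurable f -> bounded_measurable (potential f).
Proof. by move=> bf; exact/continuous_bounded_measurable/potential_continuous. Qed.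

Lemma le_potential f g u : (forall v, 0 <= J v) -> bounded_measurable f ->
  bounded_measurable g -> (forall v, f v <= g v) -> potential f u <= potential g u.
Proof.
move=> J0 bf bg fg; apply: le_Rint; try exact: J_mul_bounded_measurable.
by move=> v; exact: ler_wpM2l.
Qed.

(** Symmetry of the double integral without a product measure: [J (u - v)] is replaced by a kernel
    constant on products of finitely many cells, for which the iterated integral is a finite sum
    that is visibly symmetric. Each of the two sides costs [2 * e * Mf * Mg] times the squared
    mass. *)
Lemma potential_sym_net f g (e Mf Mg : R) : (forall v, J (- v) = J v) -> 0 < e ->
  bounded_measurable f -> bounded_measurable g ->
  (forall u, `|f u| <= Mf) -> (forall u, `|g u| <= Mg) ->
  `|\int[nu]_u (f u * potential g u) - \int[nu]_u (g u * potential f u)|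
   <= e * (4 * Mf * Mg * fine (nu setT) ^+ 2).
Proof.
move=> Js e0 bf bg fM gM.
have [L [c cP]] := J_net Jc e0.
pose S i := \bigcap_(v in [set: torus R d]) [set u | `|J (u - v) - J (c i - v)| <= e].
have cS i : closed (S i).
  apply: closed_bigI => v _.
  apply: (@closed_comp _ _ (fun u => `|J (u - v) - J (c i - v)|) [set x | x <= e]); last exact: closed_le.
  move=> u _; apply: (@continuous_comp _ _ _ (fun u => J (u - v) - J (c i - v)) (@Num.norm R R)); last exact: norm_continuous.
  by apply: continuousB; [exact: (J_sub_continuous Jc)|exact: cst_continuous].
(* The sets [S i] where the centre [c i] is good cover the torus; keeping the least good index makes
   them disjoint. *)
pose D i := S i `\` \bigcup_(j in [set j : 'I_L.+1 | (j < i)%N]) S j.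
have mS i : measurable (S i) by exact: closed_measurable_torus.
have mD i : measurable (D i).
  by apply: measurableD => //; apply: fin_bigcup_measurable => //; exact: finite_finset.
have idxP u : exists i, D i u /\ forall j, D j u -> j = i.
  have [i0 Si0] := cP u.
  pose P (n : nat) := [exists i : 'I_L.+1, (nat_of_ord i == n) && `[< S i u >]].
  have exP : exists n, P n.
    by exists i0; apply/existsP; exists i0; rewrite eqxx; apply/asboolP => v _ /=.
  case: (ex_minnP exP) => n /existsP[i /andP[/eqP ni /asboolP Si]] nmin.
  have Di j : D j u -> (nat_of_ord j = n).
    move=> [Sj nSj]; apply/eqP; rewrite eqn_leq nmin ?andbT; last first.
      by apply/existsP; exists j; rewrite eqxx; apply/asboolP.
    by rewrite leqNgt -ni; apply/negP => ij; apply: nSj; exists i.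
  exists i; split; last by move=> j /Di jn; apply: val_inj; rewrite /= jn ni.
  split=> // -[j /= ji Sj]; have := nmin j; rewrite -ni leqNgt ji => /(_ _)/negP; apply => //.
  by apply/existsP; exists j; rewrite eqxx; apply/asboolP.
pose chi i : torus R d -> R := \1_(D i).
have chi_sum u (F : 'I_L.+1 -> R) i : D i u -> \sum_j chi j u * F j = F i.
  move=> Di; rewrite (bigD1 i)//= /chi indicE mem_set// mul1r big1 ?addr0// => j ji.
  rewrite indicE memNset ?mul0r// => Dj.
  have [k [_ kP]] := idxP u.
  by rewrite (kP _ Di) (kP _ Dj) eqxx in ji.
have bchi i : bounded_measurable (chi i).
  split; first exact: measurable_indic.
  by exists 1 => u; rewrite /chi indicE; case: (_ \in _); rewrite ?normr1 ?normr0.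
have Mf0 : 0 <= Mf by apply: le_trans (normr_ge0 (f 0)) (fM 0).
have Mg0 : 0 <= Mg by apply: le_trans (normr_ge0 (g 0)) (gM 0).
have m0 : 0 <= fine (nu setT) by rewrite fine_ge0.
pose Tb (f g : torus R d -> R) := \sum_i \sum_j (\int[nu]_u (f u * chi i u)) * (J (c i - c j) * \int[nu]_v (chi j v * g v)).
suff key : forall (f g : torus R d -> R) (Mf Mg : R), bounded_measurable f -> bounded_measurable g -> (forall u, `|f u| <= Mf) -> (forall u, `|g u| <= Mg) -> 0 <= Mf -> 0 <= Mg ->
    `|\int[nu]_u (f u * potential g u) - Tb f g| <= 2 * e * Mf * Mg * fine (nu setT) ^+ 2.
  have TbC : Tb f g = Tb g f.
    rewrite /Tb exchange_big/=; apply: eq_bigr => j _; apply: eq_bigr => i _.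
    rewrite -[J (c i - c j)]Js opprB mulrCA [RHS]mulrCA [X in _ = _ * X]mulrC; congr (_ * _).
    by congr (_ * _); apply: eq_Rintegral => u _; rewrite mulrC.
  have h1 := key f g Mf Mg bf bg fM gM Mf0 Mg0.
  have h2 := key g f Mg Mf bg bf gM fM Mg0 Mf0.
  rewrite -TbC in h2.
  set X := \int[nu]_u _ in h1 h2 *; set Y := \int[nu]_u _ in h2 *.
  have -> : X - Y = (X - Tb f g) - (Y - Tb f g) by ring.
  apply: le_trans (ler_normB _ _) _; apply: le_trans (lerD h1 h2) _.
  by rewrite le_eqVlt; apply/orP; left; apply/eqP; ring.
move=> {f g Mf Mg bf bg fM gM Mf0 Mg0} f g Mf Mg bf bg fM gM Mf0 Mg0.
pose G i := \sum_j J (c i - c j) * \int[nu]_v (chi j v * g v).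
have bcg j : bounded_measurable (fun v => chi j v * g v) by exact: bounded_measurableM.
have GE i : G i = \int[nu]_v (\sum_j J (c i - c j) * (chi j v * g v)).
  rewrite Rint_sum => [|j]; last by apply: bounded_measurableM => //; exact: bounded_measurable_cst.
  by apply: eq_bigr => j _; rewrite RintZ.
have bsum i : bounded_measurable (fun v => \sum_j J (c i - c j) * (chi j v * g v)).
  by apply: bounded_measurable_sum => j; apply: bounded_measurableM => //; exact: bounded_measurable_cst.
have AG u : `|potential g u - \sum_i chi i u * G i| <= (2 * e * Mg) * fine (nu setT).
  have [i [Di _]] := idxP u.
  rewrite (chi_sum _ _ _ Di) GE /potential -RintB//; last exact: J_mul_bounded_measurable.
  apply: norm_Rint_le; first by apply: bounded_measurableB => //; exact: J_mul_bounded_measurable.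
  move=> v; have [j [Dj _]] := idxP v.
  have -> : \sum_j J (c i - c j) * (chi j v * g v) = J (c i - c j) * g v.
    rewrite -(chi_sum v (fun j => J (c i - c j) * g v) j)//.
    by apply: eq_bigr => k _; rewrite mulrCA.
  (* [u] is moved to its centre, then [v] by the symmetry of [J], at cost [e] each. *)
  rewrite -mulrBl normrM ler_pM//.
  rewrite -(subrK (J (c i - v)) (J (u - v))) -addrA (le_trans (ler_normD _ _))// mulr_natl mulr2n.
  apply: lerD; first by have [/(_ v I)] := Di.
  rewrite -[J (c i - v)]Js opprB -[J (c i - c j)]Js opprB.
  by have [/(_ (c i) I)] := Dj.
have -> : Tb f g = \int[nu]_u (f u * \sum_i chi i u * G i).
  transitivity (\int[nu]_u (\sum_i G i * (f u * chi i u))); last first.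
    by apply: eq_Rintegral => u _; rewrite mulr_sumr; apply: eq_bigr => i _; rewrite mulrC mulrA.
  rewrite Rint_sum => [|i]; last first.
    by apply: bounded_measurableM; [exact: bounded_measurable_cst|exact: bounded_measurableM].
  apply: eq_bigr => i _; rewrite RintZ; last exact: bounded_measurableM.
  by rewrite mulrC mulr_sumr.
have bcG : bounded_measurable (fun u => \sum_i chi i u * G i).
  by apply: bounded_measurable_sum => i; apply: bounded_measurableM => //; exact: bounded_measurable_cst.
rewrite -RintB; last 2 first.
  by apply: bounded_measurableM => //; exact: potential_bounded_measurable.
  exact: bounded_measurableM.
have -> : 2 * e * Mf * Mg * fine (nu setT) ^+ 2 = (Mf * (2 * e * Mg * fine (nu setT))) * fine (nu setT) by ring.
apply: norm_Rint_le.
  apply: bounded_measurableB; last exact: bounded_measurableM.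
  by apply: bounded_measurableM => //; exact: potential_bounded_measurable.
by move=> u; rewrite -mulrBr normrM ler_pM.
Qed.

Lemma potential_sym f g : (forall v, J (- v) = J v) ->
  bounded_measurable f -> bounded_measurable g ->
  \int[nu]_u (f u * potential g u) = \int[nu]_u (g u * potential f u).
Proof.
move=> Js bf bg; have [_ [Mf fM]] := bf; have [_ [Mg gM]] := bg.
apply/eqP; rewrite -subr_eq0 -normr_le0; apply/ler_addgt0Pl => e e0; rewrite addr0.
have Mf0 : 0 <= Mf by apply: le_trans (normr_ge0 (f 0)) (fM 0).
have Mg0 : 0 <= Mg by apply: le_trans (normr_ge0 (g 0)) (gM 0).
set C := 4 * Mf * Mg * fine (nu setT) ^+ 2.
have C0 : 0 <= C by rewrite /C !mulr_ge0// ?exprn_ge0// ?fine_ge0.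
have eC : 0 < e / (C + 1) by rewrite divr_gt0// ltr_pwDr.
apply: le_trans (potential_sym_net Js eC bf bg fM gM) _; rewrite -/C.
rewrite mulrAC ler_pdivrMr; last by rewrite ltr_pwDr.
by rewrite ler_wpM2l ?(ltW e0)// lerDl.
Qed.

End potential.

(** * Riemann sums on the torus *)

Section riemann_sum.
Context {R : realType}.

Lemma uniform_prob_itv (a b : R) : 0 <= a -> a <= b -> b <= 1 ->
  uniform_prob (@ltr01 R) `[a, b[ = (b - a)%:E.
Proof.
move=> a0 ab b1; rewrite /uniform_prob (eq_integral (fun=> 1%E)).
  rewrite integral_cst//= mul1e lebesgue_measure_itv/= lte_fin.
  case: ifPn => [_|]; first by rewrite -EFinB.
  by rewrite -leNgt => ba; congr (_%:E); apply/esym/eqP; rewrite subr_eq0 eq_le ab ba.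
move=> x /set_mem /=; rewrite in_itv/= => /andP[ax xb].
by rewrite /uniform_pdf (le_trans a0 ax) (le_trans (ltW xb) b1) subr0 invr1.
Qed.

Definition box n (a b : 'I_n -> R) : set (n.-tuple (measurableTypeR R)) :=
  [set t | forall i, (a i <= (tnth t i : R) < b i)%R].

Lemma measurable_box n (a b : 'I_n -> R) : measurable (box a b).
Proof.
have -> : box a b = \bigcap_(i in [set: 'I_n])
    ((@tnth n (measurableTypeR R))^~ i @^-1` `[a i, b i[).
  apply/seteqP; split => t /= h.
    by move=> i _ /=; rewrite in_itv/=; exact: h.
  by move=> i; have := h i I; rewrite /= in_itv.
apply: fin_bigcap_measurable; first exact: finite_finset.
move=> i _; rewrite -[X in measurable X]setTI; exact: measurable_tnth.
Qed.

Lemma cube_prob_box n (a b : 'I_n -> R) : (forall i, 0 <= a i /\ a i <= b i /\ b i <= 1) ->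
  cube_prob R n (box a b) = (\prod_i (b i - a i))%:E.
Proof.
elim: n a b => [|n IH] a b ab.
  rewrite /= diracE big_ord0 mem_set//.
  by move=> i; case: i.
rewrite big_ord_recl EFinM /= /distribution /pushforward.
have -> : @cons_pair R n @^-1` box a b =
    `[a ord0, b ord0[ `*` box (fun i => a (lift ord0 i)) (fun i => b (lift ord0 i)).
  apply/seteqP; split => -[t0 t] /= h.
    split; first by have := h ord0; rewrite in_itv.
    by move=> i; have := h (lift ord0 i); rewrite tnthS.
  move=> i; case: h => h0 h; rewrite in_itv/= in h0.
  by case: (unliftP ord0 i) => [j ->|->] //; rewrite tnthS; exact: h.
rewrite product_measure1E//; last exact: measurable_box.
have [a0 [a0b b1]] := ab ord0.
by congr (_ * _)%E; [exact: uniform_prob_itv|exact: IH].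
Qed.

Context {d : nat}.

(** Stated on representatives, with only [x] confined to the unit cube: [y] may leave it, so that
    the wrap-around at the boundary is covered. *)
Lemma torus_uniform_continuous (f : torus R d -> R) (e : R) : continuous f -> 0 < e ->
  exists2 r : R, 0 < r & forall x y : 'rV[R]_d, (forall i, x 0 i \in `[0, 1]) ->
    (forall i, `|x 0 i - y 0 i| < r) -> `|f (to_torus x) - f (to_torus y)| <= e.
Proof.
move=> fc e0.
pose g (x : 'rV[R]_d) := f (to_torus x).
have gc : continuous g.
  by move=> x; apply: (@continuous_comp 'rV[R]_d (torus R d) R (@to_torus R d) f);
    [exact: to_torus_continuous|exact: fc].
have /compact_near_coveringP /(_ R (0 : R)^'+ (fun r x => forall y : 'rV[R]_d,
   (forall i, `|x 0 i - y 0 i| < r) -> `|g x - g y| <= e) _) := @compact_box R d.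
move=> [|r [/= r0 rP]].
  move=> x _ /=.
  have e20 : 0 < e / 2 by rewrite divr_gt0.
  have /nbhs_ballP[r /= r0 rP] := gc x _ (nbhsx_ballx (g x) _ e20).
  have r20 : 0 < r / 2 by rewrite divr_gt0.
  exists (ball x (r / 2), [set t | 0 < t < r / 2]).
    split => /=; first exact: nbhsx_ballx.
    by near=> t; apply/andP; split.
  move=> [x' t] /= [xx' /andP[t0 tr]] y x'y.
  have h1 : ball x r x'.
    by apply: le_ball xx'; rewrite ler_pdivrMr// ler_peMr// ?ltW// ltr1n.
  have h2 : ball x r y.
    split => // i j; rewrite ord1 /ball/=.
    have := xx'.2 0 j; rewrite /ball/= => h.
    rewrite (splitr r) -(subrK (x' 0 j) (x 0 j)) -addrA (le_lt_trans (ler_normD _ _))// ltrD//.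
    exact: lt_trans (x'y j) tr.
  have /= := rP _ h1; have /= := rP _ h2; rewrite /ball/= => g2 g1.
  rewrite (splitr e) -(subrK (g x) (g x')) -addrA (le_trans (ler_normD _ _))// lerD// ltW//.
  by rewrite distrC.
exists (r / 2); first by rewrite divr_gt0.
move=> x y xb; apply: (rP (r / 2)) => //=.
  by rewrite /ball/= sub0r normrN gtr0_norm ?divr_gt0// ltr_pdivrMr// ltr_pMr// ltr1n.
by rewrite divr_gt0.
Unshelve. all: by end_near. Qed.

Section grid.
Variables (n : nat) (n1 : (1 < n)%N).

Definition cell (x : lattice d n) : set (d.-tuple (measurableTypeR R)) :=
  box (fun i => (x 0 i : nat)%:R / n%:R) (fun i => ((x 0 i : nat)%:R + 1) / n%:R).

Lemma cell_prob x : cube_prob R d (cell x) = ((n ^ d)%:R^-1)%:E.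
Proof.
have n0 : 0 < n%:R :> R by rewrite ltr0n ltnW.
rewrite /cell cube_prob_box.
  congr (_%:E); under eq_bigr do rewrite -mulrBl addrAC subrr add0r mul1r.
  by rewrite prodr_const card_ord natrX exprVn.
move=> i; split; first by rewrite divr_ge0.
split; first by rewrite ler_pM2r ?invr_gt0// lerDl.
rewrite ler_pdivrMr// mul1r natr1 ler_nat.
by have := ltn_ord (x 0 i); rewrite [X in (_ < X)%N -> _](Zp_cast n1).
Qed.

Lemma cell_disjoint x y t : cell x t -> cell y t -> x = y.
Proof.
have n0 : 0 < n%:R :> R by rewrite ltr0n ltnW.
move=> xt yt; apply/rowP => i; apply: val_inj => /=.
have /andP[x1 x2] := xt i; have /andP[y1 y2] := yt i.
have := le_lt_trans x1 y2; rewrite ltr_pM2r ?invr_gt0// natr1 ltr_nat ltnS => xy.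
have := le_lt_trans y1 x2; rewrite ltr_pM2r ?invr_gt0// natr1 ltr_nat ltnS => yx.
by apply/eqP; rewrite eqn_leq xy yx.
Qed.

Lemma card_lattice : #|{: lattice d n}| = (n ^ d)%N.
Proof. by rewrite card_mx mul1n card_ord Zp_cast. Qed.

(** On each half-open cell [f] is compared with its value at the corner. The cells are disjoint and
    have mass [n ^ -d] each. *)
Lemma riemann_sum_error (f : torus R d -> R) (e r : R) : continuous f ->
  (forall x y : 'rV[R]_d, (forall i, x 0 i \in `[0, 1]) ->
    (forall i, `|x 0 i - y 0 i| < r) -> `|f (to_torus x) - f (to_torus y)| <= e) ->
  n%:R^-1 < r ->
  `|\int[torus_lebesgue R d]_v f v - (n ^ d)%:R^-1 * \sum_(x : lattice d n) f (site R x)| <= e.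
Proof.
move=> fc fe nr.
have n0 : 0 < n%:R :> R by rewrite ltr0n ltnW.
have bf := continuous_bounded_measurable fc.
have [_ [M fM]] := bf.
have M0 : 0 <= M by apply: le_trans (normr_ge0 (f 0)) (fM 0).
pose F t := f (tuple_torus t).
have bF : bounded_measurable F.
  by split; [apply: measurableT_comp => //; exact: bf.1|exists M => t; exact: fM].
have IF : \int[torus_lebesgue R d]_v f v = \int[cube_prob R d]_t F t.
  rewrite /Rintegral; congr fine.
  apply: (@integral_distribution _ _ _ _ _ (cube_prob R d) (@tuple_torus R d)).
    by apply/measurable_EFinP; exact: bf.1.
  exact: (bounded_measurable_integrable _ bF).
pose chi x : d.-tuple (measurableTypeR R) -> R := \1_(cell x).
have bchi x : bounded_measurable (chi x).
  split; first by apply: measurable_indic; exact: measurable_box.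
  by exists 1 => u; rewrite /chi indicE; case: (_ \in _); rewrite ?normr1 ?normr0.
have Ichi x : \int[cube_prob R d]_t chi x t = (n ^ d)%:R^-1.
  rewrite /Rintegral integral_indic//; last exact: measurable_box.
  by rewrite setIT; exact: (congr1 fine (cell_prob x)).
pose S t := \sum_(x : lattice d n) chi x t * f (site R x).
have bS : bounded_measurable S.
  by apply: bounded_measurable_sum => x; apply: bounded_measurableM => //; exact: bounded_measurable_cst.
have IS : \int[cube_prob R d]_t S t = (n ^ d)%:R^-1 * \sum_(x : lattice d n) f (site R x).
  rewrite Rint_sum => [|x]; last by apply: bounded_measurableM => //; exact: bounded_measurable_cst.
  rewrite mulr_sumr; apply: eq_bigr => x _.
  under eq_Rintegral do rewrite mulrC.
  by rewrite RintZ// Ichi mulrC.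
have bsum : bounded_measurable (fun t => \sum_(x : lattice d n) chi x t) by exact: bounded_measurable_sum.
rewrite IF -IS -RintB//.
apply: le_trans (le_normr_Rintegral _ _) _ => //.
  by apply: bounded_measurable_integrable; exact: bounded_measurableB.
(* Instead of showing that the cells exhaust the cube, the integrand is bounded by [M] off the
   cells; the added term integrates to [0] because the masses of the cells sum to [1]. *)
have -> : e = \int[cube_prob R d]_t (e + M * (1 - \sum_(x : lattice d n) chi x t)).
  rewrite RintD; [|exact: bounded_measurable_cst|]; last first.
    by apply: bounded_measurableM; [|apply: bounded_measurableB => //]; exact: bounded_measurable_cst.
  rewrite RintZ; last by apply: bounded_measurableB => //; exact: bounded_measurable_cst.
  rewrite RintB//; last exact: bounded_measurable_cst.
  rewrite !Rint_cst Rint_sum//.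
  have -> : fine (cube_prob R d setT) = 1 by rewrite probability_setT.
  rewrite (eq_bigr _ (fun x _ => Ichi x)) sumr_const card_lattice.
  rewrite -[X in 1 * 1 - X]mulr_natr mulVf ?mulr1 ?subrr ?mulr0 ?addr0//.
  by rewrite pnatr_eq0 -lt0n expn_gt0 (ltnW n1).
apply: le_Rint.
  by apply: bounded_measurable_norm; exact: bounded_measurableB.
  apply: bounded_measurableD; first exact: bounded_measurable_cst.
  by apply: bounded_measurableM; [|apply: bounded_measurableB => //]; exact: bounded_measurable_cst.
move=> t.
have [[x xt]|nx] := pselect (exists x, cell x t).
  have sumE (G : lattice d n -> R) : \sum_y chi y t * G y = G x.
    rewrite (bigD1 x)//= /chi indicE mem_set// mul1r big1 ?addr0// => y yx.
    by rewrite indicE memNset ?mul0r// => yt; rewrite (cell_disjoint xt yt) eqxx in yx.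
  have -> : S t = f (site R x) by rewrite /S sumE.
  have -> : \sum_y chi y t = 1.
    by rewrite -[RHS](sumE (fun=> 1)); apply: eq_bigr => y _; rewrite mulr1.
  rewrite subrr mulr0 addr0 distrC /F /site /tuple_torus; apply: fe => i; rewrite !mxE.
    rewrite in_itv/= divr_ge0//= ler_pdivrMr// mul1r ler_nat.
    by have := ltn_ord (x 0 i); rewrite [X in (_ < X)%N -> _](Zp_cast n1) => /ltnW.
  have /andP[x1 x2] := xt i.
  rewrite distrC ger0_norm ?subr_ge0//; apply: le_lt_trans nr.
  by rewrite lerBlDr (le_trans (ltW x2))// mulrDl mul1r addrC.
have c0 x : chi x t = 0 by rewrite /chi indicE memNset// => xt; apply: nx; exists x.
have -> : S t = 0 by rewrite /S big1// => x _; rewrite c0 mul0r.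
rewrite big1// !subr0 mulr1 -[leLHS]add0r lerD//; last exact: fM.
have := fe 0 0; rewrite subrr normr0; apply => i; rewrite !mxE ?in_itv/= ?lexx ?ler01//.
by rewrite subrr normr0 (lt_trans _ nr)// invr_gt0.
Qed.

End grid.

Lemma riemann_sum (f : torus R d -> R) : continuous f ->
  (n ^ d)%:R^-1 * \sum_(x : lattice d n) f (site R x) @[n --> \oo]
    --> \int[torus_lebesgue R d]_v f v.
Proof.
move=> fc; apply/cvgrPdist_le => /= e e0.
have [r r0 fe] := torus_uniform_continuous fc e0.
near=> n; apply: (@riemann_sum_error n _ f e r) => //.
  by near: n; exact: nbhs_infty_gt.
rewrite -[r]invrK ltf_pV2 ?posrE ?invr_gt0//.
  by near: n; exact: nbhs_infty_gtr.
by rewrite ltr0n; near: n; exact: nbhs_infty_gt.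
Unshelve. all: by end_near. Qed.

End riemann_sum.

(** * Domination and densities *)

Section open_positivity.
Context {R : realType} {d : nat}.

Definition set_dist (A : set 'rV[R]_d) x : R := inf [set `|x - y| | y in A].

Section set_dist.
Variables (A : set 'rV[R]_d) (A0 : A !=set0).

Lemma set_dist_has_inf x : has_inf [set `|x - y| | y in A].
Proof.
split; first by have [y Ay] := A0; exists `|x - y|, y.
by exists 0 => _ [y _ <-].
Qed.

Lemma set_dist_le x y : A y -> set_dist A x <= `|x - y|.
Proof. by move=> Ay; apply: ge_inf; [exact: (set_dist_has_inf x).2|exists y]. Qed.

Lemma set_dist_ge0 x : 0 <= set_dist A x.
Proof. by apply: lb_le_inf; [exact: (set_dist_has_inf x).1|move=> _ [y _ <-]]. Qed.

Lemma set_dist_lipschitz x y : set_dist A x <= `|x - y| + set_dist A y.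
Proof.
rewrite -lerBlDl; apply: lb_le_inf; first exact: (set_dist_has_inf y).1.
move=> _ [z Az <-]; rewrite lerBlDl; apply: le_trans (set_dist_le x Az) _.
by rewrite -[x - z](subrKA y) ler_normD.
Qed.

Lemma set_dist_continuous : continuous (set_dist A).
Proof.
move=> x; apply/(@cvgrPdist_le _ _ _ (nbhs x) (nbhs_filter x)) => e e0.
near=> y.
have xy : `|x - y| <= e.
  by near: y; apply: cvgr_dist_le => //; exact: cvg_id.
have h1 := set_dist_lipschitz x y; have := set_dist_lipschitz y x.
rewrite distrC => h2; rewrite ler_distl lerBlDr (le_trans h2) ?lerD2r//=; last by rewrite addrC lerD2l.
by rewrite (le_trans h1)// addrC lerD2l.
Unshelve. all: by end_near. Qed.

Lemma set_dist_gt0 x : closed A -> ~ A x -> 0 < set_dist A x.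
Proof.
move=> cA nAx.
have /nbhs_ballP[e /= e0 He] : nbhs x (~` A).
  by apply: open_nbhs_nbhs; split => //; exact: closed_openC.
apply: (@lt_le_trans _ _ (e / 2)); first by rewrite divr_gt0.
apply: lb_le_inf; first exact: (set_dist_has_inf x).1.
move=> _ [y Ay <-]; rewrite leNgt; apply/negP => xy.
apply: (He y) => //; rewrite -ball_normE /ball_/=; apply: lt_trans xy _.
by rewrite ltr_pdivrMr// ltr_pMr// ltr1n.
Qed.

End set_dist.

(** The distance to the preimage of the complement is invariant under integer translations, hence
    descends to the torus. The full set is treated apart, since the infimum over an empty set is a
    default value. *)
Lemma open_torus_positive (U : set (torus R d)) : open U ->
  exists g : torus R d -> R, [/\ continuous g, forall u, 0 <= g u & forall u, U u <-> 0 < g u].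
Proof.
move=> oU; have [UT|] := pselect (~` U = set0).
  exists (fun=> 1); split=> [|u|u]; [exact: cst_continuous|exact: ler01|split => // _].
  by apply: contrapT => nU; have : (~` U) u by []; rewrite UT.
move=> /eqP/set0P[u0 nUu0].
pose A := @to_torus R d @^-1` (~` U).
have A0 : A !=set0 by have [x xu0] := to_torus_surj u0; exists x; rewrite /A /= xu0.
have cA : closed A.
  by apply: closed_comp; [move=> x _; exact: to_torus_continuous|exact: open_closedC].
have inv x y : to_torus x = to_torus y -> set_dist A x <= set_dist A y.
  move=> xy; apply: lb_le_inf; first exact: (set_dist_has_inf A0 y).1.
  move=> _ [z Az <-].
  have -> : y - z = x - (z + (x - y)) by rewrite opprD opprB addrCA (addrC x) subrK addrC.
  apply: (set_dist_le A0); rewrite /A /=.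
  suff -> : to_torus (z + (x - y)) = to_torus z by [].
  by apply/to_torus_eq; rewrite addrAC subrr add0r; exact/to_torus_eq.
pose g (u : torus R d) := set_dist A (repr u).
have gE x : g (to_torus x) = set_dist A x.
  have rK : to_torus (repr (to_torus x)) = to_torus x by exact: reprK.
  by apply/eqP; rewrite eq_le; apply/andP; split; apply: inv.
exists g; split=> [|u|u].
apply: continuous_torus; have -> : g \o @to_torus R d = set_dist A by apply/funext => x /=; rewrite gE.
  exact: set_dist_continuous.
exact: set_dist_ge0.
have [x <-] := to_torus_surj u; rewrite gE; split => [Ux|].
  by apply: set_dist_gt0 => //; rewrite /A /= => nU.
apply: contraPP => nU; apply/negP; rewrite -leNgt.
by apply: le_trans (set_dist_le A0 (y := x) _ _) _ => //; rewrite subrr normr0.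
Qed.

End open_positivity.

(** * Approximation of Borel sets and comparison of measures *)

Section domination.
Context {R : realType} {d : nat}.
Implicit Types (A : set (torus R d)).
Variables mu1 mu2 : {finite_measure set (torus R d) -> \bar R}.

(** One function [f] serves both measures at once; otherwise the two could not be compared through
    it. *)
Definition continuous_approx A := measurable A /\ forall e : R, 0 < e ->
  exists f : torus R d -> R, [/\ continuous f, forall u, 0 <= f u <= 1,
    \int[mu1]_u `|\1_A u - f u| <= e & \int[mu2]_u `|\1_A u - f u| <= e].

Lemma indic_bounded_measurable A : measurable A -> bounded_measurable (\1_A : torus R d -> R).
Proof.
move=> mA; split; first exact: measurable_indic.
by exists 1 => u; rewrite indicE; case: (_ \in _); rewrite ?normr1 ?normr0.
Qed.

Lemma indic_diff_bounded_measurable A (f : torus R d -> R) : measurable A -> bounded_measurable f ->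
  bounded_measurable (fun u => `|\1_A u - f u|).
Proof.
move=> mA bf; apply/bounded_measurable_norm/bounded_measurableB => //.
exact: indic_bounded_measurable.
Qed.

Lemma continuous_approxC A : continuous_approx A -> continuous_approx (~` A).
Proof.
move=> [mA H]; split; first exact: measurableC.
move=> e e0; have [f [fc f01 f1 f2]] := H e e0.
have indE u : \1_(~` A) u = 1 - \1_A u :> R.
  by rewrite !indicE in_setC; case: (_ \in _); rewrite ?subrr ?subr0.
exists (fun u => 1 - f u); split.
by move=> u; apply: continuousB; [exact: cst_continuous|exact: fc].
by move=> u; have /andP[? ?] := f01 u; rewrite subr_ge0 lerBlDr lerDl; apply/andP.
apply: le_trans f1; rewrite le_eqVlt; apply/orP; left; apply/eqP; apply: eq_Rintegral => u _.
  by rewrite indE opprB addrC subrKA distrC.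
apply: le_trans f2; rewrite le_eqVlt; apply/orP; left; apply/eqP; apply: eq_Rintegral => u _.
by rewrite indE opprB addrC subrKA distrC.
Qed.

Lemma continuous_approxU A B : continuous_approx A -> continuous_approx B ->
  continuous_approx (A `|` B).
Proof.
move=> [mA HA] [mB HB]; split; first exact: measurableU.
move=> e e0; have e20 : 0 < e / 2 by rewrite divr_gt0.
have [f [fc f01 f1 f2]] := HA _ e20; have [g [gc g01 g1 g2]] := HB _ e20.
have mc : continuous (fun u => Num.max (f u) (g u)).
  by move=> u; apply: continuous_max; [exact: fc|exact: gc].
have bf := continuous_bounded_measurable fc; have bg := continuous_bounded_measurable gc.
have ptw u : `|\1_(A `|` B) u - Num.max (f u) (g u)| <= `|\1_A u - f u| + `|\1_B u - g u|.
  have /andP[f0 fl1] := f01 u; have /andP[g0 gl1] := g01 u.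
  have a1 : `|1 - f u| = 1 - f u by rewrite ger0_norm// subr_ge0.
  have b1 : `|1 - g u| = 1 - g u by rewrite ger0_norm// subr_ge0.
  have a0 : `|0 - f u| = f u by rewrite sub0r normrN ger0_norm.
  have b0 : `|0 - g u| = g u by rewrite sub0r normrN ger0_norm.
  rewrite !indicE in_setU; case: (u \in A); case: (u \in B); rewrite ?orbT ?orbF ?mulr1n ?mulr0n;
    case: (leP (f u) (g u)) => fg; rewrite ?a0 ?a1 ?b0 ?b1; lra.
have I (mu : {finite_measure set (torus R d) -> \bar R}) : \int[mu]_u `|\1_A u - f u| <= e / 2 ->
   \int[mu]_u `|\1_B u - g u| <= e / 2 ->
   \int[mu]_u `|\1_(A `|` B) u - Num.max (f u) (g u)| <= e.
  move=> h1 h2; rewrite (splitr e); apply: le_trans (lerD h1 h2).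
  rewrite -RintD; try exact: indic_diff_bounded_measurable.
  apply: le_Rint => //.
    apply: indic_diff_bounded_measurable; first exact: measurableU.
    exact: continuous_bounded_measurable.
  by apply: bounded_measurableD; exact: indic_diff_bounded_measurable.
exists (fun u => Num.max (f u) (g u)); split => //; [|exact: I|exact: I].
by move=> u; have /andP[f0 fl1] := f01 u; have /andP[g0 gl1] := g01 u; rewrite le_max f0 ge_max fl1 gl1.
Qed.

Lemma continuous_approx_lim (F : nat -> set (torus R d)) A : (forall n, continuous_approx (F n)) ->
  (forall u, (\1_(F n) u : R) @[n --> \oo] --> (\1_A u : R)) -> measurable A -> continuous_approx A.
Proof.
move=> HF FA mA; split=> // e e0; have e20 : 0 < e / 2 by rewrite divr_gt0.
have bF n : bounded_measurable (\1_(F n) : torus R d -> R).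
  by apply: indic_bounded_measurable; exact: (HF n).1.
have lim (mu : {finite_measure set (torus R d) -> \bar R}) :
    \forall n \near \oo, \int[mu]_u `|\1_A u - \1_(F n) u| <= e / 2.
  have [|||_] := @Rint_dominated R _ _ mu (fun n u => `|\1_A u - \1_(F n) u|) (fun=> 0) 2.
  by move=> n; apply: (indic_diff_bounded_measurable mA (bF n)).1.
  move=> n u; rewrite normr_id !indicE; case: (_ \in _); case: (_ \in _); rewrite ?subrr ?subr0 ?sub0r ?normrN ?normr0 ?normr1 ?ler0n ?ler1n//.
  move=> u; rewrite -(normr0 R) -(subrr (\1_A u : R)); apply: cvg_norm.
    by apply: cvgB; [exact: cvg_cst|exact: FA].
  rewrite Rint_cst mul0r => h; near=> n.
  by near: n; apply: (cvgr_le _ h).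
near \oo => n.
have [f [fc f01 f1 f2]] := (HF n).2 _ e20.
have bf := continuous_bounded_measurable fc.
have I (mu : {finite_measure set (torus R d) -> \bar R}) : \int[mu]_u `|\1_A u - \1_(F n) u| <= e / 2 ->
   \int[mu]_u `|\1_(F n) u - f u| <= e / 2 -> \int[mu]_u `|\1_A u - f u| <= e.
  move=> h1 h2; rewrite (splitr e); apply: le_trans (lerD h1 h2).
  rewrite -RintD; [|exact: indic_diff_bounded_measurable|apply: indic_diff_bounded_measurable => //; exact: (HF n).1].
  apply: le_Rint.
  exact: indic_diff_bounded_measurable.
  by apply: bounded_measurableD; apply: indic_diff_bounded_measurable => //; exact: (HF n).1.
  by move=> u; rewrite -[X in `|X| <= _](subrKA (\1_(F n) u)) ler_normD.
exists f; split => //; apply: I => //; near: n; exact: lim.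
Unshelve. all: by end_near. Qed.

Lemma continuous_approx_open A : open A -> continuous_approx A.
Proof.
move=> oA; have [g [gc g0 gP]] := open_torus_positive oA.
have mA := open_measurable_torus oA.
split=> // e e0.
pose f n u := Num.min 1 (n%:R * g u).
have fc n : continuous (f n).
  move=> u; apply: (@continuous_min _ _ (fun=> 1) (fun u => n%:R * g u)); first exact: cst_continuous.
  by apply: continuousM; [exact: cst_continuous|exact: gc].
have f01 n u : 0 <= f n u <= 1.
  by rewrite /f le_min ler01 mulr_ge0//= ge_min lexx.
have bf n := continuous_bounded_measurable (fc n).
have lim (mu : {finite_measure set (torus R d) -> \bar R}) :
    \forall n \near \oo, \int[mu]_u `|\1_A u - f n u| <= e.
  have [|||_] := @Rint_dominated R _ _ mu (fun n u => `|\1_A u - f n u|) (fun=> 0) 1.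
  by move=> n; apply: (indic_diff_bounded_measurable mA (bf n)).1.
  move=> n u; rewrite normr_id indicE; have /andP[h0 h1] := f01 n u.
    by rewrite ler_norml; case: (_ \in _); rewrite ?mulr1n ?mulr0n; apply/andP; split; lra.
  move=> u; apply: cvg_near_cst; have [Au|nAu] := pselect (A u); last first.
      apply: nearW => n; rewrite indicE memNset//= sub0r normrN /f.
      have -> : g u = 0 by apply/eqP; rewrite eq_le g0 andbT leNgt; apply/negP => /gP.
      by rewrite mulr0 min_r// normr0.
    have gu : 0 < g u by apply/gP.
    near=> n; rewrite indicE mem_set//= /f min_l ?subrr ?normr0//.
    rewrite -ler_pdivrMr// div1r; near: n; exact: nbhs_infty_ger.
  rewrite Rint_cst mul0r => h; near=> n.
  by near: n; apply: (cvgr_le _ h).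
near \oo => n.
by exists (f n); split => //; near: n; exact: lim.
Unshelve. all: by end_near. Qed.

(** The approximable sets form a sigma-algebra containing the open sets; a countable union is the
    limit of its finite partial unions, by dominated convergence. *)
Lemma measurable_continuous_approx A : measurable A -> continuous_approx A.
Proof.
move=> mA.
have : <<s (@open (torus R d)) >> A by exact: mA.
apply: smallest_sub; last by move=> B; exact: continuous_approx_open.
have H0 : continuous_approx set0 by apply: continuous_approx_open; exact: open0.
split=> // [B HB|F HF]; first by rewrite setTD; exact: continuous_approxC.
have HU n : continuous_approx (\big[setU/set0]_(i < n) F i).
  elim: n => [|n IH]; first by rewrite big_ord0.
  by rewrite big_ord_recr; exact: continuous_approxU.
apply: (continuous_approx_lim HU); last by apply: bigcup_measurable => n _; exact: (HF n).1.
move=> u; apply: cvg_near_cst.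
have [[k _ Fk]|nF] := pselect ((\bigcup_n F n) u).
  near=> n; rewrite !indicE !mem_set//; first by exists k.
  rewrite -bigcup_mkord; exists k => //=; near: n; exact: nbhs_infty_gt.
apply: nearW => n; rewrite !indicE !memNset// -bigcup_mkord => -[k _ Fk].
by apply: nF; exists k.
Unshelve. all: by end_near. Qed.

(** Replacing the indicator of a [mu2]-null set by a continuous [f] costs [e / 2] in each measure,
    so its [mu1]-measure is at most [e]. *)
Lemma dominates_of_continuous :
  (forall f : torus R d -> R, continuous f -> (forall u, 0 <= f u) ->
     \int[mu1]_u f u <= \int[mu2]_u f u) ->
  mu1 `<< mu2.
Proof.
move=> H; apply/null_content_dominatesP => A mA mA0.
have [_ HA] := measurable_continuous_approx mA.
have I (mu : {finite_measure set (torus R d) -> \bar R}) : \int[mu]_u (\1_A u : R) = fine (mu A).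
  by rewrite /Rintegral integral_indic// setIT.
have bA := indic_bounded_measurable mA.
suff : fine (mu1 A) <= 0.
  move=> h; apply/eqP; rewrite eq_le measure_ge0 andbT -(fineK (fin_num_measure mu1 A mA)).
  by rewrite lee_fin.
apply/ler_addgt0Pl => e e0; rewrite addr0.
have e20 : 0 < e / 2 by rewrite divr_gt0.
have [f [fc f01 f1 f2]] := HA _ e20.
have bf := continuous_bounded_measurable fc.
have bd := indic_diff_bounded_measurable mA bf.
rewrite -I.
apply: (@le_trans _ _ (\int[mu1]_u (f u + `|\1_A u - f u|))).
  apply: le_Rint => //; first exact: bounded_measurableD.
  by move=> u; rewrite -lerBlDl ler_norm.
rewrite RintD// (splitr e) lerD//.
apply: (le_trans (H f fc _)); first by move=> u; case/andP: (f01 u).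
apply: (@le_trans _ _ (\int[mu2]_u (\1_A u + `|\1_A u - f u|))).
  apply: le_Rint => //; first exact: bounded_measurableD.
  by move=> u; rewrite -lerBlDl distrC ler_norm.
by rewrite RintD// I mA0/= add0r.
Qed.

End domination.

Section density.
Context {R : realType} {d : nat}.
Variable nu : {finite_measure set (torus R d) -> \bar R}.
Hypothesis nu_dom : nu `<< torus_lebesgue R d.

Lemma Rint_density (f : torus R d -> R) : bounded_measurable f ->
  \int[torus_lebesgue R d]_v (density nu v * f v) = \int[nu]_v f v.
Proof.
move=> bf; rewrite /Rintegral; congr fine.
have := Radon_Nikodym_change_of_variables nu_dom measurableT (bounded_measurable_integrable nu bf).
move=> <-; apply: eq_integral => v _.
by rewrite /density EFinM fineK 1?muleC//; exact: Radon_Nikodym_fin_num.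
Qed.

End density.

(** * The mean-field Ising equation *)

Section entropy_measurable.
Context {R : realType}.

Lemma Ising_entropy_ge0 (m : R) : -1 <= m <= 1 -> 0 <= Ising_entropy m.
Proof.
move=> /andP[m1 m2].
have yln (y : R) : 0 <= y -> y - 1 <= y * ln y.
  rewrite le_eqVlt => /predU1P[<-|y0]; first by rewrite mul0r; lra.
  have : ln (1 + (y^-1 - 1)) <= y^-1 - 1 by apply: le_ln1Dx; rewrite ltrBrDr addNr invr_gt0.
  rewrite addrCA subrr addr0 lnV ?posrE// => h.
  have : y * (1 - y^-1) <= y * ln y by rewrite ler_pM2l//; lra.
  by rewrite mulrBr mulr1 divff// lt0r_neq0.
have := yln (1 + m); have := yln (1 - m).
by rewrite /Ising_entropy => h1 h2; have := h1 _; have := h2 _; lra.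
Qed.

Lemma measurable_Ising_entropy : measurable_fun setT (@Ising_entropy R).
Proof.
apply: measurable_funD; apply: measurable_funM.
by apply: measurable_funM => //; apply: measurable_funD.
by apply: measurableT_comp => //; exact: measurable_funD.
by apply: measurable_funM => //; apply: measurable_funB.
by apply: measurableT_comp => //; exact: measurable_funB.
Qed.

Lemma Ising_entropy_bounded_measurable {dT} {T : measurableType dT} (m : T -> R) :
  measurable_fun setT m -> (forall u, -1 <= m u <= 1) ->
  bounded_measurable (fun u => Ising_entropy (m u)).
Proof.
move=> mm m1; split.
  by apply: (measurableT_comp measurable_Ising_entropy).
by exists (ln 2) => u; rewrite ger0_norm ?Ising_entropy_ge0// Ising_entropy_le.
Qed.

(** Turns control of [m ^ 2], all that strong convexity gives, into control of the modulus of [m].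
    Since [(a - b) ^ 2 <= |a ^ 2 - b ^ 2|], a difference larger than [c] satisfies
    [|a - b| * c ^ 3 <= (a ^ 2 - b ^ 2) ^ 2]. *)
Lemma sqr_diff_bound (a b c : R) : 0 <= a -> 0 <= b -> 0 < c ->
  `|a - b| <= c + (a ^+ 2 - b ^+ 2) ^+ 2 / c ^+ 3.
Proof.
move=> a0 b0 c0; have [h|h] := leP `|a - b| c.
  by rewrite (le_trans h)// lerDl divr_ge0 ?sqr_ge0// exprn_ge0// ltW.
have d0 : 0 <= `|a - b| by [].
have ab : `|a - b| ^+ 2 <= `|a ^+ 2 - b ^+ 2|.
  rewrite subr_sqr normrM expr2 ler_wpM2l// ger0_norm ?addr_ge0//.
  by rewrite ler_norml; apply/andP; split; lra.
have ab4 : `|a - b| ^+ 4 <= (a ^+ 2 - b ^+ 2) ^+ 2.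
  rewrite -[leRHS]real_normK ?num_real// (exprM _ 2 2).
  by rewrite lerXn2r// ?nnegrE ?exprn_ge0.
have c3 : 0 < c ^+ 3 by rewrite exprn_gt0.
apply: (@le_trans _ _ ((a ^+ 2 - b ^+ 2) ^+ 2 / c ^+ 3)); last by rewrite lerDr ltW.
rewrite ler_pdivlMr//; apply: le_trans ab4.
by rewrite [leRHS]exprS ler_wpM2l// lerXn2r ?nnegrE ?(ltW c0)// ltW.
Qed.

End entropy_measurable.

(** * Largest solution and stability of the mean-field functional *)

Section mean_field.
Context {R : realType} {d : nat}.
Variables (J : torus R d -> R) (Jc : continuous J) (J0 : forall v, 0 < J v).
Variables (Js : forall v, J (- v) = J v) (beta : R) (beta0 : 0 <= beta).
Variable nu : {finite_measure set (torus R d) -> \bar R}.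
Implicit Types (u v : torus R d) (m : torus R d -> R).

Local Notation A := (potential J nu).

(** Some upper bound of [J], picked by choice; it need not be the least. *)
Definition J_sup : R := xget 0 [set M | forall v, J v <= M].

Lemma J_le_sup v : J v <= J_sup.
Proof.
have [M JM] := continuous_torus_bounded Jc.
have P : [set M | forall v, J v <= M] M.
  by move=> w; rewrite (le_trans (ler_norm _))// JM.
by rewrite /J_sup; case: xgetP => [x _ h|/(_ M)//]; exact: h.
Qed.

(** Larger than anything the mean-field map with external field [1] can return, so that the first
    step of the iteration goes down. *)
Definition field0 : R := beta * J_sup * fine (nu setT) + 2.

(* Iterating the mean-field map from above with a vanishing external field keeps
   the iterates positive, so they converge to the largest solution and this
   without a separate treatment of its vanishing. *)
Fixpoint field k : torus R d -> R :=
  if k is k'.+1 then fun u => beta * A (fun v => tanh (field k' v)) u + k'.+1%:R^-1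
  else fun=> field0.

Definition field_lim u : R := lim (field k u @[k --> \oo]).

Definition max_magnetization u := tanh (field_lim u).

Lemma field_continuous k : continuous (field k).
Proof.
elim: k => [|k IH] /=; first exact: cst_continuous.
have tc : continuous (fun v => tanh (field k v)).
  by move=> v; apply: (@continuous_comp _ _ _ (field k) (@tanh R)); [exact: IH|exact: tanh_continuous].
move=> u; apply: (@continuousD _ _ _ (fun u => beta * A (fun v => tanh (field k v)) u) (fun=> k.+1%:R^-1)).
  apply: (@continuousM _ _ (fun=> beta)); first exact: cst_continuous.
  exact: (potential_continuous Jc (continuous_bounded_measurable tc)).
exact: cst_continuous.
Qed.

Lemma tanh_field_continuous k : continuous (fun u => tanh (field k u)).
Proof.
move=> u; apply: (@continuous_comp _ _ _ (field k) (@tanh R)).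
  exact: field_continuous.
exact: tanh_continuous.
Qed.

Lemma tanh_field_bounded_measurable k : bounded_measurable (fun u => tanh (field k u)).
Proof. exact/continuous_bounded_measurable/tanh_field_continuous. Qed.

Lemma J_sup_ge0 : 0 <= J_sup.
Proof. by rewrite (le_trans _ (J_le_sup 0))// ltW. Qed.

Lemma J_norm_le v : `|J v| <= J_sup.
Proof. by rewrite gtr0_norm ?J_le_sup. Qed.

Lemma potential_norm_le f (M : R) u : bounded_measurable f -> (forall v, `|f v| <= M) ->
  `|A f u| <= J_sup * M * fine (nu setT).
Proof.
move=> bf fM; apply: norm_Rint_le; first exact: J_mul_bounded_measurable.
by move=> v; rewrite normrM ler_pM ?J_norm_le.
Qed.

Lemma potential_ge0 f u : (forall v, 0 <= f v) -> 0 <= A f u.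
Proof. by move=> f0; apply: Rintegral_ge0 => v _; rewrite mulr_ge0 ?(ltW (J0 _)). Qed.

Lemma field0_gt0 : 0 < field0.
Proof. by rewrite ltr_pwDr// !mulr_ge0 ?J_sup_ge0 ?fine_ge0. Qed.

Lemma field_gt0 k u : 0 < field k u.
Proof.
elim: k u => [|k IH] u /=; first exact: field0_gt0.
rewrite ltr_pwDr ?invr_gt0// mulr_ge0// potential_ge0// => v.
by rewrite tanh_ge0// ltW.
Qed.

Lemma tanh_norm_le1 (x : R) : `|tanh x| <= 1.
Proof. by rewrite ler_norml; have /andP[h1 h2] := tanh_bound x; rewrite !ltW. Qed.

(** The mean-field map is monotone since [J] is positive and [tanh] increases, and the external
    field decreases with [k]. *)
Lemma field_succ_le k u : field k.+1 u <= field k u.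
Proof.
elim: k u => [|k IH] u /=.
  rewrite invr1 /field0 lerD ?ler1n// -mulrA ler_wpM2l//.
  apply: (le_trans (ler_norm _)); apply: le_trans (potential_norm_le (M := 1) _ _ _) _.
  exact: continuous_bounded_measurable (@cst_continuous _ _ _).
  by move=> v; exact: tanh_norm_le1.
  by rewrite mulr1.
apply: lerD; last by rewrite lef_pV2 ?posrE ?ler_nat.
apply: ler_wpM2l => //; apply: le_potential => //; first by move=> v; rewrite ltW.
exact: (tanh_field_bounded_measurable k.+1).
exact: tanh_field_bounded_measurable.
by move=> v; apply: le_tanh; exact: IH.
Qed.

Lemma field_le0 k u : field k u <= field0.
Proof. by elim: k => [//|k IH]; apply: le_trans IH; exact: field_succ_le. Qed.

(** The slack [k.+1%:R^-1] is what later tolerates a discretized potential in place of the exact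
    one. *)
Lemma field_supersolution k u : beta * A (fun v => tanh (field k v)) u + k.+1%:R^-1 <= field k u.
Proof. exact: field_succ_le. Qed.

Lemma field_cvg u : field k u @[k --> \oo] --> field_lim u.
Proof.
apply: nonincreasing_is_cvgn.
  by apply/nonincreasing_seqP => k; exact: field_succ_le.
by exists 0 => _ [k _ <-]; rewrite ltW// field_gt0.
Qed.

Lemma field_lim_ge0 u : 0 <= field_lim u.
Proof.
apply: limr_ge; first by apply/cvg_ex; exists (field_lim u); exact: field_cvg.
by apply: nearW => k; rewrite ltW// field_gt0.
Qed.

Lemma tanh_field_cvg u : tanh (field k u) @[k --> \oo] --> max_magnetization u.
Proof. by apply: continuous_cvg; [exact: tanh_continuous|exact: field_cvg]. Qed.

Lemma max_magnetization_bounded_measurable : bounded_measurable max_magnetization.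
Proof.
apply: (@Rint_dominated R _ _ nu (fun k u => tanh (field k u)) max_magnetization 1 _ _ _).1.
  by move=> k; exact: (tanh_field_bounded_measurable k).1.
  by move=> k u; exact: tanh_norm_le1.
exact: tanh_field_cvg.
Qed.

Lemma potential_field_cvg u :
  A (fun v => tanh (field k v)) u @[k --> \oo] --> A max_magnetization u.
Proof.
apply: (Rint_dominated nu (M := J_sup) _ _ _).2.
by move=> k; apply: (J_mul_bounded_measurable Jc u (tanh_field_bounded_measurable k)).1.
move=> k v; rewrite normrM -[leRHS]mulr1 ler_pM//; first exact: J_norm_le.
  exact: tanh_norm_le1.
by move=> v; apply: cvgM; [exact: cvg_cst|exact: tanh_field_cvg].
Qed.

Lemma field_lim_eq u : field_lim u = beta * A max_magnetization u.
Proof.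
have h1 : field k.+1 u @[k --> \oo] --> field_lim u.
  by have := @field_cvg u; rewrite -cvg_shiftS.
have h2 : field k.+1 u @[k --> \oo] --> beta * A max_magnetization u + 0.
  apply: cvgD; first by apply: cvgM; [exact: cvg_cst|exact: potential_field_cvg].
  exact: cvg_harmonic.
by rewrite addr0 in h2; exact: (cvg_unique _ h1 h2).
Qed.

Lemma field_lim_bounded_measurable : bounded_measurable field_lim.
Proof.
have -> : field_lim = fun u => beta * A max_magnetization u.
  by apply/funext => u; rewrite field_lim_eq.
apply: bounded_measurableM; first exact: bounded_measurable_cst.
exact: potential_bounded_measurable max_magnetization_bounded_measurable.
Qed.

(** The Ising functional with respect to the unnormalized [nu]: with the normalized density and
    [mass nu * beta], the Ising functional is [(mass nu)^-1] times this one. *)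
Definition mf_functional m :=
  \int[nu]_u (- (beta / 2) * (m u * A m u) + Ising_entropy (m u)).

Section stability.
Variables (m : torus R d -> R) (mm : magnetization m).

Let m1 u : -1 <= m u <= 1. Proof. exact: mm.2. Qed.

Let bm : bounded_measurable m.
Proof. by split; [exact: mm.1|exists 1 => u; rewrite ler_norml m1]. Qed.

(** A Schur test with weight [w]: expand the nonnegative square [(m u * w v - m v * w u) ^+ 2 / (w u
    * w v)], integrate it against [J (u - v)] and use the symmetry of the potential. *)
Lemma pair_integral_le (w : torus R d -> R) : continuous w -> (forall u, 0 < w u) ->
  \int[nu]_u (m u * A m u) <= \int[nu]_u (m u ^+ 2 / w u * A w u).
Proof.
move=> wc w0.
have wVc : continuous (fun u => (w u)^-1).
  by move=> u; apply: continuousV; [exact: lt0r_neq0|exact: wc].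
have bw := continuous_bounded_measurable wc.
have bg : bounded_measurable (fun u => m u ^+ 2 / w u).
  apply: bounded_measurableM; last exact: continuous_bounded_measurable.
  exact: bounded_measurableX.
have bA f := @potential_bounded_measurable R d J Jc nu f.
have two : 2 * \int[nu]_u (m u * A m u) <= \int[nu]_u (m u ^+ 2 / w u * A w u + w u * A (fun u => m u ^+ 2 / w u) u).
  rewrite -RintZ; last by apply: bounded_measurableM => //; exact: bA.
  apply: le_Rint.
  by apply: bounded_measurableM; [exact: bounded_measurable_cst|apply: bounded_measurableM => //; exact: bA].
  by apply: bounded_measurableD; apply: bounded_measurableM => //; exact: bA.
  move=> u.
  have bc (c : R) f : bounded_measurable f -> bounded_measurable (fun v => c * (J (u - v) * f v)).
    by move=> bf; apply: bounded_measurableM; [exact: bounded_measurable_cst|exact: J_mul_bounded_measurable].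
  rewrite /potential -!RintZ; try exact: J_mul_bounded_measurable; try exact: bc.
  rewrite -RintD; try exact: bc.
  apply: le_Rint.
    by apply: bounded_measurableM; [exact: bounded_measurable_cst|exact: bc].
    by apply: bounded_measurableD; exact: bc.
  move=> v.
  have -> : m u ^+ 2 / w u * (J (u - v) * w v) + w u * (J (u - v) * (m v ^+ 2 / w v)) =
     J (u - v) * (2 * m u * m v + (m u * w v - m v * w u) ^+ 2 / (w u * w v)).
    by field; rewrite !lt0r_neq0.
  have -> : 2 * (m u * (J (u - v) * m v)) = J (u - v) * (2 * m u * m v) by ring.
  by rewrite ler_pM2l// lerDl divr_ge0 ?sqr_ge0// mulr_ge0// ltW.
rewrite RintD in two; [|by apply: bounded_measurableM => //; exact: bA|by apply: bounded_measurableM => //; exact: bA].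
rewrite [X in _ <= _ + X](potential_sym Jc nu Js bw bg) in two.
move: two; move: (\int[nu]_u (m u * A m u)) (\int[nu]_u (m u ^+ 2 / w u * A w u)) => X Y.
by lra.
Qed.

(** With [w = tanh h] and [h] a supersolution, the Schur test bounds the interaction by the integral
    of [m ^ 2 * h / w]. Half of it is precisely the [m ^ 2] term of [Ising_entropy_ge], and the two
    cancel. *)
Lemma mf_functional_ge_field k :
  \int[nu]_u (field k u * tanh (field k u) / 2 - ln (cosh (field k u)) +
     (m u ^+ 2 - tanh (field k u) ^+ 2) ^+ 2 / 12) <= mf_functional m.
Proof.
set h := field k; pose w u := tanh (h u).
have hc : continuous h := @field_continuous k.
have h0 u : 0 < h u := field_gt0 k u.
have wc : continuous w := @tanh_field_continuous k.
have w0 u : 0 < w u by exact: tanh_gt0.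
have bh := continuous_bounded_measurable hc.
have bw := continuous_bounded_measurable wc.
have wVc : continuous (fun u => (w u)^-1).
  by move=> u; apply: continuousV; [exact: lt0r_neq0|exact: wc].
have bwV := continuous_bounded_measurable wVc.
have bm2 := bounded_measurableX 2 bm.
have bI := Ising_entropy_bounded_measurable mm.1 m1.
have bA := @potential_bounded_measurable R d J Jc nu _ bm.
have bAw := @potential_bounded_measurable R d J Jc nu _ bw.
have bmA : bounded_measurable (fun u => m u * A m u) by exact: bounded_measurableM.
have lc : continuous (fun u => ln (cosh (h u))).
  by move=> u; apply: (@continuous_comp _ _ _ h (fun x => ln (cosh x))); [exact: hc|exact: ln_cosh_continuous].
have bl := continuous_bounded_measurable lc.
have bX : bounded_measurable (fun u => - (1 / 2) * (m u ^+ 2 / w u * h u)).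
  apply: bounded_measurableM; first exact: bounded_measurable_cst.
  by apply: bounded_measurableM => //; exact: bounded_measurableM.
have step : \int[nu]_u (- (1 / 2) * (m u ^+ 2 / w u * h u) + Ising_entropy (m u)) <= mf_functional m.
  rewrite /mf_functional RintD// [leRHS]RintD//; last first.
    by apply: bounded_measurableM => //; exact: bounded_measurable_cst.
  rewrite lerD2r !RintZ//; last by apply: bounded_measurableM => //; exact: bounded_measurableM.
  have := pair_integral_le wc w0.
  have : beta * \int[nu]_u (m u ^+ 2 / w u * A w u) <= \int[nu]_u (m u ^+ 2 / w u * h u).
    rewrite -RintZ; last by apply: bounded_measurableM => //; exact: bounded_measurableM.
    apply: le_Rint.
    by apply: bounded_measurableM; [exact: bounded_measurable_cst|apply: bounded_measurableM => //; exact: bounded_measurableM].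
    by apply: bounded_measurableM => //; exact: bounded_measurableM.
    move=> u; rewrite mulrCA; apply: ler_wpM2l.
      by apply: divr_ge0; [exact: sqr_ge0|exact/ltW/w0].
    by apply: le_trans (field_supersolution k u); rewrite lerDl invr_ge0.
  move: (\int[nu]_u _) (\int[nu]_u _) (\int[nu]_u _) => x y z xy zx.
  have := ler_wpM2l beta0 zx; lra.
apply: le_trans step; apply: le_Rint.
apply: bounded_measurableD.
    apply: bounded_measurableB => //.
    by apply: bounded_measurableM; [exact: bounded_measurableM|exact: bounded_measurable_cst].
  apply: bounded_measurableM; last exact: bounded_measurable_cst.
  by apply: bounded_measurableX; apply: bounded_measurableB => //; exact: bounded_measurableX.
exact: bounded_measurableD.
move=> u; have := Ising_entropy_ge (h0 u) (m1 u).
rewrite -/(w u); have -> : m u ^+ 2 * h u / (2 * w u) = 1 / 2 * (m u ^+ 2 / w u * h u).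
  by field; rewrite lt0r_neq0.
lra.
Qed.

End stability.

Lemma max_magnetizationP : magnetization max_magnetization.
Proof.
split; first exact: max_magnetization_bounded_measurable.1.
by move=> u; have /andP[h1 h2] := tanh_bound (field_lim u); rewrite !ltW.
Qed.

Lemma mf_functional_max : mf_functional max_magnetization =
  \int[nu]_u (field_lim u * tanh (field_lim u) / 2 - ln (cosh (field_lim u))).
Proof.
apply: eq_Rintegral => u _; rewrite /max_magnetization Ising_entropy_tanh.
rewrite mulrCA -/max_magnetization mulNr mulrN.
have -> : beta / 2 * A max_magnetization u = field_lim u / 2 by rewrite field_lim_eq mulrAC.
by field.
Qed.

Lemma ln_cosh_norm_le (x : R) : `|ln (cosh x)| <= `|x|.
Proof.
have c1 : 1 <= cosh x.
  have := expR_ge1Dx x; have := expR_ge1Dx (- x); rewrite /cosh; lra.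
rewrite ger0_norm ?ln_ge0//.
rewrite -[leRHS]expRK ler_ln ?posrE ?expR_gt0 ?cosh_gt0//.
have h1 : expR x <= expR `|x| by rewrite ler_expR ler_norm.
have h2 : expR (- x) <= expR `|x| by rewrite ler_expR -normrN ler_norm.
rewrite /cosh; lra.
Qed.

Lemma field_gap_cvg m : magnetization m ->
  \int[nu]_u (field k u * tanh (field k u) / 2 - ln (cosh (field k u)) +
     (m u ^+ 2 - tanh (field k u) ^+ 2) ^+ 2 / 12) @[k --> \oo] -->
  \int[nu]_u (field_lim u * tanh (field_lim u) / 2 - ln (cosh (field_lim u)) +
     (m u ^+ 2 - max_magnetization u ^+ 2) ^+ 2 / 12).
Proof.
move=> mm.
have bm : bounded_measurable m.
  by split; [exact: mm.1|exists 1 => u; rewrite ler_norml mm.2].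
apply: (Rint_dominated nu (M := field0 * 1 / 2 + field0 + 1 / 12) _ _ _).2.
move=> k.
  have bh := continuous_bounded_measurable (@field_continuous k).
  have bw := tanh_field_bounded_measurable k.
  have lc : continuous (fun u => ln (cosh (field k u))).
    by move=> u; apply: (@continuous_comp _ _ _ (field k) (fun x => ln (cosh x))); [exact: field_continuous|exact: ln_cosh_continuous].
  suff [] : bounded_measurable (fun u => field k u * tanh (field k u) / 2 - ln (cosh (field k u)) +
     (m u ^+ 2 - tanh (field k u) ^+ 2) ^+ 2 / 12) by [].
  apply: bounded_measurableD.
    apply: bounded_measurableB; last exact: continuous_bounded_measurable.
    by apply: bounded_measurableM; [exact: bounded_measurableM|exact: bounded_measurable_cst].
  apply: bounded_measurableM; last exact: bounded_measurable_cst.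
  by apply: bounded_measurableX; apply: bounded_measurableB; exact: bounded_measurableX.
move=> k u; have hk := field_le0 k u; have h0 := field_gt0 k u.
  have hn : `|field k u| <= field0 by rewrite gtr0_norm.
  apply: le_trans (ler_normD _ _) _; apply: lerD.
    apply: le_trans (ler_normB _ _) _; apply: lerD; last exact: le_trans (ln_cosh_norm_le _) hn.
    rewrite normrM [ `|2^-1|]ger0_norm ?invr_ge0// normrM.
    by apply: ler_wpM2r; [rewrite invr_ge0|apply: ler_pM => //; exact: tanh_norm_le1].
  rewrite normrM [ `|12^-1|]ger0_norm ?invr_ge0// ger0_norm ?sqr_ge0//.
  apply: ler_wpM2r; first by rewrite invr_ge0.
  have a1 : 0 <= m u ^+ 2 <= 1.
    by rewrite sqr_ge0 -[m u ^+ 2]real_normK ?num_real// expr_le1// ler_norml mm.2.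
  have a2 : 0 <= tanh (field k u) ^+ 2 <= 1.
    by rewrite sqr_ge0 -[_ ^+ 2]real_normK ?num_real// expr_le1// tanh_norm_le1.
  by rewrite -[X in X <= _]real_normK ?num_real// expr_le1// ler_norml; lra.
move=> u.
have ch := @field_cvg u; have ct := @tanh_field_cvg u.
apply: cvgD.
  apply: cvgB; first by apply: cvgM; [exact: cvgM|exact: cvg_cst].
  exact: (cvg_comp _ _ ch (@ln_cosh_continuous R (field_lim u))).
apply: cvgM; last exact: cvg_cst.
rewrite expr2; under eq_fun do rewrite expr2.
by apply: cvgM; (apply: cvgB; [exact: cvg_cst|]); rewrite expr2;
  under eq_fun do rewrite expr2; apply: cvgM.
Qed.

(** The limit of [mf_functional_ge_field]. Arguing with [field_lim] itself would require division by
    its [tanh], which may vanish. *)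
Lemma mf_functional_stability m : magnetization m ->
  mf_functional max_magnetization
    + \int[nu]_u ((m u ^+ 2 - max_magnetization u ^+ 2) ^+ 2 / 12) <= mf_functional m.
Proof.
move=> mm.
have bm : bounded_measurable m.
  by split; [exact: mm.1|exists 1 => u; rewrite ler_norml mm.2].
have bl := field_lim_bounded_measurable.
have bM := max_magnetization_bounded_measurable.
rewrite mf_functional_max -RintD; last 2 first.
apply: bounded_measurableB.
    by apply: bounded_measurableM; [exact: bounded_measurableM|exact: bounded_measurable_cst].
  split; last first.
    by have [_ [M hM]] := bl; exists M => u; apply: le_trans (ln_cosh_norm_le _) (hM u).
  have ml : measurable_fun setT (fun x : R => ln (cosh x)).
    by apply: continuous_measurable_fun; exact: ln_cosh_continuous.
  exact: (measurableT_comp ml bl.1).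
apply: bounded_measurableM; last exact: bounded_measurable_cst.
  by apply: bounded_measurableX; apply: bounded_measurableB; exact: bounded_measurableX.
have c := field_gap_cvg mm.
rewrite -(cvg_lim _ c)//; apply: limr_le; first by apply/cvg_ex; eexists; exact: c.
by apply: nearW => k; exact: mf_functional_ge_field.
Qed.

(** Stability makes the squares agree [nu]-almost everywhere. The conclusion is put in terms of
    potentials, which are compared at every [u] and feed the pointwise mean-field equation. *)
Lemma mf_minimizer_unique m : magnetization m -> (forall u, 0 <= m u) ->
  mf_functional m <= mf_functional max_magnetization ->
  (forall u, A m u = A max_magnetization u).
Proof.
move=> mm m0 mle u.
have bm : bounded_measurable m.
  by split; [exact: mm.1|exists 1 => v; rewrite ler_norml mm.2].
have bM := max_magnetization_bounded_measurable.
have M0 v : 0 <= max_magnetization v by rewrite tanh_ge0// field_lim_ge0.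
pose g v := (m v ^+ 2 - max_magnetization v ^+ 2) ^+ 2.
have bg : bounded_measurable g.
  by apply: bounded_measurableX; apply: bounded_measurableB; exact: bounded_measurableX.
have Ig : \int[nu]_v g v <= 0.
  have := mf_functional_stability mm; rewrite -/g.
  have -> : \int[nu]_v (g v / 12) = \int[nu]_v g v / 12.
    by under eq_Rintegral do rewrite mulrC; rewrite RintZ// mulrC.
  lra.
apply/eqP; rewrite -subr_eq0 -normr_le0; apply/ler_addgt0Pl => e e0; rewrite addr0.
have Js0 := J_sup_ge0.
have mass0 : 0 <= fine (nu setT) by rewrite fine_ge0.
(* Chosen so that the constant part [J_sup * c] integrates to at most [e]; the quadratic part has
   integral at most [0]. *)
pose c := e / (J_sup * fine (nu setT) + 1).
have C1 : 0 < J_sup * fine (nu setT) + 1 by rewrite ltr_pwDr// mulr_ge0.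
have c0 : 0 < c by rewrite divr_gt0.
have bd : bounded_measurable (fun v => m v - max_magnetization v) by exact: bounded_measurableB.
rewrite /potential -RintB; try exact: J_mul_bounded_measurable.
apply: le_trans (le_normr_Rintegral _ _) _ => //.
  apply: bounded_measurable_integrable.
  by apply: bounded_measurableB; exact: J_mul_bounded_measurable.
apply: (@le_trans _ _ (\int[nu]_v (J_sup * c + (J_sup / c ^+ 3) * g v))).
  apply: le_Rint.
  by apply/bounded_measurable_norm/bounded_measurableB; exact: J_mul_bounded_measurable.
  apply: bounded_measurableD; first exact: bounded_measurable_cst.
    by apply: bounded_measurableM => //; exact: bounded_measurable_cst.
  move=> v; rewrite -mulrBr normrM mulrAC -mulrA -mulrDr ler_pM ?J_norm_le//.
  by apply: sqr_diff_bound.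
rewrite RintD; [|exact: bounded_measurable_cst|by apply: bounded_measurableM => //; exact: bounded_measurable_cst].
rewrite Rint_cst RintZ//.
apply: (@le_trans _ _ (J_sup * c * fine (nu setT) + 0)).
  by rewrite lerD2l mulr_ge0_le0// divr_ge0// exprn_ge0//; exact: ltW.
have eE : e = c * (J_sup * fine (nu setT) + 1) by rewrite divfK ?lt0r_neq0.
by rewrite addr0 [leRHS]eE mulrAC mulrC ler_pM2l// lerDl.
Qed.

Section density.
Hypothesis nu_dom : nu `<< torus_lebesgue R d.

Let mass0 : 0 <= mass nu. Proof. exact: fine_ge0. Qed.

Lemma Rint_normalized_density f : bounded_measurable f ->
  \int[torus_lebesgue R d]_v (normalized_density nu v * f v) = (mass nu)^-1 * \int[nu]_v f v.
Proof.
move=> bf; rewrite -RintZ// -(Rint_density nu_dom).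
  by apply: eq_Rintegral => v _; rewrite /normalized_density [RHS]mulrCA mulrA.
by apply: bounded_measurableM => //; exact: bounded_measurable_cst.
Qed.

Lemma Rint_normalized_density_kernel m u : bounded_measurable m ->
  \int[torus_lebesgue R d]_v (normalized_density nu v * m v * J (u - v)) = (mass nu)^-1 * A m u.
Proof.
move=> bm; rewrite -Rint_normalized_density; last exact: J_mul_bounded_measurable.
by apply: eq_Rintegral => v _; rewrite -mulrA [m v * _]mulrC.
Qed.

Lemma Ising_functionalE m : magnetization m -> mass nu != 0 ->
  Ising_functional J (normalized_density nu) (mass nu * beta) m = (mass nu)^-1 * mf_functional m.
Proof.
move=> mm mn0.
have bm : bounded_measurable m.
  by split; [exact: mm.1|exists 1 => u; rewrite ler_norml mm.2].
have bI := Ising_entropy_bounded_measurable mm.1 mm.2.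
have bA := @potential_bounded_measurable R d J Jc nu _ bm.
rewrite -Rint_normalized_density; last first.
  apply: bounded_measurableD => //; apply: bounded_measurableM; first exact: bounded_measurable_cst.
  exact: bounded_measurableM.
apply: eq_Rintegral => u _; congr (_ * (_ + _)).
have -> : \int[torus_lebesgue R d]_v (normalized_density nu v * m u * m v * J (u - v)) =
    (mass nu)^-1 * (m u * A m u).
  rewrite -RintZ; last exact: J_mul_bounded_measurable.
  rewrite -Rint_normalized_density; last first.
    by apply: bounded_measurableM; [exact: bounded_measurable_cst|exact: J_mul_bounded_measurable].
  by apply: eq_Rintegral => v _; rewrite -!mulrA [m v * _]mulrC.
by field.
Qed.

Lemma max_magnetization_is_minimizer : mass nu != 0 ->
  is_nonneg_minimizer J (normalized_density nu) (mass nu * beta) max_magnetization.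
Proof.
move=> mn0; have mM := max_magnetizationP.
have bM := max_magnetization_bounded_measurable.
split=> [//|u|m mm|u].
  by rewrite tanh_ge0// field_lim_ge0.
  rewrite !Ising_functionalE// ler_wpM2l ?invr_ge0//.
  apply: le_trans (mf_functional_stability mm); rewrite lerDl.
  by apply: Rintegral_ge0 => u _; rewrite divr_ge0 ?sqr_ge0.
rewrite Rint_normalized_density_kernel// /max_magnetization field_lim_eq.
by congr tanh; rewrite -/max_magnetization; field.
Qed.

(** The minimizer picked by choice solves the mean-field equation at every point, and its potential
    is that of [max_magnetization]; hence the two agree everywhere, not only almost everywhere. *)
Lemma nonneg_minimizerE u : mass nu != 0 ->
  nonneg_minimizer J (normalized_density nu) (mass nu * beta) u = tanh (field_lim u).
Proof.
move=> mn0; rewrite /nonneg_minimizer.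
case: xgetP => [m _ [mm m0 mmin meq]|/(_ max_magnetization)]; last first.
  by move=> /(_ (max_magnetization_is_minimizer mn0)).
have bm : bounded_measurable m.
  by split; [exact: mm.1|exists 1 => v; rewrite ler_norml mm.2].
have mle : mf_functional m <= mf_functional max_magnetization.
  have mM := max_magnetizationP; have := mmin _ mM.
  by rewrite !Ising_functionalE// ler_pM2l// invr_gt0 lt0r mn0.
have Am := mf_minimizer_unique mm m0 mle u.
rewrite meq Rint_normalized_density_kernel// field_lim_eq -Am.
by congr tanh; field.
Qed.

Lemma Dcomp2E u : Dcomp J beta 2 u nu = cosh (field_lim u).
Proof.
rewrite /Dcomp /Dfun eqxx; case: eqP => [m0|/eqP mn0]; last first.
  by rewrite nonneg_minimizerE// sqrt_oneBtanh2.
(* Without mass the potential vanishes, and the convention [D = 1] agrees with [cosh 0 = 1]. *)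
have -> : field_lim u = 0.
  rewrite field_lim_eq; apply/eqP; rewrite mulf_eq0 -[A _ _ == 0]normr_le0; apply/orP; right.
  have := potential_norm_le (M := 1) u max_magnetization_bounded_measurable (fun v => tanh_norm_le1 _).
  by rewrite -/(mass nu) m0 mulr0.
by rewrite /cosh oppr0 expR0 -mulr2n -mulr_natr mul1r divff.
Qed.

End density.

End mean_field.

(** * Gibbs measures and block profiles *)

Section gibbs.
Local Close Scope classical_set_scope.
Context {R : realType} {V A B : finType}.
Variables (blk : V -> B) (Cx : V -> {set A}).
Implicit Types (s : {ffun V -> A}) (p : V -> A -> R) (k : V -> V -> R).

(** The empirical law of the spins in the block of [x], indexed by sites so that it can be compared
    with an arbitrary family of one-site laws. *)
Definition profile s x a : R :=
  (\sum_y ((blk y == blk x) && (s y == a))%:R) / \sum_y (blk y == blk x)%:R.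

Lemma block_size_gt0 x : 0 < \sum_y (blk y == blk x)%:R :> R.
Proof.
rewrite (bigD1 x)//= eqxx ltr_pwDl// sumr_ge0// => y _.
Qed.

Lemma profile_ge0 s x a : 0 <= profile s x a.
Proof. by rewrite divr_ge0// sumr_ge0. Qed.

(** Averaging over blocks is invisible to a function that is constant on blocks: each [y] is counted
    once for every [x] in its block and divided by the size of that block. *)
Lemma sum_profile (f : V -> A -> R) s :
  (forall x y a, blk x = blk y -> f x a = f y a) ->
  \sum_x \sum_a profile s x a * f x a = \sum_x f x (s x).
Proof.
move=> fB.
have E x : \sum_a profile s x a * f x a =
    \sum_y (blk y == blk x)%:R / (\sum_z (blk z == blk y)%:R) * f y (s y).
  transitivity (\sum_a \sum_y (blk y == blk x)%:R * (s y == a)%:R / (\sum_z (blk z == blk x)%:R) * f x a).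
    apply: eq_bigr => a _; rewrite /profile !mulr_suml.
    by apply: eq_bigr => y _; rewrite -natrM mulnb.
  rewrite exchange_big/=; apply: eq_bigr => y _.
  rewrite (bigD1 (s y))//= eqxx mulr1 [X in _ + X]big1 ?addr0; last first.
    by move=> a /negbTE; rewrite eq_sym => ->; rewrite mulr0 !mul0r.
  by case: eqVneq => [e|]; rewrite ?mul0r// e (fB x y)// e.
under eq_bigr do rewrite E.
rewrite exchange_big/=; apply: eq_bigr => y _.
rewrite -mulr_suml -mulr_suml.
under [X in X / _ * _]eq_bigr do rewrite eq_sym.
by rewrite divff ?mul1r// lt0r_neq0 ?block_size_gt0.
Qed.

Lemma profile1 s x : \sum_a profile s x a = 1.
Proof.
rewrite -mulr_suml exchange_big/=.
under eq_bigr => y _.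
  rewrite (bigD1 (s y))//= eqxx andbT big1 ?addr0; last first.
    by move=> a /negbTE; rewrite eq_sym => ->; rewrite andbF.
  over.
by rewrite divff// lt0r_neq0 ?block_size_gt0.
Qed.

Lemma profile_gt0 s x : 0 < profile s x (s x).
Proof.
rewrite divr_gt0 ?block_size_gt0//.
by rewrite (bigD1 x)//= !eqxx ltr_pwDl// sumr_ge0.
Qed.

Lemma profile_block s x y a : blk x = blk y -> profile s x a = profile s y a.
Proof. by move=> e; rewrite /profile e. Qed.

Definition configs : {set {ffun V -> A}} := [set s : {ffun V -> A} | [forall x, s x \in Cx x]].

Definition is_profile p := [/\ forall x a, 0 <= p x a, forall x, \sum_a p x a = 1
  & forall x a, a \notin Cx x -> p x a = 0].

Lemma profileP s : (forall x y, blk x = blk y -> Cx x = Cx y) -> s \in configs ->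
  is_profile (profile s).
Proof.
move=> CB; rewrite inE => /forallP sC; split=> [x a|x|x a aC].
  exact: profile_ge0.
  exact: profile1.
rewrite /profile big1 ?mul0r// => y _; case: eqP => //= e.
by case: eqP => // sa; rewrite -sa -(CB _ _ e) sC in aC.
Qed.

Definition neg_entropy p := \sum_x \sum_a p x a * ln (p x a).
Definition pair_energy k p := \sum_x \sum_y k x y * \sum_a p x a * p y a.
Definition free_energy k p := neg_entropy p - pair_energy k p.
Definition gibbs_weight k s := expR (\sum_x \sum_y k x y * (s x == s y)%:R).

Lemma gibbs_weight_gt0 k s : 0 < gibbs_weight k s.
Proof. exact: expR_gt0. Qed.

Definition product_weight p s := \prod_x p x (s x).

Lemma sum_product_weight p (F : V -> A -> R) :
  \sum_s product_weight p s * \prod_x F x (s x) = \prod_x \sum_a p x a * F x a.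
Proof.
rewrite bigA_distr_bigA/=; apply: eq_bigr => s _.
by rewrite /product_weight -big_split.
Qed.

Section product_weight.
Variables (p : V -> A -> R) (p1 : forall x, \sum_a p x a = 1).

Lemma product_weight1 : \sum_s product_weight p s = 1.
Proof.
have := sum_product_weight p (fun _ _ => 1).
rewrite (eq_bigr (product_weight p)) => [->|s _]; last by rewrite big1 ?mulr1.
 rewrite big1// => x _; rewrite -[RHS](p1 x).
by apply: eq_bigr => a _; rewrite mulr1.
Qed.

Lemma expect_site (f : A -> R) x :
  \sum_s product_weight p s * f (s x) = \sum_a p x a * f a.
Proof.
have := sum_product_weight p (fun z a => if z == x then f a else 1).
rewrite (eq_bigr (fun s : {ffun V -> A} => product_weight p s * f (s x))) => [->|s _]; last first.
  by rewrite (bigD1 x)//= eqxx big1 ?mulr1// => z /negbTE ->.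
rewrite (bigD1 x)//= [X in _ * X]big1 ?mulr1.
  by apply: eq_bigr => a _; rewrite eqxx.
move=> z /negbTE zx; rewrite -[RHS](p1 z); apply: eq_bigr => a _.
by rewrite zx mulr1.
Qed.

Lemma expect_pair x y : x != y ->
  \sum_s product_weight p s * (s x == s y)%:R = \sum_a p x a * p y a.
Proof.
move=> xy.
transitivity (\sum_a \sum_s product_weight p s * ((s x == a)%:R * (s y == a)%:R)).
  rewrite exchange_big/=; apply: eq_bigr => s _; rewrite -mulr_sumr; congr (_ * _).
  rewrite (bigD1 (s x))//= eqxx mul1r big1 ?addr0 1?eq_sym//.
  by move=> a /negbTE; rewrite eq_sym => ->; rewrite mul0r.
apply: eq_bigr => a _.
have := sum_product_weight p (fun z b => if (z == x) || (z == y) then (b == a)%:R else 1).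
rewrite (eq_bigr (fun s : {ffun V -> A} => product_weight p s * ((s x == a)%:R * (s y == a)%:R))) => [->|s _]; last first.
  rewrite (bigD1 x)//= eqxx (bigD1 y)/=; last by rewrite eq_sym.
  rewrite eqxx orbT [X in _ * (_ * (_ * X))]big1 ?mulr1//.
  by move=> z /andP[/negbTE -> /negbTE ->].
have S z : \sum_b p z b * (b == a)%:R = p z a.
  rewrite (bigD1 a)//= eqxx mulr1 big1 ?addr0// => b /negbTE ->.
  by rewrite mulr0.
rewrite (bigD1 x)//= eqxx (bigD1 y)/=; last by rewrite eq_sym.
rewrite eqxx orbT /= !S [X in _ * (_ * X)]big1 ?mulr1//.
move=> z /andP[/negbTE -> /negbTE ->] /=.
by rewrite -[RHS](p1 z); apply: eq_bigr => b _; rewrite mulr1.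
Qed.

End product_weight.

(* Gibbs' variational bound: Jensen's inequality for the product measure [p]. *)
Lemma gibbs_partition_ge k p : (forall x y, 0 <= k x y) -> is_profile p ->
  expR (- free_energy k p) <= \sum_(s in configs) gibbs_weight k s.
Proof.
move=> k0 [p0 p1 pC].
pose P s := product_weight p s.
pose H s := \sum_x \sum_y k x y * (s x == s y)%:R.
set M := - free_energy k p.
have P0 s : 0 <= P s by apply: prodr_ge0.
(* The tangent [expR M * (1 + X - M) <= expR X]. Averaged over the product weight it leaves only the
   mean of [X], which is shown to be at least [M]. *)
have key s : s \in configs -> P s * (expR M * (1 + (H s - (\sum_x ln (p x (s x)))) - M)) <= gibbs_weight k s.
  move=> _; have [Ps0|Ps0] := eqVneq (P s) 0; first by rewrite Ps0 mul0r ltW ?gibbs_weight_gt0.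
  have Pp : 0 < P s by rewrite lt0r Ps0 P0.
  have pp x : 0 < p x (s x).
    rewrite lt0r p0 andbT; apply: contraNneq Ps0 => e.
    by rewrite /P /product_weight (bigD1 x)//= e mul0r.
  have -> : gibbs_weight k s = P s * expR (H s - \sum_x ln (p x (s x))).
    rewrite expRB mulrCA -[LHS]mulr1; congr (_ * _).
    rewrite expR_sum; under eq_bigr do rewrite lnK ?posrE//.
    by rewrite divff.
  rewrite ler_pM2l// -addrA -[X in _ <= expR X](subrK M) expRD mulrC.
  by rewrite ler_pM2r ?expR_gt0// expR_ge1Dx.
have key0 s : s \notin configs -> P s = 0.
  rewrite inE => /forallPn[x sx]; rewrite /P /product_weight (bigD1 x)//=.
  by rewrite pC// mul0r.
apply: (@le_trans _ _ (\sum_(s in configs) P s * (expR M * (1 + (H s - (\sum_x ln (p x (s x)))) - M)))); last exact: ler_sum.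
have -> : \sum_(s in configs) P s * (expR M * (1 + (H s - \sum_x ln (p x (s x))) - M)) =
  \sum_s P s * (expR M * (1 + (H s - \sum_x ln (p x (s x))) - M)).
  rewrite [RHS](bigID (mem configs))/= [X in _ + X]big1 ?addr0//.
  by move=> s sC; rewrite key0// mul0r.
under eq_bigr do rewrite mulrCA.
rewrite -mulr_sumr ler_pMr ?expR_gt0//.
under eq_bigr do rewrite addrAC mulrDr.
rewrite big_split/= -mulr_suml product_weight1// mul1r -addrA lerDl addrC subr_ge0.
under eq_bigr do rewrite mulrBr.
rewrite sumrB /M opprB lerB//.
  rewrite /pair_energy /H.
  under [leRHS]eq_bigr do rewrite mulr_sumr.
  rewrite [leRHS]exchange_big/=; apply: ler_sum => x _.
  under [leRHS]eq_bigr do rewrite mulr_sumr.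
  rewrite [leRHS]exchange_big/=; apply: ler_sum => y _.
  under [leRHS]eq_bigr do rewrite mulrCA.
  rewrite -mulr_sumr ler_wpM2l//.
  (* On the diagonal a spin agrees with itself with probability one, while the pair energy only
     counts the sum of the squares of [p x a]. *)
  have [<-|xy] := eqVneq x y; last by rewrite expect_pair.
  under [leRHS]eq_bigr do rewrite eqxx mulr1.
  rewrite product_weight1// -(p1 x); apply: ler_sum => a _.
  rewrite ler_piMr// -(p1 x) (bigD1 a)//= lerDl sumr_ge0//.
rewrite /neg_entropy; under eq_bigr do rewrite mulr_sumr.
rewrite exchange_big/=; apply: ler_sum => x _.
by rewrite (expect_site p1 (fun a => ln (p x a))).
Qed.

(** The profile coded by integer counts. The code lives in a finite type whose cardinality is
    polynomial in the number of sites when blocks and colours are fixed. *)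
Definition block_count s : {ffun B * A -> 'I_#|V|.+1} :=
  [ffun ba => inord #|[set y | (blk y == ba.1) && (s y == ba.2)]|].

Lemma block_count_profile s s' : block_count s = block_count s' ->
  profile s = profile s'.
Proof.
move=> e; apply/funext => x; apply/funext => a; rewrite /profile; congr (_ / _).
have := congr1 (fun f : {ffun B * A -> 'I_#|V|.+1} => f (blk x, a) : nat) e.
rewrite !ffunE !inordK ?ltnS ?max_card// => c.
have H (t : {ffun V -> A}) : \sum_y ((blk y == blk x) && (t y == a))%:R =
    #|[set y | (blk y == blk x) && (t y == a)]|%:R :> R.
  rewrite -sum1_card natr_sum [RHS]big_mkcond/=; apply: eq_bigr => y _.
  by rewrite inE; case: ifP.
by rewrite !H c.
Qed.

(** Method of types: under the product law of its own profile, each configuration with this count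
    has probability [expR (neg_entropy _)], and the total is at most [1]. *)
Lemma card_block_count s0 :
  #|[set s | block_count s == block_count s0]|%:R * expR (neg_entropy (profile s0)) <= 1.
Proof.
rewrite -[leRHS](product_weight1 (profile1 s0)).
rewrite -sum1_card natr_sum mulr_suml [leRHS](bigID (mem [set s | block_count s == block_count s0]))/=.
rewrite -[leLHS]addr0 lerD ?sumr_ge0//; last first.
  by move=> s _; apply: prodr_ge0 => x _; exact: profile_ge0.
apply: ler_sum => s; rewrite inE => /eqP/block_count_profile e.
rewrite mul1r /product_weight -e /neg_entropy.
rewrite (sum_profile (f := fun x a => ln (profile s x a))); last first.
  by move=> x y a h; rewrite (profile_block s a h).
rewrite expR_sum; apply: ler_prod => x _; rewrite expR_ge0/=.
by rewrite lnK ?posrE// profile_gt0.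
Qed.

(** For a kernel read off at block representatives the energy is exactly a function of the profile.
    Replacing [k] by it costs [e] per pair, once in each of the two energies. *)
Lemma pair_energy_profile k (e : R) s :
  (forall x x' y y', blk x = blk x' -> blk y = blk y' -> `|k x y - k x' y'| <= e) ->
  `|\sum_x \sum_y k x y * (s x == s y)%:R - pair_energy k (profile s)| <= 2 * e * #|V|%:R ^+ 2.
Proof.
move=> kB.
pose rep x := odflt x [pick y | blk y == blk x].
have repE x : blk (rep x) = blk x.
  by rewrite /rep; case: pickP => [y /eqP//|/(_ x)]; rewrite eqxx.
have repB x y : blk x = blk y -> rep x = rep y.
  by rewrite /rep => ->; case: pickP => // /(_ y); rewrite eqxx.
pose k' x y := k (rep x) (rep y).
have E : \sum_x \sum_y k' x y * (s x == s y)%:R = pair_energy k' (profile s).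
  rewrite -(sum_profile (f := fun x a => \sum_y k' x y * (a == s y)%:R)); last first.
    by move=> x y a h; apply: eq_bigr => z _; rewrite /k' (repB _ _ h).
  apply: eq_bigr => x _.
  transitivity (\sum_a \sum_y k' x y * (profile s x a * profile s y a)); last first.
    by rewrite exchange_big/=; apply: eq_bigr => y _; rewrite mulr_sumr.
  apply: eq_bigr => a _.
  rewrite -(sum_profile (f := fun y b => k' x y * (a == b)%:R)); last first.
    by move=> y z b h; rewrite /k' (repB _ _ h).
  rewrite mulr_sumr; apply: eq_bigr => y _.
  rewrite (bigD1 a)//= eqxx big1 ?addr0; last first.
    by move=> b /negbTE; rewrite eq_sym => ->; rewrite !mulr0.
  by rewrite mulr1; ring.
have cst (f : V -> V -> R) : (forall x y, `|f x y| <= e) -> `|\sum_x \sum_y f x y| <= e * #|V|%:R ^+ 2.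
  move=> fe; apply: le_trans (ler_norm_sum _ _ _) _.
  apply: (@le_trans _ _ (\sum_(x : V) \sum_(y : V) e)).
    by apply: ler_sum => x _; apply: le_trans (ler_norm_sum _ _ _) _; apply: ler_sum.
  by rewrite !sumr_const -mulrnA -[leLHS]mulr_natr natrM expr2.
have -> : \sum_x \sum_y k x y * (s x == s y)%:R - pair_energy k (profile s) =
   (\sum_x \sum_y (k x y - k' x y) * (s x == s y)%:R)
   - \sum_x \sum_y (k x y - k' x y) * \sum_a profile s x a * profile s y a.
  have S (f : V -> V -> R) : \sum_x \sum_y (k x y - k' x y) * f x y =
     \sum_x \sum_y k x y * f x y - \sum_x \sum_y k' x y * f x y.
    by rewrite -sumrB; apply: eq_bigr => x _; rewrite -sumrB; apply: eq_bigr => y _; rewrite mulrBl.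
  by rewrite !S E opprB addrA subrK.
have kk x y : `|k x y - k' x y| <= e by apply: kB; rewrite repE.
have e2 : 2 * e * #|V|%:R ^+ 2 = e * #|V|%:R ^+ 2 + e * #|V|%:R ^+ 2 :> R by ring.
rewrite e2; apply: le_trans (ler_normB _ _) _; apply: lerD; apply: cst => x y; rewrite normrM.
  by rewrite -[leRHS]mulr1 ler_pM//; case: eqP; rewrite ?normr1 ?normr0.
have pp0 : 0 <= \sum_a profile s x a * profile s y a.
  by apply: sumr_ge0 => a _; rewrite mulr_ge0 ?profile_ge0.
rewrite -[leRHS]mulr1 ler_pM// ger0_norm// -(profile1 s x); apply: ler_sum => a _.
rewrite ler_piMr ?profile_ge0// -(profile1 s y) (bigD1 a)//= lerDl sumr_ge0// => b _.
exact: profile_ge0.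
Qed.

(** Group by counts: the size of a group times its largest weight is at most [expR] of minus the
    free energy, up to the block error. *)
Lemma gibbs_sum_le k (e M : R) (S : {set {ffun V -> A}}) :
  (forall x x' y y', blk x = blk x' -> blk y = blk y' -> `|k x y - k x' y'| <= e) ->
  (forall s, s \in S -> M <= free_energy k (profile s)) ->
  \sum_(s in S) gibbs_weight k s <=
    ((#|V|.+1 ^ (#|B| * #|A|))%N)%:R * expR (2 * e * #|V|%:R ^+ 2 - M).
Proof.
move=> kB SM.
rewrite (partition_big block_count predT)//=.
have -> : (#|V|.+1 ^ (#|B| * #|A|))%N = #|{: {ffun B * A -> 'I_#|V|.+1}}|.
  by rewrite card_ffun card_ord card_prod.
rewrite mulr_natl -sumr_const; apply: ler_sum => c _.
have [s0 /andP[s0S /eqP s0c]|no] := pickP (fun s => (s \in S) && (block_count s == c)); last first.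
  by rewrite big_pred0// ltW ?expR_gt0.
apply: (@le_trans _ _ (\sum_(s | block_count s == block_count s0)
    expR (pair_energy k (profile s0) + 2 * e * #|V|%:R ^+ 2))).
  rewrite s0c big_mkcond [leRHS]big_mkcond; apply: ler_sum => s _ /=.
  case: ifP => [/andP[sS /eqP sc]|_]; last by case: ifP => _ //; rewrite ltW ?expR_gt0.
  rewrite sc eqxx ler_expR.
  have e1 : profile s = profile s0 by apply: block_count_profile; rewrite sc s0c.
  have := pair_energy_profile s kB; rewrite -e1 ler_norml => /andP[_]; lra.
have -> : \sum_(s | block_count s == block_count s0) expR (pair_energy k (profile s0) + 2 * e * #|V|%:R ^+ 2)
  = #|[set s | block_count s == block_count s0]|%:R * expR (pair_energy k (profile s0) + 2 * e * #|V|%:R ^+ 2).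
  rewrite -sum1_card natr_sum mulr_suml; apply: eq_big => s; first by rewrite inE.
  by rewrite mul1r.
have h := card_block_count s0.
apply: (@le_trans _ _ (expR (pair_energy k (profile s0) + 2 * e * #|V|%:R ^+ 2 - neg_entropy (profile s0)))).
  by rewrite [leRHS]expRB ler_pdivlMr ?expR_gt0// mulrAC ler_piMl ?expR_ge0.
by rewrite ler_expR; have := SM _ s0S; rewrite /free_energy; lra.
Qed.

(** The upper bound over types against the variational lower bound. The reference [p] is any family
    of one-site laws, constant on blocks or not. *)
Lemma gibbs_prob_le k (e d : R) p (S : {set {ffun V -> A}}) :
  (forall x y, 0 <= k x y) ->
  (forall x x' y y', blk x = blk x' -> blk y = blk y' -> `|k x y - k x' y'| <= e) ->
  is_profile p ->
  (forall s, s \in S -> free_energy k p + d <= free_energy k (profile s)) ->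
  \sum_(s in S) gibbs_weight k s <=
    ((#|V|.+1 ^ (#|B| * #|A|))%N)%:R * expR (2 * e * #|V|%:R ^+ 2 - d)
      * \sum_(s in configs) gibbs_weight k s.
Proof.
move=> k0 kB pP Sd; apply: le_trans (gibbs_sum_le kB Sd) _.
have := gibbs_partition_ge k0 pP.
have -> : 2 * e * #|V|%:R ^+ 2 - (free_energy k p + d) = (2 * e * #|V|%:R ^+ 2 - d) - free_energy k p by lra.
by rewrite [expR (_ - free_energy _ _)]expRD mulrA; apply: ler_wpM2l; rewrite mulr_ge0 ?expR_ge0.
Qed.

End gibbs.

(** * Stability of the class free energies *)

Section real_arithmetic.
Context {R : realFieldType}.
Implicit Types a b t : R.

Lemma positive_part_ge0 t : 0 <= (`|t| + t) / 2.
Proof. by rewrite divr_ge0// -[X in _ + X]opprK subr_ge0 -normrN ler_norm. Qed.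

Lemma negative_part_ge0 t : 0 <= (`|t| - t) / 2.
Proof. by rewrite divr_ge0// subr_ge0 ler_norm. Qed.

Lemma two_point_bound a b : 0 <= a -> 0 <= b -> a + b = 1 -> -1 <= a - b <= 1.
Proof. by move=> a0 b0 ab; apply/andP; split; lra. Qed.

Lemma two_point_law a b : a + b = 1 ->
  a = (1 + 1 * (a - b)) / 2 /\ b = (1 + (- 1) * (a - b)) / 2.
Proof. by move=> ab; split; lra. Qed.

Lemma six_eighths_lt t : 0 < t -> t / 8 + t / 8 * 5 < t.
Proof. by move=> t0; lra. Qed.

End real_arithmetic.

Section class_free_energy.
Local Close Scope classical_set_scope.
Context {R : realType} {V A : finType}.
Variables (S : {set V}) (C : {set A}) (K : V -> V -> R) (beta : R).
Hypotheses (K0 : forall x y, 0 <= K x y) (Ks : forall x y, K x y = K y x) (beta0 : 0 <= beta).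

Definition class_free_energy (p : V -> A -> R) : R :=
  \sum_(x in S) \sum_(a in C) p x a * ln (p x a)
  - beta * \sum_(x in S) \sum_(y in S) K x y * \sum_(a in C) p x a * p y a.

Definition class_profile (p : V -> A -> R) := forall x, x \in S ->
  (forall a, 0 <= p x a) /\ \sum_(a in C) p x a = 1.

Lemma symmetric_sum (f : V -> V -> R) :
  \sum_(x in S) \sum_(y in S) K x y * (f x y + f y x)
  = 2 * \sum_(x in S) \sum_(y in S) K x y * f x y.
Proof.
transitivity (\sum_(x in S) \sum_(y in S) K x y * f x y + \sum_(x in S) \sum_(y in S) K x y * f y x).
  by rewrite -big_split; apply: eq_bigr => x _; rewrite -big_split; apply: eq_bigr => y _; rewrite mulrDr.
rewrite [X in _ + X]exchange_big/= mulr_natl mulr2n; congr (_ + _).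
by apply: eq_bigr => x _; apply: eq_bigr => y _; rewrite Ks.
Qed.

Section potts.
Variables (rho b : R) (hrho : forall x, x \in S -> \sum_(y in S) K x y <= rho).
Hypotheses (C0 : (0 < #|C|)%N) (hb : pinsker b #|C|).

Local Notation r := (#|C|%:R : R).

Let r0 : 0 < r. Proof. by rewrite ltr0n. Qed.

Lemma pinsker_set (p : A -> R) : (forall a, 0 <= p a) -> \sum_(a in C) p a = 1 ->
  b * \sum_(a in C) (p a - r^-1) ^+ 2 <= \sum_(a in C) p a * ln (p a) + ln r.
Proof.
move=> p0 p1.
have eV (F : A -> R) : \sum_(i < #|C|) F (enum_val i) = \sum_(a in C) F a by rewrite [RHS]big_enum_val.
have pp : prob_vector (fun i : 'I_#|C| => p (enum_val i)).
  by split=> [i|]; [exact: p0|rewrite eV].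
have := hb pp; rewrite -(sum_sqr_dev C0 pp).
rewrite (eV (fun a => (p a - r^-1) ^+ 2)) (eV (fun a => p a * ln (r * p a))).
move=> h; apply: le_trans h _; rewrite le_eqVlt; apply/orP; left; apply/eqP.
have -> : ln r = \sum_(a in C) p a * ln r by rewrite -mulr_suml p1 mul1r.
rewrite -big_split; apply: eq_bigr => a _ /=.
have [->|pa0] := eqVneq (p a) 0; first by rewrite !mul0r addr0.
by rewrite lnM ?posrE ?r0 ?lt0r ?pa0 ?p0// mulrDr addrC.
Qed.

Lemma uniform_class_profile : class_profile (fun _ _ => r^-1).
Proof.
move=> x _; split => [a|]; first by rewrite invr_ge0 ltW.
by rewrite sumr_const -[_ *+ _]mulr_natr mulVf ?lt0r_neq0.
Qed.

(** The entropy gains [b] times the squared deviation from uniform. Centring the laws leaves an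
    interaction of deviations, which the row sums bound by [rho] times the squared deviation. *)
Lemma potts_free_energy_gap p : class_profile p ->
  class_free_energy (fun _ _ => r^-1) +
    (b - beta * rho) * \sum_(x in S) \sum_(a in C) (p x a - r^-1) ^+ 2 <= class_free_energy p.
Proof.
move=> pP; pose Q x := \sum_(a in C) (p x a - r^-1) ^+ 2.
have rn0 : r != 0 by rewrite lt0r_neq0.
have sumC (c : R) : \sum_(a in C) c = c * r by rewrite sumr_const -[_ *+ _]mulr_natr.
have Q0 x : 0 <= Q x by apply: sumr_ge0 => a _; exact: sqr_ge0.
have E1 : \sum_(x in S) \sum_(a in C) (r^-1 * ln r^-1) + b * \sum_(x in S) Q x
    <= \sum_(x in S) \sum_(a in C) p x a * ln (p x a).
  rewrite mulr_sumr -big_split; apply: ler_sum => x xS /=.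
  have [p0 p1] := pP _ xS; have := pinsker_set p0 p1.
  rewrite sumC -/(Q x) lnV ?posrE// => h.
  have -> : r^-1 * - ln r * r = - ln r by field.
  by rewrite addrC lerBlDr.
have E2 : \sum_(x in S) \sum_(y in S) K x y * \sum_(a in C) p x a * p y a
    <= \sum_(x in S) \sum_(y in S) K x y * \sum_(a in C) (r^-1 * r^-1)
     + \sum_(x in S) \sum_(y in S) K x y * (1 / 2 * Q x + 1 / 2 * Q y).
  rewrite -big_split; apply: ler_sum => x xS /=; rewrite -big_split; apply: ler_sum => y yS /=.
  rewrite -mulrDr ler_wpM2l//.
  have [_ px1] := pP _ xS; have [_ py1] := pP _ yS.
  have -> : \sum_(a in C) p x a * p y a =
     \sum_(a in C) (r^-1 * r^-1) + \sum_(a in C) (p x a - r^-1) * (p y a - r^-1).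
    have -> : \sum_(a in C) (p x a - r^-1) * (p y a - r^-1) =
       \sum_(a in C) p x a * p y a - r^-1 * \sum_(a in C) p y a - r^-1 * \sum_(a in C) p x a + \sum_(a in C) (r^-1 * r^-1).
      rewrite !mulr_sumr -!sumrB -big_split; apply: eq_bigr => a _ /=; ring.
    by rewrite px1 py1 sumC; field.
  rewrite lerD2l /Q !mulr_sumr -big_split; apply: ler_sum => a _ /=.
  by have := sqr_ge0 ((p x a - r^-1) - (p y a - r^-1)); nra.
have E3 : \sum_(x in S) \sum_(y in S) K x y * (1 / 2 * Q x + 1 / 2 * Q y) <= rho * \sum_(x in S) Q x.
  rewrite (symmetric_sum (fun x _ => 1 / 2 * Q x)) mulr_sumr mulr_sumr; apply: ler_sum => x xS.

  have -> : 2 * (\sum_(y in S) K x y * (1 / 2 * Q x)) = (\sum_(y in S) K x y) * Q x.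
    by rewrite -mulr_suml; field.
  by rewrite ler_wpM2r// hrho.
rewrite /class_free_energy.
have := ler_wpM2l beta0 (le_trans E2 (lerD (lexx _) E3)).
move: E1; rewrite -/Q.
move: (\sum_(x in S) Q x) (\sum_(x in S) \sum_(a in C) p x a * ln (p x a))
  (\sum_(x in S) \sum_(a in C) (r^-1 * ln r^-1)) (\sum_(x in S) \sum_(y in S) K x y * \sum_(a in C) p x a * p y a)
  (\sum_(x in S) \sum_(y in S) K x y * \sum_(a in C) (r^-1 * r^-1)) => q s1 s2 s3 s4 h1 h2.
by rewrite mulrBl; lra.
Qed.

End potts.

Section ising.
Variables (m h : V -> R) (c : R).
Hypotheses (m1 : forall x, x \in S -> -1 <= m x <= 1) (h0 : forall x, 0 < h x).
Hypothesis super : forall x, x \in S -> beta * \sum_(y in S) K x y * tanh (h y) <= h x.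
Hypothesis Kc : forall x y, x \in S -> y \in S -> c <= K x y.

(** The half comes from [\sum_a p x a * p y a = (1 + m x * m y) / 2] for two colours with difference
    [m]. *)
Definition ising_free_energy (m : V -> R) : R :=
  \sum_(x in S) Ising_entropy (m x)
  - beta / 2 * \sum_(x in S) \sum_(y in S) K x y * (m x * m y).

Local Notation w x := (tanh (h x)).

Let w0 x : 0 < w x. Proof. exact: tanh_gt0. Qed.

(** Discrete Schur test as in [pair_integral_le], applied to the modulus of [m] so that the loss
    from opposite signs is kept for [sign_gap]. *)
Lemma pair_sum_le :
  \sum_(x in S) \sum_(y in S) K x y * (`|m x| * `|m y|)
  <= \sum_(x in S) m x ^+ 2 / w x * \sum_(y in S) K x y * w y.
Proof.
rewrite -(ler_pM2l (ltr0n R 2)) -(symmetric_sum (fun x y => `|m x| * `|m y|)).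
have -> : \sum_(x in S) m x ^+ 2 / w x * \sum_(y in S) K x y * w y =
    \sum_(x in S) \sum_(y in S) K x y * (m x ^+ 2 / w x * w y).
  by apply: eq_bigr => x _; rewrite mulr_sumr; apply: eq_bigr => y _; rewrite mulrCA.
rewrite -symmetric_sum; apply: ler_sum => x _; apply: ler_sum => y _.
rewrite ler_wpM2l// -subr_ge0.
have -> : m x ^+ 2 / w x * w y + m y ^+ 2 / w y * w x - (`|m x| * `|m y| + `|m y| * `|m x|) =
  (`|m x| * w y - `|m y| * w x) ^+ 2 / (w x * w y).
  rewrite -[m x ^+ 2]real_normK ?num_real// -[m y ^+ 2]real_normK ?num_real//.
  by field; rewrite !lt0r_neq0.
by rewrite divr_ge0 ?sqr_ge0// mulr_ge0// ltW.
Qed.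

(** With [P] and [M] the positive and negative parts, [|m x| * |m y| - m x * m y] equals
    [2 * (P x * M y + M x * P y)], and the kernel is at least [c]. *)
Lemma sign_gap :
  4 * c * (\sum_(x in S) (`|m x| + m x) / 2) * (\sum_(x in S) (`|m x| - m x) / 2)
  <= \sum_(x in S) \sum_(y in S) K x y * (`|m x| * `|m y|)
   - \sum_(x in S) \sum_(y in S) K x y * (m x * m y).
Proof.
pose P x : R := (`|m x| + m x) / 2; pose M x : R := (`|m x| - m x) / 2.
have P0 x : 0 <= P x := positive_part_ge0 (m x).
have M0 x : 0 <= M x := negative_part_ge0 (m x).
have -> : 4 * c * (\sum_(x in S) P x) * (\sum_(x in S) M x) =
   \sum_(x in S) \sum_(y in S) c * (2 * (P x * M y + M x * P y)).
  transitivity (2 * c * ((\sum_(x in S) P x) * (\sum_(x in S) M x) + (\sum_(x in S) M x) * (\sum_(x in S) P x))); first ring.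
  rewrite !mulr_suml -big_split mulr_sumr; apply: eq_bigr => x _ /=.
  rewrite !mulr_sumr -big_split mulr_sumr; apply: eq_bigr => y _ /=; ring.
rewrite -sumrB; apply: ler_sum => x xS; rewrite -sumrB; apply: ler_sum => y yS.
rewrite -mulrBr.
have -> : `|m x| * `|m y| - m x * m y = 2 * (P x * M y + M x * P y) by rewrite /P /M; field.
by rewrite ler_wpM2r ?Kc// mulr_ge0// addr_ge0// mulr_ge0.
Qed.

(** Discrete counterpart of [mf_functional_ge_field]. The subtracted sum is the defect of [tanh h]
    as a solution: it arises because the free energy is compared with its value at [tanh h], where
    [h] is only a supersolution. *)
Lemma ising_free_energy_gap :
  ising_free_energy (fun x => w x)
   + (\sum_(x in S) (m x ^+ 2 - w x ^+ 2) ^+ 2) / 12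
   + 2 * beta * c * (\sum_(x in S) (`|m x| + m x) / 2) * (\sum_(x in S) (`|m x| - m x) / 2)
   - (\sum_(x in S) w x * (h x - beta * \sum_(y in S) K x y * w y)) / 2
  <= ising_free_energy m.
Proof.
have E1 : \sum_(x in S) (h x * w x / 2 - ln (cosh (h x)) + (m x ^+ 2 - w x ^+ 2) ^+ 2 / 12)
    + 1 / 2 * \sum_(x in S) (m x ^+ 2 / w x * h x) <= \sum_(x in S) Ising_entropy (m x).
  rewrite mulr_sumr -big_split; apply: ler_sum => x xS /=.
  apply: le_trans (Ising_entropy_ge (h0 x) (m1 xS)).
  rewrite lerD2l le_eqVlt; apply/orP; left; apply/eqP; field.
  by rewrite lt0r_neq0.
have E2 : beta * \sum_(x in S) \sum_(y in S) K x y * (`|m x| * `|m y|) <= \sum_(x in S) (m x ^+ 2 / w x * h x).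
  apply: le_trans (ler_wpM2l beta0 pair_sum_le) _.
  rewrite mulr_sumr; apply: ler_sum => x xS; rewrite mulrCA ler_wpM2l ?super//.
  by rewrite mulr_ge0 ?sqr_ge0// invr_ge0 ltW.
have E3 := ler_wpM2l beta0 sign_gap.
have E4 : ising_free_energy (fun x => w x) =
   \sum_(x in S) (h x * w x / 2 - ln (cosh (h x))) + (\sum_(x in S) w x * (h x - beta * \sum_(y in S) K x y * w y)) / 2.
  rewrite /ising_free_energy; under eq_bigr do rewrite Ising_entropy_tanh.
  rewrite mulr_sumr mulr_suml -sumrB -big_split; apply: eq_bigr => x _ /=.
  have -> : \sum_(y in S) K x y * (w x * w y) = w x * \sum_(y in S) K x y * w y.
    by rewrite mulr_sumr; apply: eq_bigr => y _; rewrite mulrCA.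
  by field.
rewrite E4 /ising_free_energy.
have E5 : \sum_(x in S) (h x * w x / 2 - ln (cosh (h x)) + (m x ^+ 2 - w x ^+ 2) ^+ 2 / 12) =
  \sum_(x in S) (h x * w x / 2 - ln (cosh (h x))) + (\sum_(x in S) (m x ^+ 2 - w x ^+ 2) ^+ 2) / 12.
  by rewrite mulr_suml -big_split.
rewrite E5 in E1.
move: E1 E2 E3.
set s1 := \sum_(x in S) (h x * w x / 2 - _); set s2 := \sum_(x in S) (m x ^+ 2 - _) ^+ 2.
set s3 := \sum_(x in S) (m x ^+ 2 / w x * h x); set s4 := \sum_(x in S) Ising_entropy (m x).
set s5 := \sum_(x in S) \sum_(y in S) K x y * (`|m x| * `|m y|).
set s6 := \sum_(x in S) \sum_(y in S) K x y * (m x * m y).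
set s7 := \sum_(x in S) (`|m x| + m x) / 2; set s8 := \sum_(x in S) (`|m x| - m x) / 2.
set s9 := \sum_(x in S) w x * _.
move: s1 s2 s3 s4 s5 s6 s7 s8 s9 => s1 s2 s3 s4 s5 s6 s7 s8 s9 E1 E2 E3.
have -> : 2 * beta * c * s7 * s8 = 1 / 2 * (beta * (4 * c * s7 * s8)) by field.
have -> : beta / 2 * s6 = 1 / 2 * (beta * s6) by field.
rewrite mulrBr in E3; lra.
Qed.

End ising.

(** The correction does not depend on [p], so gaps of the two free energies coincide. *)
Lemma class_free_energy2 (a1 a2 : A) (p : V -> A -> R) : C = [set a1; a2] -> a1 != a2 ->
  class_profile p ->
  class_free_energy p = ising_free_energy (fun x => p x a1 - p x a2)
    - (#|S|%:R * ln 2 + beta / 2 * \sum_(x in S) \sum_(y in S) K x y).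
Proof.
move=> CE a12 pP; rewrite /class_free_energy /ising_free_energy.
have sum2 (f : A -> R) : \sum_(a in C) f a = f a1 + f a2.
  by rewrite CE big_setU1 ?big_set1// inE.
have pE x : x \in S -> p x a1 = (1 + (p x a1 - p x a2)) / 2 /\ p x a2 = (1 - (p x a1 - p x a2)) / 2.
  by move=> xS; have [_] := pP x xS; rewrite sum2 => h; lra.
have plnp (x : R) : 0 <= x -> x * ln x = x * ln (x * 2) - x * ln 2.
  rewrite le_eqVlt => /predU1P[<-|x0]; first by rewrite !mul0r subrr.
  by rewrite lnM ?posrE// mulrDr addrK.
have -> : \sum_(x in S) \sum_(a in C) p x a * ln (p x a) =
   \sum_(x in S) Ising_entropy (p x a1 - p x a2) - #|S|%:R * ln 2.
  rewrite mulr_natl -sumr_const -sumrB; apply: eq_bigr => x xS.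
  have [p0 p1] := pP x xS; rewrite sum2 in p1; have [e1 e2] := pE x xS.
  rewrite sum2 (plnp _ (p0 a1)) (plnp _ (p0 a2)) /Ising_entropy -e1 -e2.
  have -> : p x a1 * 2 = 1 + (p x a1 - p x a2) by lra.
  have -> : p x a2 * 2 = 1 - (p x a1 - p x a2) by lra.
  by rewrite -[X in _ = _ - X]mul1r -p1; ring.
have -> : \sum_(x in S) \sum_(y in S) K x y * \sum_(a in C) p x a * p y a =
   1 / 2 * \sum_(x in S) \sum_(y in S) K x y
   + 1 / 2 * \sum_(x in S) \sum_(y in S) K x y * ((p x a1 - p x a2) * (p y a1 - p y a2)).
  rewrite -mulrDr -big_split mulr_sumr; apply: eq_bigr => x xS /=.
  rewrite -big_split mulr_sumr; apply: eq_bigr => y yS /=.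
  rewrite sum2; have [e1 e2] := pE x xS; have [f1 f2] := pE y yS.
  have -> : p x a2 = 1 - p x a1 by lra.
  by have -> : p y a2 = 1 - p y a1; [lra|field].
by field.
Qed.

End class_free_energy.

(** * Concentration within a fuzzy class *)

Section class_average.
Context {R : realType} {d n : nat}.
Variables (n1 : (1 < n)%N) (S : {set lattice d n}).

Lemma card_class_le : (n ^ d)%:R^-1 * #|S|%:R <= 1 :> R.
Proof.
have n0 : 0 < (n ^ d)%:R :> R by rewrite ltr0n expn_gt0 (ltnW n1).
rewrite mulrC ler_pdivrMr// mul1r ler_nat.
rewrite (leq_trans (max_card _))// card_mx mul1n card_ord Zp_cast//.
Qed.

Lemma class_average_le (g : lattice d n -> R) (e : R) : 0 <= e ->
  (forall x, x \in S -> `|g x| <= e) -> `|(n ^ d)%:R^-1 * \sum_(x in S) g x| <= e.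
Proof.
move=> e0 ge; rewrite normrM ger0_norm ?invr_ge0//.
apply: (@le_trans _ _ ((n ^ d)%:R^-1 * (#|S|%:R * e))).
  rewrite ler_wpM2l ?invr_ge0//; apply: le_trans (ler_norm_sum _ _ _) _.
  by rewrite mulr_natl -sumr_const; apply: ler_sum.
by rewrite mulrA ler_piMl// card_class_le.
Qed.

End class_average.

Section class_limit.
Context {R : realType} {d : nat}.
Variables (J : torus R d -> R) (Jc : continuous J) (J0 : forall v, 0 < J v).
Variables (Js : forall v, J (- v) = J v) (beta : R) (beta0 : 0 <= beta).
Variable nu : {finite_measure set (torus R d) -> \bar R}.
Hypothesis nu_dom : nu `<< torus_lebesgue R d.
Variables (S : forall n, {set lattice d n}) (z : nat -> torus R d) (u : torus R d).
Hypothesis z_cvg : z n @[n --> \oo] --> u.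
Hypothesis S_cvg : forall f : torus R d -> R, continuous f ->
  (n ^ d)%:R^-1 * \sum_(x in S n) f (site R x) @[n --> \oo] --> \int[nu]_v f v.
Implicit Types (f : torus R d -> R) (e : R).

Definition scaled_kernel n (x y : lattice d n) : R := (n ^ d)%:R^-1 * J (site R x - site R y).

Definition discrete_potential n f v : R :=
  (n ^ d)%:R^-1 * \sum_(x in S n) J (v - site R x) * f (site R x).

Lemma discrete_potential_diff n f v v' e (M : R) : (1 < n)%N -> (forall w, `|f w| <= M) ->
  0 <= e -> (forall w, `|J (v - w) - J (v' - w)| <= e) ->
  `|discrete_potential n f v - discrete_potential n f v'| <= e * M.
Proof.
move=> n1 fM e0 Je; rewrite /discrete_potential -mulrBr -sumrB.
have M0 : 0 <= M by apply: le_trans (normr_ge0 (f 0)) (fM 0).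
apply: class_average_le => //; first exact: mulr_ge0.
by move=> x _; rewrite -mulrBl normrM ler_pM.
Qed.

(** Weak convergence gives the limit for one [v] at a time; the net of translates reduces all [v] to
    finitely many. *)
Lemma discrete_potential_cvg f e : continuous f -> 0 < e ->
  \forall n \near \oo, forall v, `|discrete_potential n f v - potential J nu f v| <= e.
Proof.
move=> fc e0; have bf := continuous_bounded_measurable fc; have [_ [M fM]] := bf.
have M0 : 0 <= M by apply: le_trans (normr_ge0 (f 0)) (fM 0).
have mass0 : 0 <= fine (nu setT) by rewrite fine_ge0.
pose D := M + M * fine (nu setT) + 1.
have D0 : 0 < D by rewrite ltr_pwDr// addr_ge0// mulr_ge0.
have e1 : 0 < e / 2 / D by rewrite !divr_gt0.
have [L [c cP]] := J_net Jc e1.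
have e2 : 0 < e / 2 by rewrite divr_gt0.
have net i : \forall n \near \oo, `|discrete_potential n f (c i) - potential J nu f (c i)| <= e / 2.
  have gc : continuous (fun v : torus R d => J (c i - v) * f v).
    by move=> v; apply: (@continuousM _ _ (fun v : torus R d => J (c i - v)) f); [exact: J_sub_continuous2|exact: fc].
  have h := S_cvg gc; near=> n; rewrite distrC.
  by near: n; apply: (@cvgr_dist_le _ _ _ _ _ _ _ h).
have {}net : \forall n \near \oo, forall i, `|discrete_potential n f (c i) - potential J nu f (c i)| <= e / 2.
  exact: filter_forall.
near=> n.
have n1 : (1 < n)%N by near: n; exact: nbhs_infty_gt.
have netn : forall i, `|discrete_potential n f (c i) - potential J nu f (c i)| <= e / 2 by near: n.
move=> v; have [i ci] := cP v.
have h1 := discrete_potential_diff n1 fM (ltW e1) ci.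
have h2 := potential_diff_le Jc nu bf fM ci.
have h3 := netn i.
have -> : discrete_potential n f v - potential J nu f v =
  (discrete_potential n f v - discrete_potential n f (c i)) + (discrete_potential n f (c i) - potential J nu f (c i))
   - (potential J nu f v - potential J nu f (c i)) by ring.
apply: le_trans (ler_normB _ _) _; apply: le_trans (lerD (ler_normD _ _) (lexx _)) _.
apply: le_trans (lerD (lerD h1 h3) h2) _.
have -> : e / 2 / D * M + e / 2 + e / 2 / D * M * fine (nu setT) = e / 2 + e / 2 * ((M + M * fine (nu setT)) / D).
  by field; rewrite lt0r_neq0.
rewrite [leRHS]splitr lerD2l ler_piMr ?(ltW e2)// ler_pdivrMr// mul1r /D.
by rewrite lerDl.
Unshelve. all: by end_near. Qed.

Lemma discrete_potential_site_cvg f e : continuous f -> 0 < e ->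
  \forall n \near \oo, `|discrete_potential n f (z n) - potential J nu f u| <= e.
Proof.
move=> fc e0; have e2 : 0 < e / 2 by rewrite divr_gt0.
have bf := continuous_bounded_measurable fc.
have pc : potential J nu f (z n) @[n --> \oo] --> potential J nu f u.
  by apply: (cvg_comp _ _ z_cvg); exact: (potential_continuous Jc bf).
have h := discrete_potential_cvg fc e2.
near=> n.
have h1 : forall v, `|discrete_potential n f v - potential J nu f v| <= e / 2 by near: n.
have h2 : `|potential J nu f u - potential J nu f (z n)| <= e / 2.
  by near: n; apply: (@cvgr_dist_le _ _ _ _ _ _ _ pc).
rewrite -(subrKA (potential J nu f (z n))) (le_trans (ler_normD _ _))// [leRHS]splitr lerD//.
by rewrite distrC.
Unshelve. all: by end_near. Qed.

Section classes.
Variables (q : nat) (C : {set 'I_q}).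

(** The contribution of the class to the law at the pinned site, with the local fields computed from
    the profile [p]. *)
Definition observable n (p : lattice d n -> 'I_q -> R) : R :=
  \sum_(a in C) expR (2 * beta * ((n ^ d)%:R^-1 * \sum_(x in S n) J (z n - site R x) * p x a)).

Local Notation Phi n p := (class_free_energy (S n) C (@scaled_kernel n) beta p).

(* The gap [dl] is independent of the precision [e] to which [ps] has to minimize
   the free energy; an exact minimizer at finite [n] is never needed. *)
Definition class_concentration (L : R) := forall e0 : R, 0 < e0 -> exists2 dl : R, 0 < dl &
  forall e, 0 < e -> \forall n \near \oo, exists2 ps, class_profile (S n) C ps &
    forall p, class_profile (S n) C p ->
      Phi n ps - e * (n ^ d)%:R <= Phi n p /\
      (e0 < `|observable p - L| -> Phi n ps + (dl - e) * (n ^ d)%:R <= Phi n p).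

Lemma scaled_kernel_ge0 n x y : 0 <= @scaled_kernel n x y.
Proof. by rewrite mulr_ge0 ?invr_ge0// ltW. Qed.

Lemma scaled_kernelC n x y : @scaled_kernel n x y = scaled_kernel y x.
Proof. by rewrite /scaled_kernel -Js opprB. Qed.

Lemma const1_continuous : continuous (fun _ : torus R d => 1 : R).
Proof. exact: cst_continuous. Qed.

Lemma limit_weightE (r : nat) : limit_weight J beta r u nu =
  r%:R * expR (2 * beta / r%:R * potential J nu (fun=> 1) u) * Dcomp J beta r u nu.
Proof.
rewrite /limit_weight.
have -> : \int[torus_lebesgue R d]_v (density nu v * J (u - v)) = potential J nu (fun=> 1) u.
  rewrite (Rint_density nu_dom); last exact: J_sub_bounded_measurable.
  by apply: eq_Rintegral => v _; rewrite mulr1.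
by [].
Qed.

Lemma abs_le_quadratic (t c : R) : 0 < c -> `|t| <= c + t ^+ 2 / c.
Proof.
move=> c0; have [h|h] := leP `|t| c; first by rewrite (le_trans h)// lerDl divr_ge0 ?sqr_ge0// ltW.
apply: (@le_trans _ _ (t ^+ 2 / c)); last by rewrite lerDr ltW.
by rewrite ler_pdivlMr// -[t ^+ 2]real_normK ?num_real// expr2 ler_wpM2l// ltW.
Qed.

(** * Classes whose size is not two *)

Section potts.
Variables (b : R) (bb : beta < b) (hb : pinsker b #|C|) (C0 : (0 < #|C|)%N) (C2 : #|C| != 2%N).
Hypothesis row_sum : forall e, 0 < e -> \forall n \near \oo, forall x, x \in S n ->
  \sum_(y in S n) @scaled_kernel n x y <= 1 + e.

(** The uniform profile serves as [ps] for every precision. A wrong local field forces a mean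
    squared deviation of at least [eta ^+ 2], which costs [c0 * eta ^+ 2] per site. *)
Lemma potts_class_concentration : class_concentration (limit_weight J beta #|C| u nu).
Proof.
move=> e0 e00.
have r0 : 0 < #|C|%:R :> R by rewrite ltr0n.
(* Half of the room between [beta] and [b] is kept as the gap; the other half pays for row sums
   slightly above [1]. *)
pose c0 := (b - beta) / 2.
have c00 : 0 < c0 by rewrite divr_gt0// subr_gt0.
have Js1 : 0 < J_sup J + 1 by rewrite ltr_pwDr// (J_sup_ge0 Jc J0).
pose t0 := potential J nu (fun=> 1) u / #|C|%:R.
have Fc : {for t0, continuous (fun t : R => expR (2 * beta * t))}.
  by apply: (@continuous_comp _ _ _ (fun t : R => 2 * beta * t) expR); [apply: (@continuousM _ _ (fun _ : R => 2 * beta) id); [exact: cst_continuous|exact: cvg_id]|exact: continuous_expR].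
have /nbhs_ballP[k /= k0 kP] : \forall t \near t0, `|expR (2 * beta * t0) - expR (2 * beta * t)| <= e0 / #|C|%:R.
  by apply: (@cvgr_dist_le _ _ _ _ _ _ _ Fc); rewrite divr_gt0.
(* Makes the deviation of the local field, at most [(J_sup J + 1) * (eta + eta)], equal to [k / 2];
   another [k / 4] is spent on the discrete potential. *)
pose eta := k / 4 / (J_sup J + 1).
have eta0 : 0 < eta by rewrite !divr_gt0.
exists (c0 * eta ^+ 2); first by rewrite mulr_gt0// exprn_gt0.
move=> e e0'.
have rho0 : 0 < c0 / (beta + 1) by rewrite divr_gt0// ltr_pwDr.
have k4 : 0 < k / 4 * #|C|%:R by rewrite mulr_gt0// divr_gt0.
have Hc := discrete_potential_site_cvg const1_continuous k4.
have Hr := row_sum rho0.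
near=> n.
have n1 : (1 < n)%N by near: n; exact: nbhs_infty_gt.
have N0 : 0 < (n ^ d)%:R :> R by rewrite ltr0n expn_gt0 (ltnW n1).
have hr : forall x, x \in S n -> \sum_(y in S n) @scaled_kernel n x y <= 1 + c0 / (beta + 1) by near: n.
have hc : `|discrete_potential n (fun=> 1) (z n) - potential J nu (fun=> 1) u| <= k / 4 * #|C|%:R by near: n.
exists (fun _ _ => #|C|%:R^-1); first exact: uniform_class_profile.
move=> p pP.
have gap := potts_free_energy_gap (@scaled_kernel_ge0 n) (@scaled_kernelC n) beta0 hr C0 hb pP.
set Q := \sum_(x in S n) _ in gap.
have Q0 : 0 <= Q by apply: sumr_ge0 => x _; apply: sumr_ge0 => a _; exact: sqr_ge0.
have {}gap : Phi n (fun _ _ => #|C|%:R^-1) + c0 * Q <= Phi n p.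
  apply: le_trans gap; rewrite lerD2l ler_wpM2r//.
  have : beta * (c0 / (beta + 1)) <= c0.
    rewrite mulrCA ler_piMr ?(ltW c00)// ler_pdivrMr ?ltr_pwDr// mul1r lerDl//.
  by move: bb; rewrite mulrDr mulr1 /c0 => ?; lra.
have eN : 0 <= e * (n ^ d)%:R by rewrite mulr_ge0// ltW.
split.
  by apply: le_trans gap; rewrite lerD2l (le_trans _ (mulr_ge0 (ltW c00) Q0))// oppr_le0.
move=> far; apply: le_trans gap; rewrite lerD2l.
suff QN : eta ^+ 2 * (n ^ d)%:R <= Q.
  rewrite mulrBl (le_trans (_ : _ <= c0 * eta ^+ 2 * (n ^ d)%:R)) ?gerBl//.
  by rewrite -mulrA ler_wpM2l// ltW.
rewrite leNgt; apply/negP => QN; move: far; rewrite ltNge => /negP; apply.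
rewrite limit_weightE /Dcomp /Dfun (negbTE C2) if_same mulr1.
have -> : #|C|%:R * expR (2 * beta / #|C|%:R * potential J nu (fun=> 1) u) =
    \sum_(a in C) expR (2 * beta * t0).
  by rewrite sumr_const -[RHS]mulr_natl; congr (_ * expR _); rewrite /t0 mulrA mulrAC.
rewrite /observable -sumrB; apply: le_trans (ler_norm_sum _ _ _) _.
have -> : e0 = \sum_(a in C) e0 / #|C|%:R.
  by rewrite sumr_const -[_ *+ _]mulr_natr divfK// lt0r_neq0.
apply: ler_sum => a aC; rewrite distrC; apply: kP; rewrite /ball/=.
set ha := (n ^ d)%:R^-1 * _.
have haE : ha - discrete_potential n (fun=> 1) (z n) / #|C|%:R =
   (n ^ d)%:R^-1 * \sum_(x in S n) J (z n - site R x) * (p x a - #|C|%:R^-1).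
  rewrite /ha /discrete_potential mulrAC -mulrA -mulrBr; congr (_ * _).
  rewrite mulr_sumr -sumrB; apply: eq_bigr => x _; ring.
have hd : `|ha - discrete_potential n (fun=> 1) (z n) / #|C|%:R| <= k / 2.
  rewrite haE normrM ger0_norm ?invr_ge0//.
  apply: (@le_trans _ _ ((n ^ d)%:R^-1 * \sum_(x in S n) (J_sup J + 1) * (eta + (p x a - #|C|%:R^-1) ^+ 2 / eta))).
    rewrite ler_wpM2l ?invr_ge0//; apply: le_trans (ler_norm_sum _ _ _) _.
    apply: ler_sum => x _; rewrite normrM ler_pM//; last exact: abs_le_quadratic.
    by apply: le_trans (J_norm_le Jc J0 _) _; rewrite lerDl.
  have -> : (n ^ d)%:R^-1 * \sum_(x in S n) (J_sup J + 1) * (eta + (p x a - #|C|%:R^-1) ^+ 2 / eta) =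
      (J_sup J + 1) * ((n ^ d)%:R^-1 * #|S n|%:R * eta +
        (n ^ d)%:R^-1 * ((\sum_(x in S n) (p x a - #|C|%:R^-1) ^+ 2) / eta)).
    by rewrite -mulr_sumr big_split/= sumr_const -[eta *+ _]mulr_natl mulr_suml mulrCA mulrDr mulrA.
  have h1 : (n ^ d)%:R^-1 * #|S n|%:R * eta <= eta by rewrite ler_piMl ?(ltW eta0)// card_class_le.
  have h2 : (n ^ d)%:R^-1 * ((\sum_(x in S n) (p x a - #|C|%:R^-1) ^+ 2) / eta) <= eta.
    rewrite mulrA ler_pdivrMr// -expr2 mulrC ler_pdivrMr//.
    apply: le_trans (ltW QN); apply: ler_sum => x _.
    by rewrite (bigD1 a)//= lerDl sumr_ge0// => a' _; exact: sqr_ge0.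
  apply: (@le_trans _ _ ((J_sup J + 1) * (eta + eta))).
    by rewrite ler_wpM2l ?(ltW Js1)// lerD.
  by rewrite /eta le_eqVlt; apply/orP; left; apply/eqP; field; rewrite lt0r_neq0.
have hd2 : `|discrete_potential n (fun=> 1) (z n) / #|C|%:R - t0| <= k / 4.
  by rewrite /t0 -mulrBl normrM [X in _ * X]ger0_norm ?invr_ge0// ler_pdivrMr.
have -> : t0 - ha = - ((ha - discrete_potential n (fun=> 1) (z n) / #|C|%:R) + (discrete_potential n (fun=> 1) (z n) / #|C|%:R - t0)) by ring.
rewrite normrN; apply: le_lt_trans (ler_normD _ _) _; apply: le_lt_trans (lerD hd hd2) _.
lra.
Unshelve. all: by end_near. Qed.

End potts.

(** * Classes of size two *)

Section ising.

Definition class_average n (g : lattice d n -> R) : R := (n ^ d)%:R^-1 * \sum_(x in S n) g x.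

Local Notation avg := class_average.

Lemma avgD n (f g : lattice d n -> R) : avg (fun x => f x + g x) = avg f + avg g.
Proof. by rewrite /class_average big_split mulrDr. Qed.

Lemma avgZ n (c : R) (g : lattice d n -> R) : avg (fun x => c * g x) = c * avg g.
Proof. by rewrite /class_average -mulr_sumr mulrCA. Qed.

Lemma ler_avg n (f g : lattice d n -> R) : (forall x, x \in S n -> f x <= g x) -> avg f <= avg g.
Proof. by move=> fg; rewrite ler_wpM2l ?invr_ge0//; exact: ler_sum. Qed.

Lemma avg_ge0 n (f : lattice d n -> R) : (forall x, 0 <= f x) -> 0 <= avg f.
Proof. by move=> f0; rewrite mulr_ge0 ?invr_ge0// sumr_ge0. Qed.

Lemma avg_cst_le n (c : R) : (1 < n)%N -> 0 <= c -> avg (fun _ : lattice d n => c) <= c.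
Proof.
by move=> n1 c0; rewrite /class_average sumr_const -[c *+ _]mulr_natl mulrA ler_piMl// card_class_le.
Qed.

(** Two errors: replacing the modulus of [m] by [w], controlled through the squares, and replacing
    the average of the modulus by the modulus of the average, controlled by twice the mass of the
    minority sign. *)
Lemma abs_average_diff n (m w : lattice d n -> R) (v : torus R d) (eta : R) : (1 < n)%N ->
  0 < eta -> (forall x, 0 <= w x) ->
  `| `|avg (fun x => J (v - site R x) * m x)| - avg (fun x => J (v - site R x) * w x)|
  <= J_sup J * (eta + avg (fun x => (m x ^+ 2 - w x ^+ 2) ^+ 2) / eta ^+ 3)
   + 2 * J_sup J * Num.min (avg (fun x => (`|m x| + m x) / 2)) (avg (fun x => (`|m x| - m x) / 2)).
Proof.
move=> n1 eta0 w0.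
pose j (x : lattice d n) := J (v - site R x).
have jle x : 0 <= j x <= J_sup J by rewrite /j (J_le_sup Jc) andbT ltW.
have Js0 := J_sup_ge0 Jc J0.
have H1 : `|avg (fun x => j x * `|m x|) - avg (fun x => j x * w x)| <=
   J_sup J * (eta + avg (fun x => (m x ^+ 2 - w x ^+ 2) ^+ 2) / eta ^+ 3).
  have -> : avg (fun x => j x * `|m x|) - avg (fun x => j x * w x) = avg (fun x => j x * (`|m x| - w x)).
    by rewrite -mulrBr -sumrB /class_average; congr (_ * _); apply: eq_bigr => x _; rewrite mulrBr.
  apply: (@le_trans _ _ (avg (fun x => J_sup J * (eta + (eta ^+ 3)^-1 * (m x ^+ 2 - w x ^+ 2) ^+ 2)))).
    rewrite /class_average normrM ger0_norm ?invr_ge0// ler_wpM2l ?invr_ge0//.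
    apply: le_trans (ler_norm_sum _ _ _) _; apply: ler_sum => x _.
    have /andP[j0 j1] := jle x.
    rewrite normrM ger0_norm// ler_pM// [_^-1 * _]mulrC -[m x ^+ 2]real_normK ?num_real//.
    exact: sqr_diff_bound.
  rewrite avgZ avgD avgZ [_^-1 * _]mulrC ler_wpM2l// lerD2r; apply: avg_cst_le => //; exact: ltW.
have pos (g : lattice d n -> R) : (forall x, 0 <= g x) -> 0 <= avg (fun x => j x * g x) <= J_sup J * avg g.
  move=> g0; apply/andP; split; first by apply: avg_ge0 => x; rewrite mulr_ge0//; case/andP: (jle x).
  by rewrite -avgZ; apply: ler_avg => x _; rewrite ler_wpM2r//; case/andP: (jle x).
have /andP[P1 P2] := pos _ (fun x => positive_part_ge0 (m x)).
have /andP[M1 M2] := pos _ (fun x => negative_part_ge0 (m x)).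
have E1 : avg (fun x => j x * m x) = avg (fun x => j x * `|m x|) - 2 * avg (fun x => j x * ((`|m x| - m x) / 2)).
  by rewrite -avgZ /class_average -mulrBr -sumrB; congr (_ * _); apply: eq_bigr => x _; field.
have E2 : avg (fun x => j x * m x) = - avg (fun x => j x * `|m x|) + 2 * avg (fun x => j x * ((`|m x| + m x) / 2)).
  by rewrite addrC -avgZ /class_average -mulrBr -sumrB; congr (_ * _); apply: eq_bigr => x _; field.
have H2 : `| `|avg (fun x => j x * m x)| - avg (fun x => j x * `|m x|)| <=
   2 * J_sup J * Num.min (avg (fun x => (`|m x| + m x) / 2)) (avg (fun x => (`|m x| - m x) / 2)).
  have h1 := ler_norm (avg (fun x => j x * m x)).
  have h2 := ler_norm (- avg (fun x => j x * m x)); rewrite normrN in h2.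
  have h3 : `|avg (fun x => j x * m x)| <= avg (fun x => j x * `|m x|).
    by rewrite ler_norml; apply/andP; split; lra.
  rewrite ler0_norm ?subr_le0// opprB -mulrA minEle.
  case: ifP => _; lra.
rewrite -(subrKA (avg (fun x => j x * `|m x|))) (le_trans (ler_normD _ _))// addrC.
exact: lerD.
Qed.

Variables (a1 a2 : 'I_q) (CE : C = [set a1; a2]%SET) (a12 : a1 != a2).

Let sum2 (f : 'I_q -> R) : \sum_(a in C) f a = f a1 + f a2.
Proof. by rewrite CE big_setU1 ?big_set1// inE. Qed.

(** The iterates become solutions in the limit, so an iterate far enough along is nearly optimal as
    a comparison profile. *)
Lemma field_defect_cvg :
  \int[nu]_v (tanh (field J beta nu k v) *
     (field J beta nu k v - beta * potential J nu (fun v => tanh (field J beta nu k v)) v))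
  @[k --> \oo] --> (0 : R).
Proof.
have -> : (0 : R) = \int[nu]_v (tanh (field_lim J beta nu v) *
   (field_lim J beta nu v - beta * potential J nu (max_magnetization J beta nu) v)).
  rewrite (_ : (fun v => _) = fun=> 0); first by rewrite Rint_cst mul0r.
  by apply/funext => v; rewrite -(field_lim_eq Jc J0 beta0) subrr mulr0.
apply: (Rint_dominated nu (M := field0 J beta nu) _ _ _).2.
  move=> k; apply: (bounded_measurableM _ _).1.
    exact/continuous_bounded_measurable/tanh_field_continuous.
  apply: bounded_measurableB.
    exact/continuous_bounded_measurable/field_continuous.
  apply: bounded_measurableM; first exact: bounded_measurable_cst.
  apply/continuous_bounded_measurable/potential_continuous => //.
  exact/continuous_bounded_measurable/tanh_field_continuous.
  move=> k v; rewrite normrM -[leRHS]mul1r ler_pM//; first exact: tanh_norm_le1.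
  have A0 : 0 <= beta * potential J nu (fun v => tanh (field J beta nu k v)) v.
    by rewrite mulr_ge0// potential_ge0// => w; rewrite tanh_ge0// ltW// field_gt0.
  have h1 := field_supersolution Jc J0 beta0 nu k v.
  have h2 := field_le0 Jc J0 beta0 nu k v.
  have h3 : 0 <= k.+1%:R^-1 :> R by rewrite invr_ge0.
  rewrite ger0_norm; first by rewrite lerBlDr (le_trans h2)// lerDl.
  by rewrite subr_ge0 (le_trans _ h1)// lerDl.
move=> v; apply: cvgM; first exact: tanh_field_cvg.
apply: cvgB; first exact: field_cvg.
by apply: cvgM; [exact: cvg_cst|exact: potential_field_cvg].
Qed.

(** The comparison profile has as mean the [tanh] of an iterate: continuous, positive, and a
    supersolution even for the discrete potential once [n] is large. *)
Lemma ising_class_concentration : class_concentration (limit_weight J beta 2 u nu).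
Proof.
move=> e0 e00.
have Js0 := J_sup_ge0 Jc J0.
pose Js1 := J_sup J + 1; have Js10 : 0 < Js1 by rewrite ltr_pwDr.
(* [b1] and [Js1] replace [beta] and [J_sup J] in denominators, as these may vanish. *)
pose b1 := beta + 1; have b10 : 0 < b1 by rewrite ltr_pwDr.
have bJ (r : R) : 0 <= r -> beta * (J_sup J * r) <= b1 * (Js1 * r).
  by move=> r0; rewrite mulrA [leRHS]mulrA ler_wpM2r// ler_pM// lerDl.
pose t0 := beta * potential J nu (fun=> 1) u; pose s0 := field_lim J beta nu u.
have expP (y : R) : exists2 k : R, 0 < k & forall y' : R, `|y - y'| < k -> `|expR y - expR y'| <= e0 / 2.
  have /nbhs_ballP[k /= k0 kP] : \forall t \near y, `|expR y - expR t| <= e0 / 2.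
    by apply: (@cvgr_dist_le _ _ _ _ _ _ _ (@continuous_expR R y)); rewrite divr_gt0.
  by exists k => // y'; exact: kP.
have [k1 k10 k1P] := expP (t0 + s0); have [k2 k20 k2P] := expP (t0 - s0).
pose k : R := Num.min k1 k2.
have k0 : 0 < k by rewrite lt_min k10.
have [c c0 cJ] := J_lower Jc J0.
(* The tolerance [k] is spent in eighths. [eta] bounds the error of the modulus, [tau] the mass of
   the minority sign, and [dl] is the smaller of the costs of violating either bound. *)
pose eta : R := k / 8 / (b1 * Js1).
have eta0 : 0 < eta by rewrite !divr_gt0// mulr_gt0.
pose tau : R := k / 16 / Js1; have tau0 : 0 < tau by rewrite !divr_gt0.
pose dl : R := Num.min (k / 8 / (b1 * Js1) * eta ^+ 3 / 12) (tau ^+ 2 * (2 * c) / b1).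
have dl0 : 0 < dl by rewrite lt_min !(divr_gt0, mulr_gt0, exprn_gt0).
exists dl => // e e0'.
pose w kk v := tanh (field J beta nu kk v).
(* The iterate depends on the precision [e] but is fixed before [n], while [dl] was fixed before
   both. *)
have [kk [kk1 kk2]] : exists kk,
   \int[nu]_v (w kk v * (field J beta nu kk v - beta * potential J nu (w kk) v)) <= e / 2 /\
   `|beta * potential J nu (w kk) u - s0| <= k / 8.
  have h1 := field_defect_cvg.
  have h2 : beta * potential J nu (w kk) u @[kk --> \oo] --> s0.
    rewrite /s0 (field_lim_eq Jc J0 beta0); apply: cvgM; [exact: cvg_cst|exact: potential_field_cvg].
  near \oo => kk; exists kk; split.
    have h : `|0 - \int[nu]_v (w kk v * (field J beta nu kk v - beta * potential J nu (w kk) v))| <= e / 2.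
      by near: kk; apply: (@cvgr_dist_le _ _ _ _ _ _ _ h1); rewrite divr_gt0.
    by rewrite (le_trans _ h)// sub0r normrN ler_norm.
  by near: kk; apply: (@cvgr_distC_le _ _ _ _ _ _ _ h2); rewrite divr_gt0.
have wc : continuous (w kk) by exact: tanh_field_continuous.
have Awc : continuous (potential J nu (w kk)).
  by apply: potential_continuous => //; exact: continuous_bounded_measurable.
(* The precision of the discrete potential has three uses: staying within the slack of the
   supersolution, within the allowed defect, and within [k / 8] for the field at [u]. *)
pose e1 : R := Num.min (Num.min kk.+1%:R^-1 (e / 2)) (k / 8) / b1.
have e10 : 0 < e1 by rewrite divr_gt0// !lt_min invr_gt0 ltr0n/= !divr_gt0.
have be1 (r : R) : 0 <= r -> r <= e1 -> [/\ beta * r <= kk.+1%:R^-1, beta * r <= e / 2 & beta * r <= k / 8].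
  move=> r0 re; have h : b1 * r <= Num.min (Num.min kk.+1%:R^-1 (e / 2)) (k / 8).
    by rewrite mulrC -ler_pdivlMr.
  have h' : beta * r <= b1 * r by rewrite ler_wpM2r// lerDl.
  by move: h; rewrite !le_min => /andP[/andP[? ?] ?]; split; apply: le_trans h' _.
have H1 := discrete_potential_cvg wc e10.
have H2 := discrete_potential_site_cvg wc e10.
have H3 := discrete_potential_site_cvg const1_continuous e10.
have gc : continuous (fun v : torus R d => w kk v * (field J beta nu kk v - beta * potential J nu (w kk) v)).
  move=> v; apply: (@continuousM _ _ (w kk) (fun v => field J beta nu kk v - beta * potential J nu (w kk) v)); first exact: wc.
  apply: (@continuousB _ _ _ (field J beta nu kk) (fun v => beta * potential J nu (w kk) v)); first exact: field_continuous.
  by apply: (@continuousM _ _ (fun=> beta) (potential J nu (w kk))); [exact: cst_continuous|exact: Awc].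
have H4 := S_cvg gc.
near=> n.
have n1 : (1 < n)%N by near: n; exact: nbhs_infty_gt.
have N0 : 0 < (n ^ d)%:R :> R by rewrite ltr0n expn_gt0 (ltnW n1).
have h1 : forall v, `|discrete_potential n (w kk) v - potential J nu (w kk) v| <= e1 by near: n.
have h2 : `|discrete_potential n (w kk) (z n) - potential J nu (w kk) u| <= e1 by near: n.
have h3 : `|discrete_potential n (fun=> 1) (z n) - potential J nu (fun=> 1) u| <= e1 by near: n.
have h4 : `|avg (fun x : lattice d n => w kk (site R x) * (field J beta nu kk (site R x) - beta * potential J nu (w kk) (site R x))) -
   \int[nu]_v (w kk v * (field J beta nu kk v - beta * potential J nu (w kk) v))| <= e / 2.
  by near: n; apply: (@cvgr_distC_le _ _ _ _ _ _ _ H4); rewrite divr_gt0.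
pose wn (x : lattice d n) := w kk (site R x).
have wn01 x : 0 <= wn x <= 1.
  rewrite /wn /w tanh_ge0/=; last by rewrite ltW// field_gt0.
  exact: le_trans (ler_norm _) (tanh_norm_le1 _).
(* Mean [wn], the phase that favours [a1]; the opposite phase has the same free energy. *)
pose ps (x : lattice d n) (a : 'I_q) := if a == a1 then (1 + wn x) / 2 else (1 - wn x) / 2.
have psP : class_profile (S n) C ps.
  move=> x _; have /andP[? ?] := wn01 x; split => [a|].
    by rewrite /ps; case: ifP => _; rewrite divr_ge0// ?subr_ge0// addr_ge0.
  by rewrite sum2 /ps eqxx eq_sym (negbTE a12); field.
exists ps => // p pP.
pose m x := p x a1 - p x a2.
have mP x : x \in S n -> -1 <= m x <= 1.
  by move=> /pP[p0]; rewrite sum2; exact: two_point_bound.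
have KW x : \sum_(y in S n) @scaled_kernel n x y * wn y = discrete_potential n (w kk) (site R x).
  by rewrite /discrete_potential mulr_sumr; apply: eq_bigr => y _; rewrite /scaled_kernel -mulrA.
have sup x : x \in S n -> beta * \sum_(y in S n) @scaled_kernel n x y * wn y <= field J beta nu kk (site R x).
  move=> _; rewrite KW; have [g1 _ _] := be1 _ (normr_ge0 _) (h1 (site R x)).
  have g2 := field_supersolution Jc J0 beta0 nu kk (site R x).
  have g3 := ler_wpM2l beta0 (ler_norm (discrete_potential n (w kk) (site R x) - potential J nu (w kk) (site R x))).
  by apply: le_trans g2; rewrite -lerBlDl -mulrBr; exact: le_trans g3 g1.
have cK x y : x \in S n -> y \in S n -> (n ^ d)%:R^-1 * c <= @scaled_kernel n x y.
  by move=> _ _; rewrite ler_wpM2l ?invr_ge0.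
have gap := ising_free_energy_gap (@scaled_kernel_ge0 n) (@scaled_kernelC n) beta0 mP
   (fun x => field_gt0 Jc J0 beta0 nu kk (site R x)) sup cK.
have psE : Phi n p - Phi n ps = ising_free_energy (S n) (@scaled_kernel n) beta m -
    ising_free_energy (S n) (@scaled_kernel n) beta wn.
  rewrite (class_free_energy2 _ _ CE a12 pP) (class_free_energy2 _ _ CE a12 psP).
  rewrite (_ : (fun x => ps x a1 - ps x a2) = wn); first by rewrite -/m; ring.
  by apply/funext => x; rewrite /ps eqxx eq_sym (negbTE a12); field.
pose qq := avg (fun x => (m x ^+ 2 - wn x ^+ 2) ^+ 2).
pose P := avg (fun x => (`|m x| + m x) / 2); pose M := avg (fun x => (`|m x| - m x) / 2).
pose E := avg (fun x => wn x * (field J beta nu kk (site R x) - beta * \sum_(y in S n) @scaled_kernel n x y * wn y)).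
have q0 : 0 <= qq by apply: avg_ge0 => x; exact: sqr_ge0.
have P0 : 0 <= P by apply: avg_ge0 => x; exact: positive_part_ge0.
have M0 : 0 <= M by apply: avg_ge0 => x; exact: negative_part_ge0.
have {}gap : Phi n ps + (qq / 12 + 2 * beta * c * P * M - E / 2) * (n ^ d)%:R <= Phi n p.
  rewrite -lerBrDl psE lerBrDl; apply: le_trans gap.
  rewrite -/wn le_eqVlt; apply/orP; left; apply/eqP.
  rewrite /qq /P /M /E /class_average; field; exact: lt0r_neq0.
have El : E / 2 <= e.
  have : E <= avg (fun x : lattice d n => w kk (site R x) * (field J beta nu kk (site R x) - beta * potential J nu (w kk) (site R x)) + e / 2).
    apply: ler_avg => x _; rewrite KW; have [_ g1 _] := be1 _ (normr_ge0 _) (h1 (site R x)).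
    have g3 : beta * potential J nu (w kk) (site R x) - beta * discrete_potential n (w kk) (site R x) <= e / 2.
      by apply: le_trans g1; rewrite -mulrBr ler_wpM2l// distrC ler_norm.
    have /andP[w0 w1] := wn01 x.
    have -> : wn x * (field J beta nu kk (site R x) - beta * discrete_potential n (w kk) (site R x)) =
      wn x * (field J beta nu kk (site R x) - beta * potential J nu (w kk) (site R x)) +
      wn x * (beta * potential J nu (w kk) (site R x) - beta * discrete_potential n (w kk) (site R x)) by ring.
    rewrite lerD2l; apply: le_trans (ler_wpM2l w0 g3) _; rewrite ler_piMl// divr_ge0// ltW//.
  rewrite avgD => h; have e20 : 0 <= e / 2 by rewrite divr_ge0// ltW.
  rewrite ler_pdivrMr// mulr_natr mulr2n; apply: le_trans h _; apply: lerD.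
    rewrite -(subrK (\int[nu]_v (w kk v * (field J beta nu kk v - beta * potential J nu (w kk) v))) (avg _)).
    by rewrite [leRHS]splitr lerD// (le_trans (ler_norm _)).
  by apply: (le_trans (avg_cst_le n1 e20)); rewrite ler_piMr ?(ltW e0')// invf_le1// ler1n.
have PM0 : 0 <= 2 * beta * c * P * M by rewrite mulr_ge0// mulr_ge0// mulr_ge0 ?(ltW c0)// mulr_ge0.
have q12 : 0 <= qq / 12 by rewrite divr_ge0.
split.
  by apply: le_trans gap; rewrite lerD2l -mulNr ler_wpM2r ?(ltW N0)// -sub0r lerB// addr_ge0.
move=> far; apply: le_trans gap; rewrite lerD2l ler_wpM2r ?(ltW N0)//.
suff h : dl <= qq / 12 + 2 * beta * c * P * M by exact: lerB.
rewrite leNgt; apply/negP => small; move: far; rewrite ltNge => /negP; apply.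
have Mz := @abs_average_diff n m wn (z n) eta n1 eta0 (fun x => (andP (wn01 x)).1).
rewrite -/qq -/P -/M in Mz.
set Z := avg (fun x => J (z n - site R x) * m x) in Mz.
have WE : avg (fun x => J (z n - site R x) * wn x) = discrete_potential n (w kk) (z n) by [].
rewrite WE in Mz; clearbody qq P M E.
have small1 : qq / 12 < k / 8 / (b1 * Js1) * eta ^+ 3 / 12.
  by move: small; rewrite lt_min => /andP[h _]; apply: le_lt_trans h; rewrite lerDl.
have small2 : 2 * beta * c * P * M < tau ^+ 2 * (2 * c) / b1.
  by move: small; rewrite lt_min => /andP[_ h]; apply: le_lt_trans h; rewrite lerDr.
have q1 : b1 * (Js1 * (qq / eta ^+ 3)) <= k / 8.
  have : qq <= k / 8 / (b1 * Js1) * eta ^+ 3 by move: small1; rewrite ltr_pM2r ?invr_gt0// => /ltW.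
  rewrite -ler_pdivrMr ?exprn_gt0// ler_pdivlMr ?mulr_gt0// => h; apply: le_trans h.
  by rewrite le_eqVlt; apply/orP; left; apply/eqP; ring.
(* The cost bounds only the product of the two masses; the square of the smaller one is at most that
   product. *)
have t1 : beta * Num.min P M <= tau.
  have mn0 : 0 <= Num.min P M by rewrite le_min P0.
  have : (beta * Num.min P M) ^+ 2 <= tau ^+ 2.
    have mm : Num.min P M ^+ 2 <= P * M by rewrite expr2 ler_pM// ge_min lexx ?orbT.
    have : beta * (P * M) * b1 <= tau ^+ 2.
      rewrite -ler_pdivlMr// -(ler_pM2r (mulr_gt0 (ltr0n R 2) c0)); move: small2 => /ltW.
      have -> : 2 * beta * c * P * M = beta * (P * M) * (2 * c) by ring.
      by move=> h; apply: le_trans h _; rewrite mulrAC.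
    apply: le_trans; rewrite exprMn.
    apply: (@le_trans _ _ (beta ^+ 2 * (P * M))); first by rewrite ler_wpM2l// sqr_ge0.
    have -> : beta * (P * M) * b1 = beta ^+ 2 * (P * M) + beta * (P * M) by rewrite /b1; ring.
    by rewrite lerDl mulr_ge0// mulr_ge0.
  have bm0 : 0 <= beta * Num.min P M by exact: mulr_ge0.
  by rewrite ler_sqr ?nnegrE// ltW.
have Zs : `| beta * `|Z| - s0| <= k / 8 * 5.
  have g1 : `|beta * `|Z| - beta * discrete_potential n (w kk) (z n)| <= k / 8 * 3.
    rewrite -mulrBr normrM (ger0_norm beta0); apply: le_trans (ler_wpM2l beta0 Mz) _.
    rewrite mulrDr mulrDr mulrDr.
    have a1' : beta * (J_sup J * eta) <= k / 8.
      have -> : k / 8 = b1 * (Js1 * eta) by rewrite /eta; field; rewrite !lt0r_neq0.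
      exact/bJ/ltW.
    have a2' : beta * (J_sup J * (qq / eta ^+ 3)) <= k / 8.
      apply: le_trans q1; have qe : 0 <= qq / eta ^+ 3 by rewrite divr_ge0// exprn_ge0// ltW.
      exact: bJ.
    have a3' : beta * (2 * J_sup J * Num.min P M) <= k / 8.
      have -> : k / 8 = 2 * Js1 * tau by rewrite /tau; field; rewrite lt0r_neq0.
      rewrite mulrCA ler_pM ?mulr_ge0// ?le_min ?P0// ler_wpM2l// lerDl//.
    have -> : k / 8 * 3 = k / 8 + k / 8 + k / 8 by ring.
    exact: lerD (lerD a1' a2') a3'.
  have g2 : `|beta * discrete_potential n (w kk) (z n) - beta * potential J nu (w kk) u| <= k / 8.
    by have [_ _] := be1 _ (normr_ge0 _) h2; rewrite -mulrBr normrM (ger0_norm beta0).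
  have -> : beta * `|Z| - s0 = (beta * `|Z| - beta * discrete_potential n (w kk) (z n)) +
     (beta * discrete_potential n (w kk) (z n) - beta * potential J nu (w kk) u) + (beta * potential J nu (w kk) u - s0) by ring.
  apply: le_trans (ler_normD _ _) _; apply: le_trans (lerD (ler_normD _ _) (lexx _)) _.
  have -> : k / 8 * 5 = k / 8 * 3 + k / 8 + k / 8 by ring.
  exact: lerD (lerD g1 g2) kk2.
pose U := beta * discrete_potential n (fun=> 1) (z n).
have Us : `|U - t0| <= k / 8.
  by have [_ _] := be1 _ (normr_ge0 _) h3; rewrite /U /t0 -mulrBr normrM (ger0_norm beta0).
(* The two colours see fields [Z] and [-Z], so the observable is even in [Z] and the phase does not
   matter. This sum of two exponentials becomes the factor [cosh]. *)
have obsE : observable p = expR (U + beta * `|Z|) + expR (U - beta * `|Z|).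
  have E1 a (sg : R) : (forall x, x \in S n -> p x a = (1 + sg * m x) / 2) ->
     2 * beta * ((n ^ d)%:R^-1 * \sum_(x in S n) J (z n - site R x) * p x a) = U + sg * (beta * Z).
    move=> pE; rewrite /U /Z /discrete_potential /class_average.
    have -> : \sum_(x in S n) J (z n - site R x) * p x a =
      1 / 2 * \sum_(x in S n) J (z n - site R x) * 1 + sg / 2 * \sum_(x in S n) J (z n - site R x) * m x.
      by rewrite !mulr_sumr -big_split; apply: eq_bigr => x xS /=; rewrite pE//; field.
    by field; rewrite lt0r_neq0.
  have -> : observable p = expR (U + 1 * (beta * Z)) + expR (U + (-1) * (beta * Z)).
    rewrite /observable sum2 (E1 a1 1) ?(E1 a2 (-1))//.
      by move=> x xS; have [_] := pP x xS; rewrite sum2 => /two_point_law[].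
    by move=> x xS; have [_] := pP x xS; rewrite sum2 => /two_point_law[].
  rewrite mul1r mulN1r; case: (ger0P Z) => _; first by [].
  by rewrite mulrN opprK addrC.
rewrite obsE limit_weightE (Dcomp2E Jc J0 Js beta0 nu_dom) -/s0.
have -> : 2%:R * expR (2 * beta / 2%:R * potential J nu (fun=> 1) u) * cosh s0 = expR (t0 + s0) + expR (t0 - s0).
  rewrite /cosh !expRD (_ : 2 * beta / 2%:R * _ = t0); first by field.
  by rewrite /t0; field.
have -> : expR (U + beta * `|Z|) + expR (U - beta * `|Z|) - (expR (t0 + s0) + expR (t0 - s0)) =
  - ((expR (t0 + s0) - expR (U + beta * `|Z|)) + (expR (t0 - s0) - expR (U - beta * `|Z|))) by ring.
rewrite normrN; apply: le_trans (ler_normD _ _) _; rewrite [leRHS]splitr lerD//.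
  apply: k1P; apply: (@lt_le_trans _ _ k); last by rewrite /k ge_min lexx.
  have -> : t0 + s0 - (U + beta * `|Z|) = - ((U - t0) + (beta * `|Z| - s0)) by ring.
  by rewrite normrN (le_lt_trans (ler_normD _ _))// (le_lt_trans (lerD Us Zs))// six_eighths_lt.
apply: k2P; apply: (@lt_le_trans _ _ k); last by rewrite /k ge_min lexx orbT.
have -> : t0 - s0 - (U - beta * `|Z|) = (beta * `|Z| - s0) - (U - t0) by ring.
by rewrite (le_lt_trans (ler_normB _ _))// (le_lt_trans (lerD Zs Us))// addrC six_eighths_lt.
Unshelve. all: by end_near. Qed.

End ising.
End classes.
End class_limit.

(** * Empirical measures *)

Section torus_points.
Context {R : realType} {d : nat}.

Lemma open_nonint : open [set t : R | t \isn't a Num.int].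
Proof.
have -> : [set t : R | t \isn't a Num.int] = \bigcup_(m in [set: int]) `]m%:~R, (m + 1)%:~R[%classic.
  apply/seteqP; split => [t /= tZ|t [m _ /=]].
    exists (Num.floor t) => //=; rewrite in_itv/= floorD1_gt andbT lt_neqAle ge_floor andbT.
    by apply: contraNneq tZ => <-; exact: intr_int.
  rewrite in_itv/= => /andP[mt tm]; apply/negP => /intrP[k tk]; move: mt tm.
  by rewrite tk !ltr_int ltzD1 leNgt => ->.
by apply: bigcup_open => m _; exact: interval_open.
Qed.

(** Points are closed: away from [x], some coordinate of the difference is not an integer, an open
    condition. Atoms are how spins are read off an empirical measure. *)
Lemma measurable_torus1 (u : torus R d) : measurable [set u].
Proof.
apply: closed_measurable_torus; have [x <-] := to_torus_surj u.
rewrite -openC.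
suff h : open (@to_torus R d @^-1` (~` [set to_torus x])) by exact: h.
have -> : @to_torus R d @^-1` (~` [set to_torus x]) =
   \bigcup_(i in [set: 'I_d]) (fun y : 'rV[R]_d => y 0 i - x 0 i) @^-1` [set t : R | t \isn't a Num.int].
  apply/seteqP; split => [y /= yx|y [i _ /= yx]].
    apply: contrapT => no; apply: yx; apply/to_torus_eq/mxOverP => i j.
    apply: contrapT => h; apply: no; exists j => //=.
    by apply/negP => h'; apply: h; rewrite ord1 !mxE.
  by move=> /to_torus_eq/mxOverP/(_ 0 i); rewrite !mxE => h; rewrite h in yx.
apply: bigcup_open => i _; apply: open_comp; last exact: open_nonint.
move=> y _; apply: (@continuousB _ _ _ (fun y : 'rV[R]_d => y 0 i) (fun=> x 0 i)); last exact: cst_continuous.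
exact: coord_continuous.
Qed.

Variables (n : nat) (n1 : (1 < n)%N).

Let n0 : n%:R != 0 :> R.
Proof. by rewrite pnatr_eq0 -lt0n ltnW. Qed.

(** Reduction modulo [n] changes the numerator by a multiple of [n], hence the quotient by an
    integer. *)
Lemma siteB (x y : lattice d n) : site R (x - y) = site R x - site R y.
Proof.
rewrite /site -to_torusB; apply/to_torus_eq/mxOverP => i j; rewrite (ord1 i) !mxE.
set a := x 0 j; set b := y 0 j.
have bn : (b < n)%N by have := ltn_ord b; rewrite [X in (_ < X)%N -> _]Zp_cast.
have -> : (a - b)%R = ((a + (n - b)) %% n)%N :> nat.
  by rewrite /= modnDmr; move: (nat_of_ord a) (nat_of_ord b) => a' b'; rewrite Zp_cast.
have E : ((a + (n - b)) %/ n * n)%N%:R + ((a + (n - b)) %% n)%N%:R = a%:R + (n%:R - b%:R) :> R.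
  by rewrite -natrD -divn_eq natrD natrB// ltnW.
have -> : ((a + (n - b)) %% n)%N%:R / n%:R - (a%:R / n%:R - b%:R / n%:R) = 1 - ((a + (n - b)) %/ n)%N%:R :> R.
  rewrite natrM in E.
  have -> : ((a + (n - b)) %% n)%N%:R = a%:R + (n%:R - b%:R) - ((a + (n - b)) %/ n)%N%:R * n%:R :> R by rewrite -E; ring.
  by field.
by rewrite rpredB ?rpred1// rpred_nat.
Qed.

Lemma site_inj : injective (@site R d n).
Proof.
move=> x y /to_torus_eq/mxOverP h; apply/rowP => i; have := h 0 i; rewrite !mxE.
set a := x 0 i; set b := y 0 i => ab; apply: val_inj.
have aux (k : 'Z_n) : (k : nat)%:R / n%:R < 1 :> R /\ 0 <= (k : nat)%:R / n%:R :> R.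
  have kn : (k < n)%N by have := ltn_ord k; rewrite [X in (_ < X)%N -> _]Zp_cast.
  by split; [rewrite ltr_pdivrMr ?ltr0n ?(ltnW n1)// mul1r ltr_nat|rewrite divr_ge0].
have [a1 a2] := aux a; have [b1 b2] := aux b.
have : a%:R / n%:R - b%:R / n%:R = 0 :> R.
  have /intrP[m abm] := ab; rewrite abm; suff -> : m = 0 by [].
  have m1 : -1 < m%:~R :> R by rewrite -abm; lra.
  have m2 : m%:~R < 1 :> R by rewrite -abm; lra.
  move: m1 m2; rewrite -[1]/(1%:~R) -mulrNz !ltr_int; case: m {abm} => [[|m]|[|m]] //.
by move=> /subr0_eq /(congr1 (fun t => t * n%:R)); rewrite !divfK// => /eqP; rewrite eqr_nat => /eqP.
Qed.

Section empirical.
Variables (s : nat) (x0 : lattice d n) (d0 : (0 < d)%N).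
Implicit Types (sigma : {ffun lattice d n -> 'I_s}) (a : 'I_s).

Definition fuzzy_class sigma a : {set lattice d n} := [set x | (x != x0) && (sigma x == a)]%SET.

Lemma empiricalE sigma a (A : set (torus R d)) :
  empirical x0 sigma a A = ((n ^ d - 1)%N%:R^-1 * \sum_(x in fuzzy_class sigma a) (site R x \in A)%:R)%:E.
Proof.
rewrite /empirical EFinM; congr (_ * _)%E; rewrite -sumEFin.
rewrite [RHS]big_mkcond [LHS]big_mkcond; apply: eq_bigr => x _.
rewrite inE; case: (x != x0) => //=; rewrite diracE -EFinM.
by case: (sigma x == a); rewrite ?mul1r ?mul0r.
Qed.

Lemma card_punctured_gt0 : 0 < (n ^ d - 1)%N%:R :> R.
Proof.
rewrite ltr0n subn_gt0; case: d d0 => // m _.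
by rewrite (leq_trans n1)// -[X in (X <= _)%N]expn1 leq_pexp2l// ltnW.
Qed.

Lemma empirical_site sigma a x :
  empirical x0 sigma a [set site R x] = ((n ^ d - 1)%N%:R^-1 * (x \in fuzzy_class sigma a)%:R)%:E.
Proof.
rewrite empiricalE big_mkcond (bigD1 x)//= in_set1 eqxx big1 ?addr0.
  by case: (x \in _).
move=> y yx; case: ifP => // _; rewrite in_set1 (inj_eq site_inj) (negbTE yx)//.
Qed.

(** Distinct sites are distinct atoms, so conditioning on the empirical measure is the same as
    fixing all fuzzy spins off [x0]. *)
Lemma empirical_isP sigma sigma' (nu : 'I_s -> set (torus R d) -> \bar R) :
  empirical_is x0 sigma nu ->
  (empirical_is x0 sigma' nu <-> forall x, x != x0 -> sigma' x = sigma x).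
Proof.
move=> h; split => [h' x xx0|eq_off a A mA].
  have := h' (sigma x) _ (measurable_torus1 (site R x)).
  rewrite -(h (sigma x) _ (measurable_torus1 (site R x))) !empirical_site => -[].
  have k0 := card_punctured_gt0.
  move=> /(congr1 (fun t => (n ^ d - 1)%N%:R * t)); rewrite !mulrA divff ?lt0r_neq0// !mul1r.
  by rewrite !inE xx0 eqxx/=; case: eqP => // _ /esym/eqP; rewrite oner_eq0.
rewrite -h// !empiricalE; congr (_ * _)%:E; apply: eq_bigl => x; rewrite !inE.
by case: eqVneq => //= xx0; rewrite eq_off.
Qed.

(** [nu] is known only through its values on sets. [f] agrees at the sites with a combination of
    indicators of points, and elsewhere the error is at most [M * (1 - \sum_x 1 * I x v)], whose
    integral vanishes. *)
Lemma empirical_integral sigma a (nu : {finite_measure set (torus R d) -> \bar R}) f :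
  same_measure (empirical x0 sigma a) nu -> continuous f ->
  \int[nu]_v f v = (n ^ d - 1)%N%:R^-1 * \sum_(x in fuzzy_class sigma a) f (site R x).
Proof.
move=> h fc; have bf := continuous_bounded_measurable fc; have [_ [M fM]] := bf.
pose I (x : lattice d n) (u : torus R d) := \1_[set site R x] u : R.
have bI x : bounded_measurable (I x).
  split; first exact: measurable_indic (measurable_torus1 _).
  by exists 1 => u; rewrite /I indicE; case: (_ \in _); rewrite ?normr0 ?normr1.
have II x : \int[nu]_v I x v = (n ^ d - 1)%N%:R^-1 * (x \in fuzzy_class sigma a)%:R.
  rewrite /Rintegral integral_indic ?setIT//; last exact: measurable_torus1.
  by have /(congr1 fine)/esym := h _ (measurable_torus1 (site R x)); rewrite empirical_site; apply.
have bZ (g : lattice d n -> R) x : bounded_measurable (fun u => g x * I x u).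
  by apply: bounded_measurableM => //; exact: bounded_measurable_cst.
have sumI (g : lattice d n -> R) : \int[nu]_v (\sum_x g x * I x v) =
    (n ^ d - 1)%N%:R^-1 * \sum_(x in fuzzy_class sigma a) g x.
  rewrite Rint_sum; last by move=> x; exact: bZ.
  rewrite mulr_sumr [RHS]big_mkcond; apply: eq_bigr => x _.
  by rewrite RintZ// II; case: (x \in _); rewrite ?mulr1 ?mulr0// mulrC.
have bS (g : lattice d n -> R) : bounded_measurable (fun u => \sum_x g x * I x u).
  by apply: bounded_measurable_sum => x; exact: bZ.
have SE (g : lattice d n -> R) x : \sum_y g y * I y (site R x) = g x.
  rewrite (bigD1 x)//= big1 ?addr0 => [|y yx]; first by rewrite /I indicE in_set1 eqxx mulr1.
  by rewrite /I indicE in_set1 (inj_eq site_inj) eq_sym (negbTE yx) mulr0.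
have S0 (g : lattice d n -> R) u : (forall x : lattice d n, u != site R x) -> \sum_y g y * I y u = 0.
  by move=> ux; rewrite big1// => y _; rewrite /I indicE in_set1 (negbTE (ux y)) mulr0.
rewrite -(sumI (fun x => f (site R x))); apply/eqP; rewrite -subr_eq0 -RintB// -normr_le0.
apply: (@le_trans _ _ (\int[nu]_v (M * (1 - \sum_x 1 * I x v)))).
  have b1 : bounded_measurable (fun u => 1 - \sum_x 1 * I x u).
    by apply: bounded_measurableB; [exact: bounded_measurable_cst|exact: bS].
  have bM : bounded_measurable (fun u => M * (1 - \sum_x 1 * I x u)).
    by apply: bounded_measurableM => //; exact: bounded_measurable_cst.
  have bd : bounded_measurable (fun u => f u - \sum_x f (site R x) * I x u).
    exact: bounded_measurableB.
  have key u : `|f u - \sum_x f (site R x) * I x u| <= M * (1 - \sum_x 1 * I x u).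
    have [[x ->]|no] := pselect (exists x : lattice d n, u = site R x); first by rewrite !SE !subrr normr0 mulr0.
    have ux (x : lattice d n) : u != site R x by apply/eqP => e; apply: no; exists x.
    by rewrite !S0// !subr0 mulr1.
  rewrite ler_norml -RintN// !le_Rint//.
  by move=> u; have := key u; rewrite ler_norml => /andP[].
  exact: bounded_measurableN.
  by move=> u; have := key u; rewrite ler_norml => /andP[].
rewrite RintZ; last by apply: bounded_measurableB; [exact: bounded_measurable_cst|exact: bS].
rewrite RintB; [|exact: bounded_measurable_cst|exact: bS].
rewrite sumI Rint_cst mul1r.
have /(congr1 fine)/esym := h _ measurableT; rewrite empiricalE => e.
rewrite [X in X - _](e : _ = _)/=; under eq_bigr do rewrite in_setT.
by rewrite subrr mulr0.
Qed.

End empirical.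
End torus_points.

(** * The kernel as a quotient of Gibbs expectations *)

Section repin.
Local Close Scope classical_set_scope.
Context {V A : finType}.
Variable x0 : V.
Implicit Types (sigma : {ffun V -> A}) (a b : A).

Definition repin a sigma : {ffun V -> A} := [ffun x => if x == x0 then a else sigma x].

(** Resetting the spin at [x0] is a bijection between the two index sets. *)
Lemma sum_repin (R : nmodType) (P : pred {ffun V -> A}) (F : {ffun V -> A} -> R) a b :
  (forall sigma c, P (repin c sigma) = P sigma) ->
  (forall sigma c, F (repin c sigma) = F sigma) ->
  \sum_(sigma | P sigma && (sigma x0 == a)) F sigma
  = \sum_(sigma | P sigma && (sigma x0 == b)) F sigma.
Proof.
move=> PF FF; rewrite (reindex_onto (repin a) (repin b)); last first.
  move=> sigma /andP[_ /eqP sa]; apply/ffunP => x; rewrite !ffunE.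
  by case: eqP => // ->.
apply: eq_big => [sigma|sigma _]; last by rewrite FF.
rewrite PF ffunE eqxx eqxx andbT; congr (_ && _).
apply/eqP/eqP => [<-|sb]; first by rewrite ffunE eqxx.
by apply/ffunP => x; rewrite !ffunE; case: eqP => // ->.
Qed.

End repin.

Section fixed_size.
Local Close Scope classical_set_scope.
Context {R : realType} {d n q s : nat}.
Variables (J : torus R d -> R) (Js : forall v, J (- v) = J v).
Variables (beta : R) (T : 'I_q -> 'I_s) (C : 'I_s -> {set 'I_q}).
Hypothesis T_C : forall a i, (a \in C i) = (T a == i).
Hypotheses (n1 : (1 < n)%N) (d0 : (0 < d)%N).
Variables (x0 : lattice d n) (eta : {ffun lattice d n -> 'I_s}) (b0 : 'I_q).

Local Notation N := ((n ^ d)%:R : R).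
Local Notation V := (lattice d n).
Local Notation S := (fuzzy_class x0 eta).
Implicit Types (sigma : {ffun V -> 'I_q}) (p : V -> 'I_q -> R).

Definition punctured_kernel (x y : V) : R :=
  if (x != x0) && (y != x0) then beta * scaled_kernel J x y else 0.

Definition local_field sigma a : R :=
  (n ^ d)%:R^-1 * \sum_(y | y != x0) J (site R x0 - site R y) * (sigma y == a)%:R.

(* The spin at [x0] does not interact through [punctured_kernel]; freezing it to
   an arbitrary colour keeps the configurations indexed by the whole lattice. *)
Definition pinned_colors x : {set 'I_q} := if x == x0 then [set b0] else C (eta x).

Local Notation kappa := punctured_kernel.
Local Notation g := (gibbs_weight kappa).

(** The double sum splits into the term of [x0] with itself, a constant, the terms of [x0] with the
    other sites, counted twice by symmetry, and the rest. *)
Lemma potts_weightE sigma : potts_weight J beta sigma =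
  expR (beta * (n ^ d)%:R^-1 * J 0) * (g sigma * expR (2 * beta * local_field sigma (sigma x0))).
Proof.
rewrite /potts_weight /gibbs_weight -!expRD; congr expR.
pose f x y := beta * scaled_kernel J x y * (sigma x == sigma y)%:R.
have fC x y : f x y = f y x.
  by rewrite /f /scaled_kernel -Js opprB eq_sym.
have -> : beta / (n ^ d)%:R * (\sum_x \sum_y J (site R (x - y)) * (sigma x == sigma y)%:R) =
    \sum_x \sum_y f x y.
  rewrite mulr_sumr; apply: eq_bigr => x _; rewrite mulr_sumr; apply: eq_bigr => y _.
  by rewrite siteB// /f /scaled_kernel !mulrA.
have -> : \sum_x \sum_y kappa x y * (sigma x == sigma y)%:R = \sum_(x | x != x0) \sum_(y | y != x0) f x y.
  rewrite (bigD1 x0)//= big1 ?add0r; last by move=> y _; rewrite /kappa eqxx mul0r.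
  apply: eq_bigr => x xx0; rewrite (bigD1 x0)//= {1}/kappa eqxx andbF mul0r add0r.
  by apply: eq_bigr => y yx0; rewrite /kappa xx0 yx0.
rewrite (bigD1 x0)//= (bigD1 x0)//=.
under [X in _ + X = _]eq_bigr => x _ do rewrite (bigD1 x0)//= fC.
rewrite big_split/=.
have -> : 2 * beta * local_field sigma (sigma x0) = 2 * \sum_(y | y != x0) f x0 y.
  rewrite -mulrA; congr (2 * _); rewrite /local_field !mulr_sumr; apply: eq_bigr => y _.
  by rewrite /f /scaled_kernel [sigma x0 == _]eq_sym !mulrA.
have -> : f x0 x0 = beta * (n ^ d)%:R^-1 * J 0 by rewrite /f eqxx mulr1 /scaled_kernel subrr mulrA.
ring.
Qed.

Definition compatible : pred {ffun V -> 'I_q} :=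
  fun sigma => [forall x, (x != x0) ==> (T (sigma x) == eta x)].

Lemma compatible_repin c sigma : compatible (repin x0 c sigma) = compatible sigma.
Proof.
by apply: eq_forallb => x; rewrite ffunE; case: eqP.
Qed.

Lemma gibbs_weight_repin c sigma : g (repin x0 c sigma) = g sigma.
Proof.
rewrite /gibbs_weight; congr expR; apply: eq_bigr => x _; apply: eq_bigr => y _.
by rewrite /kappa !ffunE; do 2! case: eqP => //=; rewrite !mul0r.
Qed.

Lemma local_field_repin c sigma a : local_field (repin x0 c sigma) a = local_field sigma a.
Proof.
by rewrite /local_field; congr (_ * _); apply: eq_bigr => y yx0; rewrite ffunE (negbTE yx0).
Qed.

Lemma pinned_configs sigma : (sigma \in configs pinned_colors) = compatible sigma && (sigma x0 == b0).
Proof.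
rewrite inE; apply/forallP/andP => [h|[/forallP h1 /eqP h2] x].
  split; last by have := h x0; rewrite /pinned_colors eqxx inE.
  apply/forallP => x; apply/implyP => xx0; have := h x.
  by rewrite /pinned_colors (negbTE xx0) T_C.
rewrite /pinned_colors; case: eqP => [->|/eqP xx0]; first by rewrite h2 inE.
by rewrite T_C; exact: implyP (h1 x) xx0.
Qed.

Definition observable_sum i : R :=
  \sum_(sigma in configs pinned_colors) g sigma * \sum_(a in C i) expR (2 * beta * local_field sigma a).

(** The spin at [x0] is summed out over the colours of class [i]; after that nothing depends on it,
    and it is frozen to [b0]. *)
Lemma sum_potts_weight_class i :
  \sum_(sigma | compatible sigma && (T (sigma x0) == i)) potts_weight J beta sigma =
  expR (beta * (n ^ d)%:R^-1 * J 0) * observable_sum i.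
Proof.
rewrite (partition_big (fun sigma : {ffun V -> 'I_q} => sigma x0) (mem (C i)))/=; last first.
  by move=> sigma /andP[_]; rewrite T_C.
rewrite /observable_sum.
under [in RHS]eq_bigr do rewrite mulr_sumr.
rewrite exchange_big/= mulr_sumr; apply: eq_bigr => a aC.
rewrite mulr_sumr.
under [RHS]eq_bigl do rewrite pinned_configs.
rewrite [RHS](@sum_repin _ _ x0 _ compatible _ b0 a); first last.
  by move=> sigma c; rewrite gibbs_weight_repin local_field_repin.
  by move=> sigma c; rewrite compatible_repin.
apply: eq_big => [sigma|sigma /andP[_ /eqP <-]]; last by rewrite potts_weightE.
rewrite -andbA; congr (_ && _); case: (eqVneq (sigma x0) a) => [->|_]; last by rewrite andbF.
by rewrite andbT -T_C aC.
Qed.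

Lemma fuzzy_kernelE k (nun : 'I_s -> set (torus R d) -> \bar R) :
  empirical_is x0 eta nun ->
  fuzzy_kernel J beta T x0 k nun = observable_sum k / \sum_i observable_sum i.
Proof.
move=> h; rewrite /fuzzy_kernel /fuzzy_prob /potts_prob.
set Z := \sum_sigma potts_weight J beta sigma.
have Z0 : Z != 0.
  rewrite lt0r_neq0// /Z (bigD1 [ffun=> b0])//= ltr_pwDl ?expR_gt0//.
  by apply: sumr_ge0 => sigma _; exact: expR_ge0.
have mem_emp sigma : asbool (empirical_is x0 (fuzzy T sigma) nun) = compatible sigma.
  apply/asboolP/forallP => [/(empirical_isP n1 d0 _ h) e x|e].
    by apply/implyP => xx0; rewrite -e// ffunE.
  apply/(empirical_isP n1 d0 _ h) => x xx0; rewrite ffunE; apply/eqP.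
  exact: implyP (e x) xx0.
have -> : \sum_(sigma in fuzzy T (n:=n) @^-1: ([set sigma | asbool (empirical_is x0 sigma nun)] :&: [set sigma : {ffun V -> 'I_s} | sigma x0 == k])) potts_weight J beta sigma =
   expR (beta * (n ^ d)%:R^-1 * J 0) * observable_sum k.
  rewrite -sum_potts_weight_class; apply: eq_bigl => sigma.
  by rewrite !inE mem_emp ffunE.
have -> : \sum_(sigma in fuzzy T (n:=n) @^-1: [set sigma | asbool (empirical_is x0 sigma nun)]) potts_weight J beta sigma =
   expR (beta * (n ^ d)%:R^-1 * J 0) * \sum_i observable_sum i.
  rewrite mulr_sumr; under [RHS]eq_bigr do rewrite -sum_potts_weight_class.
  rewrite (partition_big (fun sigma : {ffun V -> 'I_q} => T (sigma x0)) predT)//=.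
  by apply: eq_bigr => i _; apply: eq_bigl => sigma; rewrite !inE mem_emp.
have e0 : expR (beta * (n ^ d)%:R^-1 * J 0) != 0 by rewrite lt0r_neq0// expR_gt0.
by rewrite -mulf_div divff ?mulr1 ?invr_eq0// -mulf_div divff// mul1r.
Qed.

Lemma sum_classes (F : V -> R) : \sum_(x | x != x0) F x = \sum_j \sum_(x in S j) F x.
Proof.
rewrite (partition_big eta predT)//=; apply: eq_bigr => j _.
by apply: eq_bigl => x; rewrite inE.
Qed.

Lemma profile_class_profile p j : is_profile pinned_colors p -> class_profile (S j) (C j) p.
Proof.
move=> [p0 p1 pC] x; rewrite inE => /andP[xx0 /eqP xj]; split => //.
rewrite -(p1 x) [RHS](bigID (mem (C j)))/= [X in _ = _ + X]big1 ?addr0// => a aC.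
by apply: pC; rewrite /pinned_colors (negbTE xx0) xj.
Qed.

(** The pinned site has a deterministic law, hence no entropy, and no interaction; sites of
    different fuzzy classes share no colour, so their laws have zero overlap. *)
Lemma free_energy_classes p : is_profile pinned_colors p ->
  free_energy kappa p = \sum_j class_free_energy (S j) (C j) (@scaled_kernel R d J n) beta p.
Proof.
move=> pP; have [p0 p1 pC] := pP.
have p0C x a j : x \in S j -> a \notin C j -> p x a = 0.
  by rewrite inE => /andP[xx0 /eqP xj] aC; apply: pC; rewrite /pinned_colors (negbTE xx0) xj.
have sumC (F : 'I_q -> R) j : (forall a, a \notin C j -> F a = 0) -> \sum_a F a = \sum_(a in C j) F a.
  by move=> F0; rewrite (bigID (mem (C j)))/= [X in _ + X]big1 ?addr0.
rewrite /free_energy /class_free_energy sumrB; congr (_ - _).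
  rewrite /neg_entropy (bigD1 x0)//= big1 ?add0r => [|a _]; last first.
    have [->|ab0] := eqVneq a b0; last by rewrite pC ?mul0r// /pinned_colors eqxx inE.
    suff -> : p x0 b0 = 1 by rewrite ln1 mulr0.
    rewrite -(p1 x0) (bigD1 b0)//= big1 ?addr0// => c cb0.
    by rewrite pC// /pinned_colors eqxx inE.
  rewrite sum_classes; apply: eq_bigr => j _; apply: eq_bigr => x xS.
  by apply: sumC => a aC; rewrite (p0C _ _ _ xS aC) mul0r.
rewrite -mulr_sumr /pair_energy (bigD1 x0)//= big1 ?add0r; last first.
  by move=> y _; rewrite /kappa eqxx mul0r.
rewrite sum_classes mulr_sumr; apply: eq_bigr => j _; rewrite mulr_sumr; apply: eq_bigr => x xS.
have xx0 : x != x0 by move: xS; rewrite inE => /andP[].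
rewrite (bigD1 x0)//= {1}/kappa eqxx andbF mul0r add0r mulr_sumr.
rewrite sum_classes (bigD1 j)//= [X in _ + X]big1 ?addr0; last first.
  move=> l lj; apply: big1 => y yS; rewrite big1 ?mulr0// => a _.
  have [aj|aj] := boolP (a \in C j); last by rewrite (p0C _ _ _ xS aj) mul0r.
  rewrite (p0C _ _ _ yS) ?mulr0//; move: aj; rewrite !T_C => /eqP ->.
  by rewrite eq_sym.
apply: eq_bigr => y yS; have yx0 : y != x0 by move: yS; rewrite inE => /andP[].
rewrite /kappa xx0 yx0 -mulrA; congr (beta * (_ * _)).
by apply: sumC => a aC; rewrite (p0C _ _ _ xS aC) mul0r.
Qed.

Definition glued_profile (ps : 'I_s -> V -> 'I_q -> R) x a : R :=
  if x == x0 then (a == b0)%:R else if a \in C (eta x) then ps (eta x) x a else 0.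

Lemma glued_profileP ps : (forall j, class_profile (S j) (C j) (ps j)) ->
  is_profile pinned_colors (glued_profile ps).
Proof.
move=> h; split=> [x a|x|x a].
  rewrite /glued_profile; case: ifP => [_|/negbT xx0]; first exact: ler0n.
  have [//|/(_ a)] := h (eta x) x; first by rewrite inE xx0 eqxx.
  by case: ifP.
  case: (boolP (x == x0)) => xx0.
    under eq_bigr do rewrite /glued_profile xx0.
    by rewrite (bigD1 b0)//= eqxx big1 ?addr0// => a /negbTE ->.
  under eq_bigr do rewrite /glued_profile (negbTE xx0).
  have [|_ <-] := h (eta x) x; first by rewrite inE xx0 eqxx.
  by rewrite -big_mkcond.
rewrite /glued_profile /pinned_colors; case: ifP => [_|_ /negbTE -> //].
by rewrite inE => /negbTE ->.
Qed.

Lemma glued_class_free_energy ps j :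
  class_free_energy (S j) (C j) (@scaled_kernel R d J n) beta (glued_profile ps) =
  class_free_energy (S j) (C j) (@scaled_kernel R d J n) beta (ps j).
Proof.
have E x a : x \in S j -> a \in C j -> glued_profile ps x a = ps j x a.
  by rewrite inE => /andP[xx0 /eqP <-] aC; rewrite /glued_profile (negbTE xx0) aC.
rewrite /class_free_energy; congr (_ - _ * _).
  by apply: eq_bigr => x xS; apply: eq_bigr => a aC; rewrite !E.
apply: eq_bigr => x xS; apply: eq_bigr => y yS; congr (_ * _).
by apply: eq_bigr => a aC; rewrite !E.
Qed.

(** * Block approximation at finite volume *)

Section blocks.
Variables (L : nat) (c : 'I_L.+1 -> torus R d) (cell : torus R d -> 'I_L.+1) (e1 : R).
Hypothesis cellP : forall u v, `|J (u - v) - J (c (cell u) - v)| <= e1.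
Hypotheses (beta0 : 0 <= beta) (J0 : forall v, 0 < J v).

(** The pinned site forms a block of its own, so that the allowed colours are constant on blocks. *)
Definition block (x : V) : option ('I_L.+1 * 'I_s) :=
  if x == x0 then None else Some (cell (site R x), eta x).

Lemma block_pinned_colors x y : block x = block y -> pinned_colors x = pinned_colors y.
Proof.
by rewrite /block /pinned_colors; case: eqP => _; case: eqP => // _ [_ ->].
Qed.

Lemma punctured_kernel_ge0 x y : 0 <= kappa x y.
Proof. by rewrite /kappa; case: ifP => // _; rewrite mulr_ge0// mulr_ge0 ?invr_ge0// ltW. Qed.

(** Moving one argument within its cell passes through the centre and costs [2 * e1]; both arguments
    move. *)
Lemma punctured_kernel_block x x' y y' : block x = block x' -> block y = block y' ->
  `|kappa x y - kappa x' y'| <= 4 * e1 * beta / N.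
Proof.
have e10 : 0 <= e1 by apply: le_trans (normr_ge0 _) (cellP 0 0).
have N0 : 0 < N by rewrite ltr0n expn_gt0 (ltnW n1).
have bd0 : 0 <= 4 * e1 * beta / N by rewrite divr_ge0 ?(ltW N0)// mulr_ge0// mulr_ge0.
rewrite /block /kappa; case: eqP => _; case: eqP => //= _; first by rewrite subrr normr0.
move=> [cx _]; case: eqP => _; case: eqP => //= _; first by rewrite subrr normr0.
move=> [cy _].
rewrite -mulrBr /scaled_kernel -mulrBr normrM normrM (ger0_norm beta0) ger0_norm ?invr_ge0//.
rewrite -[leRHS]mulrA mulrC -[leRHS]mulrA mulrA [_ / N]mulrC mulrA ler_wpM2r//.
rewrite mulrC ler_wpM2r ?invr_ge0//.
have key a b : cell a = cell b -> forall v, `|J (a - v) - J (b - v)| <= 2 * e1.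
  move=> ab v; rewrite -(subrKA (J (c (cell a) - v))) (le_trans (ler_normD _ _))//.
  by rewrite mulr_natl mulr2n lerD// distrC ab.
rewrite -(subrKA (J (site R x' - site R y))) (le_trans (ler_normD _ _))//.
have -> : 4 * e1 = 2 * e1 + 2 * e1 by ring.
by rewrite lerD ?key// -[J (_ x' - _ y)]Js -[J (_ x' - _ y')]Js !opprB key.
Qed.

Lemma pinned_gibbs_prob_le (ps : 'I_s -> V -> 'I_q -> R) (D : R) (bad : {set {ffun V -> 'I_q}}) :
  (forall j, class_profile (S j) (C j) (ps j)) ->
  {subset bad <= configs pinned_colors} ->
  (forall sigma, sigma \in bad ->
    \sum_j class_free_energy (S j) (C j) (@scaled_kernel R d J n) beta (ps j) + D <=
    \sum_j class_free_energy (S j) (C j) (@scaled_kernel R d J n) beta (profile block sigma)) ->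
  \sum_(sigma in bad) g sigma <=
    ((n ^ d).+1 ^ ((L.+1 * s).+1 * q))%N%:R * expR (8 * e1 * beta * N - D)
    * \sum_(sigma in configs pinned_colors) g sigma.
Proof.
move=> psP bc gap.
have N0 : N != 0 by rewrite lt0r_neq0// ltr0n expn_gt0 (ltnW n1).
have := @gibbs_prob_le R V 'I_q _ block pinned_colors kappa (4 * e1 * beta / N) D (glued_profile ps) bad
  punctured_kernel_ge0 punctured_kernel_block (glued_profileP psP).
rewrite (card_lattice n1) card_option card_prod !card_ord.
have -> : 2 * (4 * e1 * beta / N) * N ^+ 2 - D = 8 * e1 * beta * N - D by field.
apply=> sigma sb; rewrite !free_energy_classes; first last.
  exact: glued_profileP.
  by apply: profileP => [x y|]; [exact: block_pinned_colors|exact: bc].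
by under eq_bigr do rewrite glued_class_free_energy; exact: gap.
Qed.

(** [J (x0 - _)] is replaced by its value at cell centres, for which spins and block averages give
    the same sum; the replacement is made on both sides, at cost [e1] each. *)
Lemma local_field_profile sigma i a : sigma \in configs pinned_colors -> a \in C i ->
  `|local_field sigma a - (n ^ d)%:R^-1 * \sum_(x in S i) J (site R x0 - site R x) * profile block sigma x a|
    <= 2 * e1.
Proof.
move=> sc aC.
have e10 : 0 <= e1 by apply: le_trans (normr_ge0 _) (cellP 0 0).
have N0 : 0 < N by rewrite ltr0n expn_gt0 (ltnW n1).
pose j x := if x \in S i then J (c (cell (site R x)) - site R x0) else 0.
have jB x y : block x = block y -> j x = j y.
  by rewrite /block /j !inE; case: (x == x0); case: (y == x0) => //= -[-> ->].
have SP := sum_profile (R := R) (blk := block) (f := fun x b => j x * (b == a)%:R) sigma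
  (fun x y b h => congr1 (fun t => t * (b == a)%:R) (jB x y h)).
have SE : \sum_x j x * profile block sigma x a = \sum_x j x * (sigma x == a)%:R.
  rewrite -SP; apply: eq_bigr => x _; rewrite (bigD1 a)//= eqxx mulr1 big1 ?addr0 1?mulrC//.
  by move=> b /negbTE ->; rewrite !mulr0.
have toS (F : V -> R) : \sum_x j x * F x = \sum_(x in S i) J (c (cell (site R x)) - site R x0) * F x.
  rewrite [RHS]big_mkcond; apply: eq_bigr => x _; rewrite /j; case: ifP => //; by rewrite mul0r.
have lfE : local_field sigma a = (n ^ d)%:R^-1 * \sum_(x in S i) J (site R x0 - site R x) * (sigma x == a)%:R.
  rewrite /local_field; congr (_ * _); rewrite [RHS]big_mkcond [LHS]big_mkcond.
  apply: eq_bigr => x _; rewrite inE; case: (eqVneq x x0) => //= xx0.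
  case: (eqVneq (sigma x) a) => [sxa|]; last by rewrite mulr0 if_same.
  move: sc; rewrite pinned_configs => /andP[/forallP/(_ x)]; rewrite xx0 /= sxa => /eqP Ta _.
  by move: aC; rewrite T_C Ta => ->.
have diff (F : V -> R) : (forall x, 0 <= F x <= 1) ->
    `|(n ^ d)%:R^-1 * \sum_(x in S i) J (site R x0 - site R x) * F x - (n ^ d)%:R^-1 * \sum_x j x * F x| <= e1.
  move=> F01; rewrite toS -mulrBr -sumrB; apply: (class_average_le n1) => //.
  move=> x _; rewrite -mulrBl normrM; have /andP[F0 F1] := F01 x.
  rewrite -[leRHS]mulr1 (ger0_norm F0) ler_pM// -[J (_ x0 - _ x)]Js opprB.
  exact: cellP.
rewrite lfE; set j1 := _ * \sum_(x in S i) _; set j2 := _ * \sum_(x in S i) _.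
have d1 : `|j1 - (n ^ d)%:R^-1 * \sum_x j x * (sigma x == a)%:R| <= e1.
  by apply: (diff (fun x => (sigma x == a)%:R)) => x; case: eqP; rewrite lexx ler01.
have d2 : `|j2 - (n ^ d)%:R^-1 * \sum_x j x * profile block sigma x a| <= e1.
  apply: (diff (fun x => profile block sigma x a)) => x; rewrite profile_ge0/=.
  rewrite -(@profile1 R _ _ _ block sigma x) (bigD1 a)//= lerDl sumr_ge0// => b _.
  exact: profile_ge0.
rewrite SE in d2; rewrite -(subrKA ((n ^ d)%:R^-1 * \sum_x j x * (sigma x == a)%:R)).
by rewrite (le_trans (ler_normD _ _))// mulr_natl mulr2n lerD// distrC.
Qed.

End blocks.
End fixed_size.

(** * The limit *)

Section volume.
Context {R : realType} {d : nat}.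
Variable d0 : (0 < d)%N.

Lemma leq_volume n : (1 < n)%N -> (n <= n ^ d)%N.
Proof. by move=> n1; rewrite -[X in (X <= _)%N]expn1 leq_pexp2l// ltnW. Qed.

Lemma volumeV_cvg : (n ^ d)%:R^-1 @[n --> \oo] --> (0 : R).
Proof.
apply/cvgr0Pnorm_le => e e0; near=> n.
have n1 : (1 < n)%N by near: n; exact: nbhs_infty_gt.
have ne : e^-1 <= n%:R by near: n; exact: nbhs_infty_ger.
have N0 : 0 < (n ^ d)%:R :> R by rewrite ltr0n expn_gt0 (ltnW n1).
rewrite ger0_norm ?invr_ge0// invf_ple ?posrE//.
by rewrite (le_trans ne)// ler_nat leq_volume.
Unshelve. all: by end_near. Qed.

(** Raise [m * (N + 1) <= expR (a * N / (c + 1))] to the power [c + 1]: the spare factor [N + 1]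
    sends the product to [0]. *)
Lemma exp_beats_poly (c : nat) (a e : R) : 0 < a -> 0 < e ->
  \forall n \near \oo, ((n ^ d).+1 ^ c)%N%:R * expR (- (a * (n ^ d)%:R)) <= e.
Proof.
move=> a0 e0; pose al := a / c.+1%:R; pose m := Num.min 1 al.
have al0 : 0 < al by rewrite divr_gt0.
have m0 : 0 < m by rewrite lt_min ltr01.
near=> n.
have n1 : (1 < n)%N by near: n; exact: nbhs_infty_gt.
have ne : (e * m ^+ c.+1)^-1 <= n%:R by near: n; exact: nbhs_infty_ger.
set N := (n ^ d)%N.
have hexp : m * N.+1%:R <= expR (al * N%:R).
  apply: le_trans (expR_ge1Dx _); rewrite -natr1 mulrDr mulr1 addrC lerD ?ge_min ?lexx//.
  by rewrite ler_wpM2r// ge_min lexx orbT.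
have -> : a * N%:R = c.+1%:R * (al * N%:R) by rewrite mulrA [_ * al]mulrC divfK// pnatr_eq0.
rewrite expRN expRM_natl ler_pdivrMr ?exprn_gt0 ?expR_gt0//.
apply: (@le_trans _ _ (e * (m * N.+1%:R) ^+ c.+1)); last first.
  by rewrite ler_wpM2l ?(ltW e0)// lerXn2r// ?nnegrE ?mulr_ge0 ?expR_ge0// ltW.
have em0 : 0 < e * m ^+ c.+1 by rewrite mulr_gt0// exprn_gt0.
rewrite natrX exprMn mulrA [N.+1%:R ^+ c.+1]exprS mulrA ler_peMl ?exprn_ge0//.
rewrite mulrC -ler_pdivrMr// mul1r (le_trans ne)// ler_nat.
by rewrite (leq_trans (leq_volume n1)).
Unshelve. all: by end_near. Qed.

End volume.

(** * Passage to the limit in the conditional law *)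

Section gibbs_limit.
Context {R : realType} {d : nat}.
Variables (d0 : (0 < d)%N) (J : torus R d -> R).
Variables (J0 : forall v, 0 < J v) (Jc : continuous J) (Js : forall v, J (- v) = J v).
Hypothesis J_int : \int[torus_lebesgue R d]_v J v = 1.
Variables (beta : R) (beta0 : 0 <= beta) (q s : nat).
Variables (T : 'I_q -> 'I_s) (C : 'I_s -> {set 'I_q}).
Hypothesis T_C : forall a i, (a \in C i) = (T a == i).
Variables (x : forall n, lattice d n) (u : torus R d).
Hypothesis x_cvg : site R (x n) @[n --> \oo] --> u.
Variable nun : nat -> 'I_s -> {finite_measure set (torus R d) -> \bar R}.
Variable eta : forall n, {ffun lattice d n -> 'I_s}.
Hypothesis nun_eta : forall n, (1 < n)%N -> empirical_is (x n) (eta n) (nun n).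
Variable nu : 'I_s -> {finite_measure set (torus R d) -> \bar R}.
Hypothesis nu_cvg : weak_cvg nun nu.

Local Notation S j := (fun n => fuzzy_class (x n) (eta n) j).

Lemma component_cvg j (f : torus R d -> R) : continuous f ->
  \int[nun n j]_v f v @[n --> \oo] --> \int[nu j]_v f v.
Proof.
move=> fc; pose F (a : 'I_s) : torus R d -> R := if a == j then f else fun=> 0.
have Fc a : continuous (F a) by rewrite /F; case: ifP => // _; exact: cst_continuous.
have sumF (mu : 'I_s -> {finite_measure set (torus R d) -> \bar R}) :
    \sum_a \int[mu a]_v F a v = \int[mu j]_v f v.
  rewrite (bigD1 j)//= big1 ?addr0 => [|a aj]; first by rewrite /F eqxx.
  by rewrite /F (negbTE aj) Rint_cst mul0r.
have := nu_cvg Fc; rewrite sumF; apply: cvg_trans; apply: near_eq_cvg.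
by apply: nearW => n; rewrite sumF.
Qed.

(** Empirical measures are normalized by [n ^ d - 1], the Gibbs weights by [n ^ d]; the ratio tends
    to [1]. *)
Lemma class_cvg j (f : torus R d -> R) : continuous f ->
  (n ^ d)%:R^-1 * \sum_(y in S j n) f (site R y) @[n --> \oo] --> \int[nu j]_v f v.
Proof.
move=> fc; have h : (1 - (n ^ d)%:R^-1) * \int[nun n j]_v f v @[n --> \oo] --> \int[nu j]_v f v.
  rewrite -[X in _ --> X]mul1r -[X in X * _]subr0; apply: cvgM; last exact: component_cvg.
  by apply: cvgB; [exact: cvg_cst|exact: volumeV_cvg].
apply: cvg_trans h; apply: near_eq_cvg; near=> n.
have n1 : (1 < n)%N by near: n; exact: nbhs_infty_gt.
have k0 := @card_punctured_gt0 R d n n1 d0.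
have N0 : 0 < (n ^ d)%:R :> R by rewrite ltr0n expn_gt0 (ltnW n1).
rewrite (empirical_integral n1 (nun_eta n1 j) fc) mulrA; congr (_ * _).
have NB : (n ^ d - 1)%N%:R = (n ^ d)%:R - 1 :> R by rewrite natrB// expn_gt0 (ltnW n1).
by rewrite NB in k0 *; field; rewrite !lt0r_neq0.
Unshelve. all: by end_near. Qed.

(** The sum over a class is at most the full Riemann sum, so the limit lies below Lebesgue measure
    on nonnegative continuous functions. *)
Lemma limit_dominated j : nu j `<< torus_lebesgue R d.
Proof.
apply: dominates_of_continuous => f fc f0.
suff h : \forall n \near \oo, (n ^ d)%:R^-1 * \sum_(y in S j n) f (site R y) <=
    (n ^ d)%:R^-1 * \sum_(y : lattice d n) f (site R y).
  exact: (ler_cvg_to (class_cvg fc) (riemann_sum fc) h).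
near=> n; have n1 : (1 < n)%N by near: n; exact: nbhs_infty_gt.
by rewrite ler_wpM2l ?invr_ge0// [leRHS](bigID (mem (S j n)))/= lerDl sumr_ge0.
Unshelve. all: by end_near. Qed.

(** By translation invariance a full row sum is the Riemann sum of [J], whose integral is [1]. *)
Lemma row_sum_le j e : 0 < e -> \forall n \near \oo, forall y, y \in S j n ->
  \sum_(y' in S j n) @scaled_kernel R d J n y y' <= 1 + e.
Proof.
move=> e0; have h := riemann_sum Jc; rewrite J_int in h; near=> n => y _.
have n1 : (1 < n)%N by near: n; exact: nbhs_infty_gt.
have hn : `|1 - (n ^ d)%:R^-1 * \sum_(y : lattice d n) J (site R y)| <= e.
  by near: n; exact: (@cvgr_dist_le _ _ _ _ _ _ _ h).
apply: (@le_trans _ _ (\sum_y' @scaled_kernel R d J n y y')).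
  rewrite [leRHS](bigID (mem (S j n)))/= lerDl sumr_ge0// => y' _.
  exact: scaled_kernel_ge0.
have -> : \sum_y' @scaled_kernel R d J n y y' = (n ^ d)%:R^-1 * \sum_(y : lattice d n) J (site R y).
  rewrite -mulr_sumr; congr (_ * _).
  rewrite [RHS](reindex_inj (inv_inj (subKr y)))/=; apply: eq_bigr => y' _.
  by rewrite siteB.
by move: hn; rewrite distrC ler_norml => /andP[_]; rewrite lerBlDl.
Unshelve. all: by end_near. Qed.

Section temperature.
Variables (r : 'I_s -> nat) (r_pos : forall i, (0 < r i)%N).
Hypothesis C_card : forall i, #|C i| = r i.
Hypothesis h_temp : (forall i, (r i <= 2)%N) \/
            (exists rstar, is_rstar r rstar /\ beta < beta_c R rstar).

(** Size two is the Ising case. Size one satisfies the Pinsker inequality for every [b], and a size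
    of at least three is at least [rstar], so the temperature hypothesis provides [b > beta]. *)
Lemma class_concentrated i :
  class_concentration J beta (S i) (fun n => site R (x n)) (C i) (limit_weight J beta (r i) u (nu i)).
Proof.
have [r2|r2] := eqVneq (r i) 2%N.
  have /cards2P[a1 [a2 [a12 CE]]] : #|C i| == 2%N by rewrite C_card r2.
  rewrite r2; apply: (ising_class_concentration Jc J0 Js beta0 (limit_dominated i) x_cvg (@class_cvg i) CE a12).
have [b bb hb] : exists2 b : R, beta < b & pinsker b (r i).
  have [r1|r1] := eqVneq (r i) 1%N.
    by exists (beta + 1); [rewrite ltrDl|rewrite r1; exact: pinsker1].
  have r3 : (3 <= r i)%N by have := r_pos i; move: r1 r2; case: (r i) => [|[|[|]]].
  case: h_temp => [/(_ i)|[rs [[rs3 _ rsi] bc]]]; first by rewrite leqNgt r3.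
  by apply: beta_c_pinsker bc => //; rewrite rs3 rsi.
rewrite -(C_card i) in hb r2 *.
apply: (potts_class_concentration Jc J0 Js beta0 (limit_dominated i) x_cvg (@class_cvg i) bb hb _ r2).
  by rewrite C_card.
exact: row_sum_le.
Qed.

Lemma limit_weight_gt0 i : 0 < limit_weight J beta (r i) u (nu i).
Proof.
rewrite /limit_weight !mulr_gt0 ?expR_gt0 ?ltr0n//.
have [->|r2] := eqVneq (r i) 2%N.
  by rewrite (Dcomp2E Jc J0 Js beta0 (limit_dominated i)) cosh_gt0.
by rewrite /Dcomp /Dfun (negbTE r2) if_same ltr01.
Qed.

Variable b0 : 'I_q.

Local Notation confs n := (configs (@pinned_colors d n q s C (x n) (eta n) b0)).
Local Notation g n := (gibbs_weight (@punctured_kernel R d n J beta (x n))).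
Local Notation G n := (\sum_(sigma in confs n) g n sigma).
Local Notation obs n i sigma := (\sum_(a in C i) expR (2 * beta * local_field J (x n) sigma a)).

Lemma local_field_le n (sigma : {ffun lattice d n -> 'I_q}) a : (1 < n)%N ->
  local_field J (x n) sigma a <= J_sup J.
Proof.
move=> n1; apply: le_trans (ler_norm _) _.
have -> : local_field J (x n) sigma a =
   (n ^ d)%:R^-1 * \sum_(y in [set y | y != x n]%SET) J (site R (x n) - site R y) * (sigma y == a)%:R.
  by rewrite /local_field; congr (_ * _); apply: eq_bigl => y; rewrite inE.
apply: (class_average_le n1); first exact: (J_sup_ge0 Jc J0).
move=> y _; rewrite normrM -[leRHS]mulr1 ler_pM ?(J_norm_le Jc J0)//.
by case: eqP; rewrite ?normr1 ?normr0.
Qed.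

Lemma pinned_partition_gt0 n : (1 < n)%N -> 0 < G n.
Proof.
move=> n1; pose sg : {ffun lattice d n -> 'I_q} :=
  [ffun y => if y == x n then b0 else odflt b0 [pick a in C (eta n y)]].
have sgC : sg \in confs n.
  rewrite inE; apply/forallP => y; rewrite /pinned_colors ffunE.
  case: eqP => _; first by rewrite inE.
  case: pickP => //= no; have := r_pos (eta n y).
  by rewrite -C_card (eq_card0 no).
by rewrite (bigD1 sg)//= ltr_pwDl ?expR_gt0// sumr_ge0// => sigma _; exact: expR_ge0.
Qed.

(** The quotient is the Gibbs expectation of an observable bounded by [M]. It is within [e / 2] of
    the limit off a bad set, and the bad set has probability at most [e / 2 / (M + L + 1)]. *)
Lemma observable_cvg i :
  observable_sum J beta C (x n) (eta n) b0 i / G n @[n --> \oo] -->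
    limit_weight J beta (r i) u (nu i).
Proof.
set L := limit_weight _ _ _ _ _.
have L0 : 0 < L by exact: limit_weight_gt0.
apply/cvgrPdist_le => e e0.
have s0 : 0 < s%:R :> R by rewrite ltr0n (leq_ltn_trans _ (ltn_ord i)).
pose b1 := beta + 1; have b10 : 0 < b1 by rewrite ltr_pwDr.
have e4 : 0 < e / 4 by rewrite divr_gt0.
have [dl dl0 conc] := @class_concentrated i _ e4.
pose Me := expR (2 * beta * J_sup J); pose M := q%:R * Me.
have Me0 : 0 < Me by exact: expR_gt0.
have M0 : 0 <= M by rewrite mulr_ge0// ltW.
have [k k0 kP] : exists2 k : R, 0 < k & forall t, `|t| < k -> `|1 - expR t| <= e / 4 / (M + 1).
  have /nbhs_ballP[k /= k0 kP] : \forall t \near (0 : R), `|expR 0 - expR t| <= e / 4 / (M + 1).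
    by apply: (@cvgr_dist_le _ _ _ _ _ _ _ (@continuous_expR R 0)); rewrite divr_gt0// ltr_pwDr.
  exists k => // t tk; rewrite -[X in `|X - _|]expR0; apply: kP.
  by rewrite /ball/= sub0r normrN.
(* Fine enough that passing to block profiles changes the observable by at most [e / 4], and that
   the block error uses at most [dl / 4] of the gap per site. *)
pose e1 : R := Num.min (k / (8 * b1)) (dl / (32 * b1)).
have e10 : 0 < e1 by rewrite lt_min !divr_gt0// mulr_gt0.
have be1 : 4 * beta * e1 <= k / 2 /\ 8 * e1 * beta <= dl / 4.
  have h : beta * e1 <= b1 * e1 by rewrite ler_wpM2r ?(ltW e10)// lerDl.
  have h1 : e1 * (8 * b1) <= k by rewrite -ler_pdivlMr ?mulr_gt0// ge_min lexx.
  have h2 : e1 * (32 * b1) <= dl by rewrite -ler_pdivlMr ?mulr_gt0// ge_min lexx orbT.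
  by rewrite -[4 * _ * _]mulrA -[8 * _ * _]mulrA [e1 * beta]mulrC; split; lra.
have [Ln [c cnet]] := J_net Jc e10.
have [cell cellP] := choice cnet.
have es : 0 < dl / 4 / s%:R by rewrite !divr_gt0.
(* Every class is nearly optimal up to [dl / 4 / s] per site, so that all [s] classes together lose
   at most [dl / 4]; only class [i] has to gain [dl] on the bad set. *)
pose near_optimal n j (ps : lattice d n -> 'I_q -> R) := class_profile (S j n) (C j) ps /\
  forall p, class_profile (S j n) (C j) p ->
    class_free_energy (S j n) (C j) (@scaled_kernel R d J n) beta ps - dl / 4 / s%:R * (n ^ d)%:R
      <= class_free_energy (S j n) (C j) (@scaled_kernel R d J n) beta p /\
    (j = i -> e / 4 < `|observable J beta (S j) (fun n => site R (x n)) (C j) p - L| ->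
      class_free_energy (S j n) (C j) (@scaled_kernel R d J n) beta ps + (dl - dl / 4 / s%:R) * (n ^ d)%:R
      <= class_free_energy (S j n) (C j) (@scaled_kernel R d J n) beta p).
have conc_all : \forall n \near \oo, forall j, exists ps, @near_optimal n j ps.
  apply: filter_forall => j.
  have [->|ji] := eqVneq j i.
    apply: filterS (conc _ es) => n [ps psP h]; exists ps; split=> // p pP.
    by have [h1 h2] := h _ pP; split.
  have [dj _ concj] := @class_concentrated j _ ltr01.
  apply: filterS (concj _ es) => n [ps psP h]; exists ps; split=> // p pP.
  have [h1 _] := h _ pP; split => // e'; by rewrite e' eqxx in ji.
pose cc := ((Ln.+1 * s).+1 * q)%N.
have ML : 0 < M + L + 1 by rewrite ltr_pwDr// addr_ge0// ltW.
have e2' : 0 < e / 2 / (M + L + 1) by rewrite !divr_gt0.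
have dl2 : 0 < dl / 2 by rewrite divr_gt0.
have decay := @exp_beats_poly R d d0 cc (dl / 2) _ dl2 e2'.
near=> n.
have n1 : (1 < n)%N by near: n; exact: nbhs_infty_gt.
have N0 : 0 < (n ^ d)%:R :> R by rewrite ltr0n expn_gt0 (ltnW n1).
have decn : ((n ^ d).+1 ^ cc)%N%:R * expR (- (dl / 2 * (n ^ d)%:R)) <= e / 2 / (M + L + 1) by near: n.
have concn : forall j, exists ps, @near_optimal n j ps by near: n.
have [ps /all_and2[psP psgap]] := choice concn.
pose blk := @block R d n s (x n) (eta n) Ln cell.
have obs_ge0 sigma : 0 <= obs n i sigma by apply: sumr_ge0 => a _; exact: expR_ge0.
have exp_le (sigma : {ffun lattice d n -> 'I_q}) a : expR (2 * beta * local_field J (x n) sigma a) <= Me.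
  by rewrite ler_expR ler_wpM2l ?mulr_ge0//; exact: local_field_le.
have obs_le sigma : obs n i sigma <= M.
  apply: (@le_trans _ _ (\sum_(a in C i) Me)); first by apply: ler_sum => a _.
  by rewrite sumr_const -[Me *+ _]mulr_natl ler_wpM2r ?(ltW Me0)// ler_nat (leq_trans (max_card _))// card_ord.
have obs_profile sigma : sigma \in confs n ->
    `|obs n i sigma - observable J beta (S i) (fun n => site R (x n)) (C i) (profile blk sigma)| <= e / 4.
  move=> sc; rewrite /observable -sumrB; apply: le_trans (ler_norm_sum _ _ _) _.
  apply: (@le_trans _ _ (\sum_(a in C i) Me * (e / 4 / (M + 1)))).
    apply: ler_sum => a aC.
    have := local_field_profile Js T_C n1 cellP sc aC; rewrite -/blk.
    set h := _ * \sum_(y in _) _; move=> hd.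
    have -> : expR (2 * beta * local_field J (x n) sigma a) - expR (2 * beta * h) =
       expR (2 * beta * local_field J (x n) sigma a) * (1 - expR (2 * beta * (h - local_field J (x n) sigma a))).
      by rewrite mulrBr mulr1 -expRD; congr (_ - expR _); ring.
    rewrite normrM (ger0_norm (expR_ge0 _)) ler_pM ?expR_ge0//; apply: kP.
    rewrite normrM ger0_norm ?mulr_ge0// distrC; apply: (@le_lt_trans _ _ (k / 2)); last by rewrite ltr_pdivrMr// ltr_pMr// ltr1n.
    apply: le_trans be1.1; have -> : 4 * beta * e1 = 2 * beta * (2 * e1) by ring.
    by rewrite ler_wpM2l// mulr_ge0.
  rewrite sumr_const -[_ *+ _]mulr_natl.
  apply: (@le_trans _ _ (M * (e / 4 / (M + 1)))).
    rewrite /M -[leRHS]mulrA ler_wpM2r//.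
      by rewrite mulr_ge0 ?(ltW Me0)// divr_ge0 ?(ltW e4)// addr_ge0.
    by rewrite ler_nat (leq_trans (max_card _))// card_ord.
  rewrite mulrCA ler_piMr ?(ltW e4)// ler_pdivrMr ?ltr_pwDr// mul1r lerDl//.
pose bad := [set sigma in confs n | e / 2 < `|obs n i sigma - L|]%SET.
have bad_le : \sum_(sigma in bad) g n sigma <= e / 2 / (M + L + 1) * G n.
  have := @pinned_gibbs_prob_le R d n q s J Js beta T C T_C n1 (x n) (eta n) b0 Ln c cell e1 cellP beta0 J0 ps
    (3 / 4 * dl * (n ^ d)%:R) bad psP.
  move=> /(_ _ _)/le_trans; apply.
    by move=> sigma; rewrite inE => /andP[].
    move=> sigma; rewrite inE => /andP[sc far].
    have PP j : class_profile (S j n) (C j) (profile blk sigma : lattice d n -> 'I_q -> R).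
      apply: (profile_class_profile (b0 := b0)); apply: profileP => // y y'; exact: block_pinned_colors.
    have far' : e / 4 < `|observable J beta (S i) (fun n => site R (x n)) (C i) (profile blk sigma) - L|.
      have h1 := obs_profile _ sc.
      have h2 : `|obs n i sigma - L| <= `|obs n i sigma - observable J beta (S i) (fun n => site R (x n)) (C i) (profile blk sigma)|
         + `|observable J beta (S i) (fun n => site R (x n)) (C i) (profile blk sigma) - L|.
        by rewrite -(subrKA (observable J beta (S i) (fun n => site R (x n)) (C i) (profile blk sigma))) ler_normD.
      by rewrite -(ltrD2l (e / 4)) (lt_le_trans _ (le_trans h2 (lerD h1 (lexx _))))// (le_lt_trans _ far)//; lra.
    (* The gap [dl] of class [i] minus the shares of all classes; after the block error [dl / 2] per
       site remains, the rate in [decay]. *)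
    have -> : 3 / 4 * dl * (n ^ d)%:R = \sum_(j < s) ((j == i)%:R * dl - dl / 4 / s%:R) * (n ^ d)%:R.
      rewrite -mulr_suml sumrB sumr_const card_ord -mulr_suml (bigD1 i)//= eqxx big1 ?addr0; last first.
        by move=> j /negbTE ->.
      by rewrite -[_ *+ s]mulr_natr divfK ?lt0r_neq0// mul1r; field.
    rewrite -big_split; apply: ler_sum => j _ /=.
    have [h1 h2] := psgap j _ (PP j).
    case: (eqVneq j i) => [ji|_]; last by rewrite mul0r sub0r mulNr.
    by rewrite mul1r; apply: h2 => //; rewrite ji.
  rewrite ler_wpM2r ?(ltW (pinned_partition_gt0 n1))//; apply: le_trans decn.
  rewrite ler_wpM2l// ler_expR.
  have h : 8 * e1 * beta * (n ^ d)%:R <= dl / 4 * (n ^ d)%:R by rewrite ler_wpM2r ?be1.2// ltW.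
  move: h; move: (8 * e1 * beta * _) => t h.
  by have : dl / 4 * (n ^ d)%:R = 3 / 4 * dl * (n ^ d)%:R - dl / 2 * (n ^ d)%:R; [field|lra].
have G0 := pinned_partition_gt0 n1.
rewrite distrC /observable_sum.
have -> : (\sum_(sigma in confs n) g n sigma * obs n i sigma) / G n - L =
   (\sum_(sigma in confs n) g n sigma * (obs n i sigma - L)) / G n.
  under [in RHS]eq_bigr do rewrite mulrBr.
  by rewrite sumrB -mulr_suml mulrBl [_ * L / _]mulrAC divff ?mul1r// lt0r_neq0.
rewrite normrM (ger0_norm (ltW (_ : 0 < (G n)^-1))) ?invr_gt0// ler_pdivrMr//.
apply: le_trans (ler_norm_sum _ _ _) _.
apply: (@le_trans _ _ (\sum_(sigma in confs n) (g n sigma * (e / 2) + (sigma \in bad)%:R * g n sigma * (M + L)))).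
  apply: ler_sum => sigma sc; have g0 : 0 < g n sigma by exact: expR_gt0.
  rewrite normrM (gtr0_norm g0) inE sc /=.
  have [h|h] := leP `|obs n i sigma - L| (e / 2).
    by rewrite mul0r mul0r addr0 ler_pM2l.
  rewrite mul1r -mulrDr ler_pM2l//.
  apply: (@le_trans _ _ (M + L)); last by rewrite lerDr divr_ge0// ltW.
  apply: le_trans (ler_normB _ _) _; rewrite (gtr0_norm L0) (ger0_norm (obs_ge0 _)).
  by rewrite lerD2r.
rewrite big_split/= -!mulr_suml.
have -> : \sum_(sigma in confs n) (sigma \in bad)%:R * g n sigma = \sum_(sigma in bad) g n sigma.
  rewrite big_mkcond [RHS]big_mkcond; apply: eq_bigr => sigma _.
  case: (boolP (sigma \in bad)) => [sb|_]; last by rewrite mul0r if_same.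
  by move: sb; rewrite inE => /andP[-> _]; rewrite mul1r.
apply: le_trans (lerD (lexx _) (ler_wpM2r _ bad_le)) _; first by rewrite addr_ge0// ltW.
have h : e / 2 / (M + L + 1) * (M + L) <= e / 2.
  rewrite -mulrA ler_piMr ?divr_ge0 ?(ltW e0)// mulrC ler_pdivrMr// mul1r lerDl//.
have -> : e * G n = e / 2 * G n + e / 2 * G n by rewrite -mulrDl -splitr.
rewrite mulrAC [_ * (e / 2)]mulrC lerD2l.
by rewrite ler_pM2r.
Unshelve. all: by end_near. Qed.

Lemma fuzzy_kernel_cvg k :
  fuzzy_kernel J beta T (x n) k (nun n) @[n --> \oo] -->
    limit_weight J beta (r k) u (nu k) / \sum_i limit_weight J beta (r i) u (nu i).
Proof.
pose o n i := observable_sum J beta C (x n) (eta n) b0 i.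
have h : (o n k / G n) / (\sum_i o n i / G n) @[n --> \oo] -->
    limit_weight J beta (r k) u (nu k) / \sum_i limit_weight J beta (r i) u (nu i).
  apply: cvgM; first exact: observable_cvg.
  apply: cvgV; last by apply: cvg_big => [|i _]; [exact: add_continuous|exact: observable_cvg].
  rewrite lt0r_neq0// (bigD1 k)//= ltr_pwDl ?limit_weight_gt0// sumr_ge0// => i _.
  by rewrite ltW// limit_weight_gt0.
apply: cvg_trans h; apply: near_eq_cvg; near=> n.
have n1 : (1 < n)%N by near: n; exact: nbhs_infty_gt.
rewrite (fuzzy_kernelE Js beta T_C n1 d0 b0 k (nun_eta n1)) -/(o n k) -mulr_suml.
by rewrite -mulf_div divff ?mulr1// invr_eq0 lt0r_neq0// pinned_partition_gt0.
Unshelve. all: by end_near. Qed.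

End temperature.
End gibbs_limit.

Theorem theorem2p16 (R : realType) (d : nat) (hd : (0 < d)%N)
  (J : torus R d -> R) (J_pos : forall v, 0 < J v) (J_cont : continuous J)
  (J_sym : forall v, J (- v) = J v)
  (J_int : \int[torus_lebesgue R d]_v J v = 1)
  (beta : R) (hbeta : 0 <= beta)
  (q s : nat) (hs : (1 < s < q)%N)
  (r : 'I_s -> nat) (r_pos : forall i, (0 < r i)%N)
  (r_sum : (\sum_i r i)%N = q)
  (C : 'I_s -> {set 'I_q}) (C_card : forall i, #|C i| = r i)
  (T : 'I_q -> 'I_s) (T_C : forall a i, (a \in C i) = (T a == i))
  (h_temp : (forall i, (r i <= 2)%N) \/
            (exists rstar, is_rstar r rstar /\ beta < beta_c R rstar))
  (x : forall n, lattice d n) (u : torus R d)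
  (x_cvg : site R (x n) @[n --> \oo] --> u)
  (nun : nat -> 'I_s -> {finite_measure set (torus R d) -> \bar R})
  (nun_emp : forall n, (1 < n)%N -> is_empirical (x n) (nun n))
  (nu : 'I_s -> {finite_measure set (torus R d) -> \bar R})
  (nu_cvg : weak_cvg nun nu)
  (k : 'I_s) :
  fuzzy_kernel J beta T (x n) k (nun n) @[n --> \oo] -->
    limit_weight J beta (r k) u (nu k) /
      \sum_i limit_weight J beta (r i) u (nu i).
Proof.
have q0 : (0 < q)%N by case/andP: hs => _; exact: leq_ltn_trans.
have etaP n : {eta : {ffun lattice d n -> 'I_s} | (1 < n)%N -> empirical_is (x n) eta (nun n)}.
  (* For [n <= 1] the type ['Z_n] is not [Z / nZ] and nothing is claimed; a constant configuration
     fills in. *)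
  apply: cid; have [n1|] := ltnP 1 n; last by exists [ffun=> k].
  by have [eta etaP] := nun_emp n n1; exists eta.
exact: (fuzzy_kernel_cvg hd J_pos J_cont J_sym J_int hbeta T_C x_cvg (fun n => svalP (etaP n))
  nu_cvg r_pos C_card h_temp (Ordinal q0)).
Qed.
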